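(* Let $n\le3$, let $\Omega\subset\mathbb{R}^n$ be a smooth bounded domain, let $\gamma\in C^3([0,\infty))$ satisfy $\gamma>0$ and $\gamma'\le0$ on $(0,\infty)$, let $u_0\in C^0(\overline\Omega)$, $u_0\ge0$, $u_0\not\equiv0$, and let $\mu>0$. Let $(u,v)$ be the classical solution, on its maximal existence interval $[0,T_{\max})$, of $$\begin{cases} u_t=\Delta(\gamma(v)u)+\mu u(1-u), & x\in\Omega,\ t>0,\\ -\Delta v+v=u, & x\in\Omega,\ t>0,\\ \partial_\nu u=\partial_\nu v=0, & x\in\partial\Omega,\ t>0,\\ u(x,0)=u_0(x), & x\in\Omega.\end{cases}$$ Then there exists $C>0$, depending (for the given $\gamma$) only on $\|u_0\|_{L^1(\Omega)}$ and $\Omega$, such that for any $(x,t)\in\Omega\times[0,T_{\max})$, $$v(x,t)\le v_0(x)+1+\frac{C}{\mu},$$ where $v_0:=(I-\Delta)^{-1}u_0$.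
   Context: $(I-\Delta)^{-1}$ is the inverse of $I-\Delta$ with homogeneous Neumann boundary condition on $\Omega$. The problem has a unique classical solution $(u,v)\in\big(C^0(\overline\Omega\times[0,T_{\max}))\cap C^{2,1}(\overline\Omega\times(0,T_{\max}))\big)^2$ with maximal existence time $T_{\max}\in(0,\infty]$. *)

(* Defs.v *)
From HB Require Import structures.
From mathcomp Require Import all_boot all_order all_algebra.
From mathcomp Require Import all_classical all_reals all_analysis.
Set Implicit Arguments.
Unset Strict Implicit.
Unset Printing Implicit Defensive.
Import Order.TTheory GRing.Theory Num.Theory.
Import numFieldNormedType.Exports.

Local Open Scope classical_set_scope.
Local Open Scope ring_scope.

(* Row vectors carry the product sigma-algebra of the Borel sets of R. *)
Section rv_measurable.
Context {R : realType} {n : nat}.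

Let coord (i : 'I_n) (x : 'rV[R]_n) : measurableTypeR R := x ord0 i.

Let rv_set0 : g_sigma_preimage coord set0.
Proof. exact: sigma_algebra0. Qed.

Let rv_setC A : g_sigma_preimage coord A -> g_sigma_preimage coord (~` A).
Proof. exact: sigma_algebraC. Qed.

Let rv_bigcup (F : (set 'rV[R]_n)^nat) : (forall i, g_sigma_preimage coord (F i)) ->
  g_sigma_preimage coord (\bigcup_i (F i)).
Proof. exact: sigma_algebra_bigcup. Qed.

HB.instance Definition _ := @isMeasurable.Build default_measure_display
  'rV[R]_n (g_sigma_preimage coord) rv_set0 rv_setC rv_bigcup.

Lemma measurable_coord (i : 'I_n) :
  measurable_fun [set: 'rV[R]_n] (fun x : 'rV[R]_n => x ord0 i).
Proof.
move=> _ Y mY; rewrite setTI; apply: sub_sigma_algebra => /=.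
rewrite -bigcup_seq/=; exists i => /=; first by rewrite mem_index_enum.
by exists Y => //; rewrite setTI.
Qed.

Lemma measurable_fun_rv d (T : measurableType d) (f : T -> 'rV[R]_n) :
  (forall i, measurable_fun [set: T] (fun x => f x ord0 i)) ->
  measurable_fun [set: T] f.
Proof.
move=> mf; apply: (@measurability _ _ T ('rV[R]_n) setT f
  (\big[setU/set0]_(i < n) preimage_set_system setT (coord i) measurable) erefl).
move=> _ [B + <-].
rewrite -bigcup_seq => -[i _ [Y mY <-]].
by have := mf i measurableT Y mY; rewrite !setTI.
Qed.

End rv_measurable.

(* The library's sigma-finite instance on \x is shadowed by its instances for
   subprobabilities, hence not found by unification. *)
Lemma product_sigma_finite d1 d2 (T1 : measurableType d1)
    (T2 : measurableType d2) (R : realType)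
    (m1 : {sigma_finite_measure set T1 -> \bar R})
    (m2 : {sigma_finite_measure set T2 -> \bar R}) :
  sigma_finite setT (m1 \x m2)%E.
Proof.
have /sigma_finiteP[F [TF ndF Foo]] := sigma_finiteT m1.
have /sigma_finiteP[G [TG ndG Goo]] := sigma_finiteT m2.
exists (fun n => F n `*` G n).
  rewrite -setXTT TF TG predeqE => -[x y]; split.
    move=> [/= [n _ Fnx] [k _ Gky]]; exists (maxn n k) => //; split.
    - by move: x Fnx; exact/subsetPset/ndF/leq_maxl.
    - by move: y Gky; exact/subsetPset/ndG/leq_maxr.
  by move=> [n _ []/= ? ?]; split; exists n.
move=> k; have [? ?] := Foo k; have [? ?] := Goo k.
split; first exact: measurableX.
by rewrite product_measure1E// lte_mul_pinfty// ge0_fin_numE.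
Qed.

Section lebesgue_rv.
Context {R : realType}.

Section step.
Context {n : nat} (mu : {sigma_finite_measure set 'rV[R]_n -> \bar R}).

Definition rv_cons (p : measurableTypeR R * 'rV[R]_n) : 'rV[R]_n.+1 :=
  row_mx (p.1%:M : 'M[R]_1) p.2.

Definition rv_uncons (x : 'rV[R]_n.+1) : measurableTypeR R * 'rV[R]_n :=
  (x ord0 ord0, \row_i x ord0 (lift ord0 i)).

Lemma rv_consK : cancel rv_cons rv_uncons.
Proof.
move=> [x y]; congr pair.
  by rewrite mxE; case: splitP => // j _; rewrite !mxE (ord1 j) eqxx mulr1n.
apply/rowP => i; rewrite !mxE; case: splitP => j; first by rewrite (ord1 j).
by rewrite /= /bump/= => /eqP; rewrite eqn_add2l => /eqP/val_inj ->.
Qed.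

Lemma rv_unconsK : cancel rv_uncons rv_cons.
Proof.
move=> x; apply/rowP => i; rewrite !mxE; case: splitP => j ij.
  by rewrite (ord1 j) mxE eqxx mulr1n; congr (x _ _); apply: val_inj; rewrite /= ij (ord1 j).
by rewrite mxE; congr (x _ _); apply: val_inj; rewrite /= ij.
Qed.

Lemma measurable_rv_cons : measurable_fun setT rv_cons.
Proof.
apply: measurable_fun_rv => i.
have [->|[j ->]] : i = ord0 \/ exists j, i = lift ord0 j.
- by case: (unliftP ord0 i) => [j ->|->]; [right; exists j|left].
- have -> : (fun p => rv_cons p ord0 ord0) = fst.
    by apply/funext => p; rewrite -[in RHS](rv_consK p).
  exact: measurable_fst.
- have -> : (fun p => rv_cons p ord0 (lift ord0 j)) = (fun y : 'rV[R]_n => y ord0 j) \o snd.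
    by apply/funext => p /=; rewrite -[in RHS](rv_consK p) /= mxE.
  by apply: measurableT_comp => //; exact: measurable_coord.
Qed.

Lemma measurable_rv_uncons : measurable_fun setT rv_uncons.
Proof.
apply/measurable_fun_pairP; split; first exact: measurable_coord.
apply: measurable_fun_rv => i.
have -> : (fun x => (snd \o rv_uncons) x ord0 i) = fun x => x ord0 (lift ord0 i).
  by apply/funext => x /=; rewrite mxE.
exact: measurable_coord.
Qed.


Definition lebesgue_step : set 'rV[R]_n.+1 -> \bar R :=
  pushforward (lebesgue_measure \x mu)%E rv_cons.

Let step0 : lebesgue_step set0 = 0%E.
Proof. by rewrite /lebesgue_step /pushforward preimage_set0 measure0. Qed.

Let step_ge0 A : (0 <= lebesgue_step A)%E.
Proof. exact: (measure_ge0 (lebesgue_measure \x mu)%E). Qed.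

Let step_sigma_additive : semi_sigma_additive lebesgue_step.
Proof.
have mf := measurable_rv_cons.
move=> F mF tF mUF; rewrite /lebesgue_step /pushforward preimage_bigcup.
apply: measure_semi_sigma_additive.
- by move=> k; rewrite -[X in measurable X]setTI; exact: mf.
- apply/trivIsetP => /= i j _ _ ij; rewrite -preimage_setI.
  by move/trivIsetP : tF => /(_ _ _ _ _ ij) ->//; rewrite preimage_set0.
- by rewrite -preimage_bigcup -[X in measurable X]setTI; exact: mf.
Qed.

HB.instance Definition _ :=
  isMeasure.Build _ _ _ lebesgue_step step0 step_ge0 step_sigma_additive.

Let step_sigma_finite : sigma_finite setT lebesgue_step.
Proof.
have [F FT Foo] := product_sigma_finite (@lebesgue_measure R) mu.
exists (fun k => rv_uncons @^-1` F k); first by rewrite -preimage_bigcup -FT.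
move=> k; have [mF Fk] := Foo k; split.
  by rewrite -[X in measurable X]setTI; exact: measurable_rv_uncons.
rewrite /lebesgue_step /pushforward -comp_preimage.
by rewrite (_ : _ \o _ = id) //; apply/funext => p /=; rewrite rv_consK.
Qed.

HB.instance Definition _ :=
  Measure_isSigmaFinite.Build _ _ _ lebesgue_step step_sigma_finite.

End step.

(* The n-dimensional Lebesgue measure, as an iterated product measure. *)
Fixpoint lebesgue_rv (n : nat) : {sigma_finite_measure set 'rV[R]_n -> \bar R} :=
  if n is m.+1 then lebesgue_step (lebesgue_rv m) else \d_(0 : 'rV[R]_0).

End lebesgue_rv.

Section calculus.
Context {R : realType} {n : nat}.
Local Notation V := 'rV[R]_n.
Implicit Types (f g : V -> R) (Omega : set V) (x nu : V).

Definition pderivable (i : 'I_n) f x : Prop := derivable f x (delta_mx ord0 i).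

Definition pderiv (i : 'I_n) f : V -> R := 'D_(delta_mx ord0 i) f.

Definition laplacian f x : R := \sum_(i < n) pderiv i (pderiv i f) x.

Fixpoint Ck (k : nat) f : Prop :=
  match k with
  | 0 => continuous f
  | k'.+1 => continuous f /\
      forall i, (forall x, pderivable i f x) /\ Ck k' (pderiv i f)
  end.

Definition smooth f : Prop := forall k, Ck k f.

(* This is only used for open sets, for which it is the topological boundary. *)
Definition bdry Omega : set V := closure Omega `\` Omega.

(* rho is a smooth local defining function of Omega at x: near x, Omega is the
   set where rho < 0, and the gradient of rho does not vanish at x. *)
Definition local_defining Omega x (rho : V -> R) : Prop :=
  [/\ smooth rho, exists i, pderiv i rho x != 0 &
      \forall y \near x, Omega y <-> rho y < 0].

Definition smooth_bounded_domain Omega : Prop :=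
  [/\ Omega !=set0, open Omega, connected Omega, bounded_set Omega &
      forall x, bdry Omega x -> exists rho, local_defining Omega x rho].

(* The outward unit normal for the Euclidean norm (the library's norm on row
   vectors is the sup norm); it does not depend on the choice of rho. *)
Definition outward_normal Omega x nu : Prop :=
  exists2 rho, local_defining Omega x rho &
    nu = (Num.sqrt (\sum_(i < n) pderiv i rho x ^+ 2))^-1 *:
         \row_(i < n) pderiv i rho x.

(* The normal derivative at a boundary point is computed with the limit of the
   gradient from inside Omega. *)
Definition neumann Omega f : Prop :=
  forall x nu, bdry Omega x -> outward_normal Omega x nu ->
    (fun y => \sum_(i < n) pderiv i f y * nu ord0 i)
      @ within Omega (nbhs x) --> (0 : R).

(* The restriction of h to A has a continuous extension to B. *)
Definition extends_continuously (X : topologicalType) (A B : set X)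
    (h : X -> R) : Prop :=
  exists2 k : X -> R, {within B, continuous k} & forall p, A p -> h p = k p.

Definition continuous_on_cylinder Omega (I : set R) (w : V -> R -> R) : Prop :=
  {within closure Omega `*` I, continuous (fun p : V * R => w p.1 p.2)}.

(* w belongs to C^{2,1}(closure Omega x I), for I open: the derivatives exist in
   Omega x I and extend continuously to closure Omega x I. *)
Definition C21 Omega (I : set R) (w : V -> R -> R) : Prop :=
  let ext (h : V * R -> R) :=
    extends_continuously (Omega `*` I) (closure Omega `*` I) h in
  [/\ continuous_on_cylinder Omega I w,
      (forall x t, Omega x -> I t -> derivable (w x) t 1) /\
        ext (fun p => derive1 (w p.1) p.2),
      forall i, (forall x t, Omega x -> I t -> pderivable i (w^~ t) x) /\
        ext (fun p => pderiv i (w^~ p.2) p.1) &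
      forall i j,
        (forall x t, Omega x -> I t -> pderivable j (pderiv i (w^~ t)) x) /\
        ext (fun p => pderiv j (pderiv i (w^~ p.2)) p.1)].

End calculus.

(* g belongs to C^k([0, +oo)); values of g at negative arguments play no role. *)
Definition Ck_halfline {R : realType} (k : nat) (g : R -> R) : Prop :=
  [/\ {within `[0, +oo[, continuous g},
      forall (j : nat) (s : R), (j < k)%N -> 0 < s -> derivable (derive1n j g) s 1 &
      forall j, (j <= k)%N ->
        extends_continuously [set s : R | 0 < s] `[0, +oo[ (derive1n j g)].

Section sobolev.
Context {R : realType} {n : nat}.
Local Notation V := 'rV[R]_n.
Local Notation leb := (@lebesgue_rv R n).
Implicit Types (f phi : V -> R) (G H : 'I_n -> V -> R) (Omega : set V).

Definition L1norm Omega f : R := \int[leb]_(x in Omega) `|f x|.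

Definition L2 Omega f : Prop :=
  measurable_fun Omega f /\
  leb.-integrable Omega (fun x => (f x ^+ 2)%:E).

Definition test_function Omega phi : Prop :=
  [/\ smooth phi, compact (closure [set x | phi x != 0]) &
      closure [set x | phi x != 0] `<=` Omega].

(* f belongs to the Sobolev space H^1(Omega) and has weak gradient G. *)
Definition H1 Omega f G : Prop :=
  L2 Omega f /\
  forall i, L2 Omega (G i) /\
    forall phi, test_function Omega phi ->
      \int[leb]_(x in Omega) (f x * pderiv i phi x) =
      - \int[leb]_(x in Omega) (G i x * phi x).

(* w = (I - Delta)^{-1} f, with homogeneous Neumann boundary condition. The
   variational formulation over the whole of H^1(Omega) is used, since w need
   not be twice differentiable when f is merely continuous; the boundary
   condition is the natural one. *)
Definition neumann_resolvent Omega f (w : V -> R) : Prop :=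
  exists2 G, H1 Omega w G &
    forall phi H, H1 Omega phi H ->
      \int[leb]_(x in Omega) (\sum_(i < n) G i x * H i x + w x * phi x) =
      \int[leb]_(x in Omega) (f x * phi x).

End sobolev.

Section problem.
Context {R : realType} {n : nat}.
Local Notation V := 'rV[R]_n.
Implicit Types (Omega : set V) (gamma : R -> R) (u v : V -> R -> R).

Definition time_co (T : \bar R) : set R := [set t | 0 <= t /\ (t%:E < T)%E].
Definition time_oo (T : \bar R) : set R := [set t | 0 < t /\ (t%:E < T)%E].

(* Since gamma is only given on [0, +oo), v >= 0 is part of the meaning of
   gamma(v). *)
Definition classical_solution Omega gamma (mu : R) (u0 : V -> R)
    (T : \bar R) u v : Prop :=
  [/\ [/\ continuous_on_cylinder Omega (time_co T) u,
          continuous_on_cylinder Omega (time_co T) v,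
          C21 Omega (time_oo T) u & C21 Omega (time_oo T) v],
      forall (x : V) (t : R), closure Omega x -> time_co T t -> 0 <= v x t,
      forall x t, Omega x -> time_oo T t ->
        derive1 (u x) t = laplacian (fun y => gamma (v y t) * u y t) x
                      + mu * u x t * (1 - u x t) /\
        - laplacian (v^~ t) x + v x t = u x t,
      forall t, time_oo T t ->
        neumann Omega (u^~ t) /\ neumann Omega (v^~ t) &
      forall x, Omega x -> u x 0 = u0 x].

Definition maximal_classical_solution Omega gamma (mu : R) (u0 : V -> R)
    (T : \bar R) u v : Prop :=
  [/\ (0 < T)%E, classical_solution Omega gamma mu u0 T u v &
      ~ exists T' u' v',
          [/\ (T < T')%E, classical_solution Omega gamma mu u0 T' u' v' &
              forall (x : V) (t : R), closure Omega x -> time_co T t ->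
                u' x t = u x t /\ v' x t = v x t]].

End problem.

(* Main.v *)
(* Put [K = 1 + gamma 0 / mu] and [lam = gamma 0 + mu].  Applying the resolvent
   [(I - Delta)^-1] to the equation for [u] gives
     [v_t + gamma(v) u + lam v = (I - Delta)^-1 (gamma(v) u + mu u (1 - u) + lam u)],
   whose right-hand side is at most [lam^2 / mu = lam K], because [0 <= u],
   [gamma(v) <= gamma 0] and [2 lam u - mu u^2 <= lam^2 / mu].  Hence
   [v_t + lam (v - K) <= 0], and Gronwall's lemma yields [v(t) <= v(0) + K], so that
   [C = gamma 0] works whatever the mass of [u0].

   The identity needs [v_t] to be twice differentiable in space, which is not
   known; its consequence is instead obtained from the elliptic comparison
   principle for difference quotients of [v] in time.  The sign of [u] comes from
   the linear parabolic equation satisfied by [gamma(v) u].  Both maximum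
   principles use a global smooth defining function of the domain, built from the
   local ones with a partition of unity.

   Finally [v(0) = v0], although [v0] is only a weak solution: by Green's formula
   [v(t)] is a weak solution, and testing with the difference bounds
   [v(t) - v0] in [L2] by [u(t) - u0].  Green's formula against an arbitrary [H1]
   function needs no trace theorem: the weak gradient is tested on the field
   [grad v] cut off near the boundary, and the error vanishes in the limit because
   [grad v . grad rho] is dominated by the defining function [rho]. *)

(* The solution is [C21] only for positive times. At time 0 both [u] and [v] are merely continuous,
   so [v_t] has no a priori bound near time 0, and [v(0)] is not known to have a Laplacian. Two
   steps are shaped by this. The zero-order coefficient in the linear equation for [gamma(v) u]
   contains [v_t]; its bound comes from the resolvent comparison with [lam = 0], used once for each
   sign. And [v(0) = v0] is reached only as a limit of positive times.

   The rate [lam] is optimal: with a rate [a] instead, the maximum over [u] of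
   [(lam + a) u - mu u^2] is [(lam + a)^2 / (4 mu)], and its quotient by [a] is smallest at
   [a = lam], where it is [lam / mu = 1 + gamma 0 / mu]. Hence the additive constant is exactly 1.

   Boundary maxima are excluded by adding [eps rho], where [rho] grows strictly into the domain, and
   not by a Hopf lemma. Test functions are smooth while the cut-off [grad v] is only C^1, so the
   weak gradient is first extended to C^1 fields; this takes an approximation of a function together
   with one partial derivative, obtained by integrating Bernstein polynomials. *)
Require Import Defs.
From mathcomp Require Import all_boot all_order all_algebra.
From mathcomp Require Import all_classical all_reals all_analysis.
From mathcomp Require Import measurable_realfun.
From mathcomp Require Import ring lra.
Set Implicit Arguments.
Unset Strict Implicit.
Unset Printing Implicit Defensive.
Import Order.TTheory GRing.Theory Num.Theory.
Import numFieldNormedType.Exports.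

Local Open Scope classical_set_scope.
Local Open Scope ring_scope.

(* Stated over an abstract topological space: on row vectors, unification
   unfolds the neighborhood filter and misses its filter structure. *)
Section pointwise_continuity.
Context {R : realType} {T : topologicalType}.
Implicit Types (f g : T -> R) (x : T).

Lemma for_contD f g x : {for x, continuous f} -> {for x, continuous g} ->
  {for x, continuous (fun y => f y + g y)}.
Proof. exact: continuousD. Qed.

Lemma for_contM f g x : {for x, continuous f} -> {for x, continuous g} ->
  {for x, continuous (fun y => f y * g y)}.
Proof. exact: continuousM. Qed.

Lemma for_cont_comp (h : R -> R) f x : {for x, continuous f} ->
  {for f x, continuous h} -> {for x, continuous (fun y => h (f y))}.
Proof. exact: continuous_comp. Qed.

Lemma near_all (P : T -> Prop) x : (forall y, P y) -> \forall y \near x, P y.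
Proof. by move=> HP; apply: nearW. Qed.

Lemma near_gt f x (c : R) : {for x, continuous f} -> c < f x ->
  \forall y \near x, c < f y.
Proof. by move=> fx cf; exact: (cvgr_gt _ fx). Qed.

Lemma near_lt f x (c : R) : {for x, continuous f} -> f x < c ->
  \forall y \near x, f y < c.
Proof. by move=> fx cf; exact: (cvgr_lt _ fx). Qed.

Lemma near_open (A : set T) x : open A -> A x -> \forall y \near x, A y.
Proof. by move=> oA Ax; exact: open_nbhs_nbhs. Qed.

Lemma near_and (P Q : set T) x : (\forall y \near x, P y) ->
  (\forall y \near x, Q y) -> \forall y \near x, P y /\ Q y.
Proof. exact: filterI. Qed.

End pointwise_continuity.

(** * Directional derivatives *)

Section directional.
Context {R : realType} {n : nat}.
Local Notation V := 'rV[R]_n.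
Implicit Types (f g : V -> R) (x d : V).

(** Directional derivatives are derivatives of the restriction to a line, so the one-variable chain
    rule and mean value theorem carry over. *)
Lemma is_derive_lineP f x d (t df : R) :
  is_derive (x + t *: d) d f df <-> is_derive t 1 (fun s : R => f (x + s *: d)) df.
Proof.
have E : (fun h : R => h^-1 *: ((fun s : R => f (x + s *: d)) (h *: 1 + t) - f (x + t *: d))) =
         (fun h : R => h^-1 *: (f (h *: d + (x + t *: d)) - f (x + t *: d))).
  apply/funext => h; congr (_ *: (f _ - _)).
  by rewrite scalerDl -mulr_algl !scaler1 mulr1 addrCA.
split=> -[fd fE]; split.
- by move: fd; rewrite /derivable /= => fd; rewrite E.
- by rewrite -fE /derive /= E.
- by move: fd; rewrite /derivable /= => fd; rewrite -E.
- by rewrite -fE /derive /= -E.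
Qed.

Lemma is_derive_line f x d (t df : R) :
  is_derive (x + t *: d) d f df -> is_derive t 1 (fun s : R => f (x + s *: d)) df.
Proof. by move/is_derive_lineP. Qed.

Lemma is_derive_line0 f x d (df : R) :
  is_derive x d f df <-> is_derive (0 : R) 1 (fun s : R => f (x + s *: d)) df.
Proof.
split=> [h|/is_derive_lineP]; last by rewrite scale0r addr0.
by apply: is_derive_line; rewrite scale0r addr0.
Qed.

Lemma is_derive_chain (h : R -> R) g x d (a b : R) :
  is_derive (g x) 1 h a -> is_derive x d g b ->
  is_derive x d (fun y => h (g y)) (a * b).
Proof.
move=> ha /is_derive_line0 gb; apply/is_derive_line0.
by apply: (@is_derive1_comp _ h (fun s : R => g (x + s *: d)) 0) => //;
  rewrite scale0r addr0.
Qed.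

Lemma MVT_line f (df : R -> R) x d (b : R) : 0 < b ->
  (forall t : R, 0 < t < b -> is_derive (x + t *: d) d f (df t)) ->
  {within `[0, b], continuous (fun t : R => f (x + t *: d))} ->
  exists2 c : R, 0 < c < b & f (x + b *: d) - f x = df c * b.
Proof.
move=> b0 fd fc.
have [c|c cin E] := @MVT R (fun t : R => f (x + t *: d)) df 0 b b0 _ fc.
  by rewrite in_itv/= => cb; apply: is_derive_line; exact: fd.
by exists c; [rewrite in_itv/= in cin|rewrite scale0r addr0 subr0 in E].
Qed.

Lemma continuous_line x d : continuous (fun t : R => x + t *: d).
Proof.
move=> t; apply: cvgD; first exact: cvg_cst.
by apply: cvgZr_tmp; exact: cvg_id.
Qed.

Lemma near_line (P : set V) x d : nbhs x P ->
  exists2 e : R, 0 < e & forall t : R, `|t| < e -> P (x + t *: d).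
Proof.
move=> Px; have := @continuous_line x d 0.
rewrite /continuous_at scale0r addr0 => /(_ P Px).
move=> /nbhs_ballP[e/= e0 he]; exists e => // t te; apply: he.
by rewrite /ball/= sub0r normrN.
Qed.

Lemma is_derive_cvgP f x d (l : R) :
  is_derive x d f l <->
  (fun s : R => s^-1 * (f (x + s *: d) - f x)) @ 0^' --> l.
Proof.
have E : (fun h : R => h^-1 *: ((f \o shift x) (h *: d) - f x)) =
         (fun s : R => s^-1 * (f (x + s *: d) - f x)).
  by apply/funext => h /=; rewrite [h *: d + x]addrC.
split=> [[fd <-]|fl].
  by rewrite /derive E; move: fd; rewrite /derivable E.
split; first by rewrite /derivable E; apply/cvg_ex; exists l.
by rewrite /derive E; apply/cvg_lim.
Qed.

Lemma is_derive_dirZ f x d (c l : R) :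
  is_derive x d f l -> is_derive x (c *: d) f (c * l).
Proof.
move=> /is_derive_line0 fl; apply/is_derive_line0.
have -> : (fun s : R => f (x + s *: (c *: d))) =
          (fun s : R => f (x + s *: d)) \o (fun s => c * s).
  by apply/funext => s /=; rewrite scalerA mulrC.
rewrite mulrC; apply: is_derive1_comp; first by rewrite mulr0.
by have := is_deriveZ c (@is_derive_id R R 0 1); rewrite scaler1.
Qed.

(* The increment along [d] and then along [a *: e] is split by the mean value
   theorem, which only uses the continuity at [x] of the derivative along [e]. *)
Lemma is_derive_dirD f x d e (a l : R) :
  (\forall y \near x, derivable f y e) ->
  {for x, continuous ('D_e f)} ->
  is_derive x d f l -> is_derive x (d + a *: e) f (l + a * 'D_e f x).
Proof.
move=> fe ce /is_derive_cvgP fl; apply/is_derive_cvgP.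
have -> : (fun s : R => s^-1 * (f (x + s *: (d + a *: e)) - f x)) =
  (fun s : R => s^-1 * (f (x + s *: d) - f x) +
     s^-1 * (f (x + s *: d + (s * a) *: e) - f (x + s *: d))).
  by apply/funext => s; rewrite -mulrDr [in RHS]addrC addrA subrK scalerDr scalerA addrA.
apply: cvgD => //; apply/cvgrPdist_le => eps eps0.
have a1 : 0 < `|a| + 1 by rewrite ltr_wpDl.
have [r/= r0 hr] : exists2 r : R, 0 < r & forall y, `|x - y| < r ->
    derivable f y e /\ `|'D_e f x - 'D_e f y| <= eps / (`|a| + 1).
  have /cvgrPdist_le/(_ (eps / (`|a| + 1))) := ce.
  rewrite divr_gt0// => /(_ isT) ce'.
  have : \forall y \near x, derivable f y e /\
      `|'D_e f x - 'D_e f y| <= eps / (`|a| + 1) by apply: filterI; [exact: fe|exact: ce'].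
  by move=> /nbhs_ballP[r r0 h]; exists r => // y xy; apply: h; rewrite mx_norm_ball.
have D0 : 0 < `|d| + `|a| * `|e| + 1.
  by rewrite ltr_wpDl// addr_ge0// ?mulr_ge0.
near=> s.
have s0 : s != 0 by near: s; exact: nbhs_dnbhs_neq.
have sr : `|s| * (`|d| + `|a| * `|e| + 1) < r.
  rewrite -ltr_pdivlMr//; near: s; apply: dnbhs0_lt.
  by rewrite divr_gt0.
have inB (t : R) : 0 <= t <= 1 -> `|x - (x + s *: d + t *: ((s * a) *: e))| < r.
  move=> /andP[t0 t1]; rewrite -addrA opprD addrA subrr add0r normrN.
  apply: le_lt_trans sr; rewrite (le_trans (ler_normD _ _))//.
  rewrite !normrZ ?normrM (ger0_norm t0) !mulrDr mulr1.
  rewrite -addrA lerD2l// -?mulrA.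
  have : t * (`|s| * (`|a| * `|e|)) <= `|s| * (`|a| * `|e|).
    by rewrite ler_piMl// !mulr_ge0.
  move=> /le_trans; apply.
  by rewrite lerDl ?mulr_ge0.
have [c /andP[c0 c1] E] : exists2 c : R, 0 < c < 1 &
   f (x + s *: d + 1 *: ((s * a) *: e)) - f (x + s *: d) =
   ((s * a) * 'D_e f (x + s *: d + c *: ((s * a) *: e))) * 1.
  apply: (@MVT_line f (fun t => (s * a) * 'D_e f (x + s *: d + t *: ((s * a) *: e)))).
  - by [].
  - move=> t /andP[t0 t1]; apply: is_derive_dirZ; apply/derivableP.
    by apply: (hr _ (inB _ _)).1; rewrite !ltW.
  - apply: derivable_within_continuous => t; rewrite in_itv/= => t01.
    have /derivableP/(is_derive_dirZ (s * a))/is_derive_line[] // := (hr _ (inB _ t01)).1.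
rewrite scale1r mulr1 in E.
rewrite E -!mulrA mulKf// -mulrBr normrM.
have [_ H] : derivable f (x + s *: d + c *: ((s * a) *: e)) e /\ 
   `|'D_e f x - 'D_e f (x + s *: d + c *: ((s * a) *: e))| <= eps / (`|a| + 1).
  by apply: hr; apply: inB; rewrite !ltW.
apply: (le_trans (ler_wpM2l _ H)) => //.
by rewrite mulrCA ler_piMr ?(ltW eps0)// ler_pdivrMr// mul1r lerDl.
Unshelve. all: by end_near.
Qed.

(** By induction on the coordinates of [d], each application of [is_derive_dirD] adding one axis
    direction. *)
Lemma is_derive_partials f x d :
  (\forall y \near x, forall i, pderivable i f y) ->
  (forall i, {for x, continuous (pderiv i f)}) ->
  is_derive x d f (\sum_i d ord0 i * pderiv i f x).
Proof.
move=> fd fc.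
have -> : d = \sum_i d ord0 i *: delta_mx ord0 i by rewrite [LHS]row_sum_delta.
have -> : \sum_i (\sum_j d ord0 j *: delta_mx ord0 j : V) ord0 i * pderiv i f x =
          \sum_i d ord0 i * pderiv i f x.
  by rewrite -row_sum_delta.
elim/big_rec2 : _ => [|i l y _ IH]; first exact: is_derive0.
rewrite [d ord0 i *: _ + _]addrC [_ * _ + _]addrC; apply: is_derive_dirD => //; last exact: fc.
by apply: filterS fd => y'; apply.
Qed.

(** Were the second derivative positive, the first one, zero at the maximum, would be positive just
    after it, and the mean value theorem would give a larger value of [f]. The second derivative has
    to exist only at [x]. *)
Lemma derive2_max f x i : (\forall y \near x, pderivable i f y) ->
  pderivable i (pderiv i f) x -> (\forall y \near x, f y <= f x) ->
  pderiv i (pderiv i f) x <= 0.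
Proof.
move=> fd f2 fm; rewrite leNgt; apply/negP => gt0.
set e := delta_mx ord0 i : V.
have [r r0 hr] := near_line e (filterI fd fm).
pose g (s : R) := f (x + s *: e); pose g' (s : R) := pderiv i f (x + s *: e).
have dg (s : R) : `|s| < r -> is_derive s 1 g (g' s).
  by move=> sr; apply: is_derive_line; apply/derivableP; exact: (hr _ sr).1.
have g'0 : g' 0 = 0.
  have r2 : r / 2 < r by rewrite ltr_pdivrMr// ltr_pMr// ltr1n.
  have /(_ _ _ _ _)[] := @derive1_at_max _ g (- (r/2)) (r/2) 0.
  - by rewrite lerNl; lra.
  - move=> t; rewrite in_itv/= => tr.
    by have [] := dg t (ltac:(rewrite ltr_norml; lra)).
  - by rewrite in_itv/=; lra.
  - move=> t; rewrite in_itv/= => tr; rewrite /g [in leRHS]scale0r addr0.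
    by apply: (hr t _).2; rewrite ltr_norml; lra.
  - move=> _ gE; have [|_ gE'] := dg 0; first by rewrite normr0.
    by rewrite -gE' gE.
have /is_derive_cvgP : is_derive x e (pderiv i f) (pderiv i (pderiv i f) x).
  by apply/derivableP.
move=> /cvgr_gt/(_ _ gt0)/nbhs_ballP[d/= d0 hd].
pose s := Num.min (r / 2) (d / 2).
have s0 : 0 < s by rewrite lt_min !divr_gt0.
have [sr sd] : s < r /\ s < d.
  by split; rewrite gt_min; apply/orP; [left|right]; lra.
have [c /andP[c0 cs] E] : exists2 c : R, 0 < c < s & f (x + s *: e) - f x = g' c * s.
  apply: MVT_line => // [t /andP[t0 ts]|].
    by apply/derivableP; apply: (hr t _).1; rewrite gtr0_norm// (lt_trans ts).
  apply: derivable_within_continuous => t; rewrite in_itv/= => /andP[t0 ts].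
  by have [] := dg t (ltac:(by rewrite ger0_norm// (le_lt_trans ts))).
have : 0 < g' c.
  have := hd c; rewrite /ball/= sub0r normrN gtr0_norm// (lt_trans cs)// gt_eqF//.
  move=> /(_ isT isT); rewrite -[pderiv i f x]/(pderiv i f x).
  have -> : pderiv i f x = 0 by rewrite -g'0 /g' scale0r addr0.
  by rewrite subr0 pmulr_rgt0// invr_gt0.
move=> g'c; have := (hr s _).2; rewrite gtr0_norm// sr => /(_ isT).
by rewrite -subr_le0 E leNgt mulr_gt0.
Qed.

End directional.

(** * Continuity relative to a subset, and one-variable preliminaries *)

Lemma within_comp (T U : topologicalType) (W : topologicalType) (A : set T) (B : set U)
    (g : T -> U) (f : U -> W) : continuous g -> (forall t, A t -> B (g t)) ->
  {within B, continuous f} -> {within A, continuous (fun t => f (g t))}.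
Proof.
move=> gc gAB /subspace_continuousP fB; apply/subspace_continuousP => t At.
move=> P /(fB _ (gAB _ At)) H.
have H' : nbhs (g t) [set u | B u -> P (f u)] := H.
have H2 : nbhs t [set t' | B (g t') -> P (f (g t'))] := gc t _ H'.
suff : nbhs t [set t' | A t' -> P (f (g t'))] by [].
by apply: filterS H2 => t' /= h At'; apply: h; exact: gAB.
Qed.

Lemma within_contD (R : realType) (T : topologicalType) (A : set T) (f g : T -> R) :
  {within A, continuous f} -> {within A, continuous g} ->
  {within A, continuous (fun x => f x + g x)}.
Proof. by move=> fc gc x; exact: (@for_contD R (subspace A) f g x (fc x) (gc x)). Qed.

Lemma within_contM (R : realType) (T : topologicalType) (A : set T) (f g : T -> R) :
  {within A, continuous f} -> {within A, continuous g} ->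
  {within A, continuous (fun x => f x * g x)}.
Proof. by move=> fc gc x; exact: (@for_contM R (subspace A) f g x (fc x) (gc x)). Qed.

Lemma within_cont_comp (R : realType) (T : topologicalType) (A : set T) (h : R -> R) (f : T -> R) :
  continuous h -> {within A, continuous f} ->
  {within A, continuous (fun x => h (f x))}.
Proof. by move=> hc fc x; exact: (@for_cont_comp R (subspace A) h f x (fc x) (hc _)). Qed.

Lemma compact_bounded_above (R : realType) (T : topologicalType) (A : set T) (f : T -> R) :
  compact A -> {within A, continuous f} -> exists2 M : R, 0 <= M & forall x, A x -> `|f x| <= M.
Proof.
move=> cA fc; have [A0|/set0P nA] := eqVneq A set0.
  by exists 0 => // x; rewrite A0.
have fN : {within A, continuous (fun x => `|f x|)}.
  by apply: within_cont_comp => //; exact: norm_continuous.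
have [c _ Hc] := compact_EVT_max nA cA fN.
by exists `|f c| => // x Ax; apply: Hc; rewrite inE.
Qed.

(** Only earlier times are compared, because a maximum over a closed time cylinder may lie at its
    final time. *)
Lemma left_max_derive (R : realType) (f : R -> R) (t a : R) : is_derive t 1 f a ->
  (exists2 e : R, 0 < e & forall s, t - e < s < t -> f s <= f t) -> 0 <= a.
Proof.
move=> /is_derive1_caratheodory[g [gE gc <-]] [e e0 He].
rewrite leNgt; apply/negP => gt0.
have /nbhs_ballP[d/= d0 hd] : \forall s \near t, g s < 0 by exact: near_lt gc gt0.
pose s := Num.max (t - e / 2) (t - d / 2).
have st : s < t by rewrite /s gt_max; lra.
have es : t - e < s by rewrite /s lt_max; apply/orP; left; lra.
have ds : t - d / 2 <= s by rewrite /s le_max lexx orbT.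
have gs : g s < 0 by apply: hd; rewrite /ball/= gtr0_norm; lra.
have := He s; rewrite es st => /(_ isT).
by rewrite -subr_le0 gE leNgt nmulr_rgt0// subr_lt0 st.
Qed.

Lemma norm_continuousP (R : realType) (T U : normedModType R) (f : T -> U) :
  (forall x (e : R), 0 < e -> exists2 d : R, 0 < d & forall y, `|x - y| < d -> `|f x - f y| < e) ->
  continuous f.
Proof.
move=> H x; apply/cvgrPdist_lt => e e0; have [d d0 hd] := H x e e0.
near=> y; apply: hd; near: y; apply/nbhs_ballP; exists d => //= y.
by rewrite -ball_normE.
Unshelve. all: by end_near.
Qed.

(** * Smooth functions *)

Section smooth_functions.
Context {R : realType} {n : nat}.
Local Notation V := 'rV[R]_n.
Implicit Types (f g : V -> R) (h : R -> R).

Fixpoint Ck1 (k : nat) h : Prop :=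
  if k is k'.+1 then (forall s : R, derivable h s 1) /\ Ck1 k' (derive1 h)
  else continuous h.

Definition smooth1 h := forall k, Ck1 k h.

Lemma derivable_cont h : (forall s : R, derivable h s 1) -> continuous h.
Proof.
by move=> hd s; apply: differentiable_continuous; apply/derivable1_diffP; exact: hd.
Qed.

Lemma CkW k f : Ck k.+1 f -> Ck k f.
Proof.
elim: k f => [|k IH] f; first by case.
move=> [fc fd]; split => // i; have [fi fS] := fd i; split => //; exact: IH.
Qed.

Lemma pderivE i f x a : is_derive x (delta_mx ord0 i) f a -> pderiv i f x = a.
Proof. by case. Qed.

Lemma pderivableP i f x : pderivable i f x ->
  is_derive x (delta_mx ord0 i) f (pderiv i f x).
Proof. by move=> /derivableP. Qed.

Lemma Ck_cst k (c : R) : Ck k (fun _ : V => c).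
Proof.
elim: k c => [|k IH] c; first exact: cst_continuous.
split; first exact: cst_continuous.
move=> i; split=> [x|]; first exact: derivable_cst.
have -> : pderiv i (fun=> c) = fun=> 0.
  by apply/funext => x; apply: pderivE; exact: is_derive_cst.
exact: IH.
Qed.

Lemma is_derive_coord (x : V) i j :
  is_derive x (delta_mx ord0 i) (fun y : V => y ord0 j) (i == j)%:R.
Proof.
apply/is_derive_line0.
have -> : (fun s : R => (x + s *: delta_mx ord0 i : V) ord0 j) =
    fun s => x ord0 j + (i == j)%:R * s.
  by apply/funext => s; rewrite !mxE /= eq_sym mulrC.
rewrite -[X in is_derive _ _ _ X]add0r; apply: is_deriveD.
by have := is_deriveZ (i == j)%:R (@is_derive_id R R 0 1); rewrite scaler1.
Qed.

Lemma Ck_coord k j : Ck k (fun y : V => y ord0 j).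
Proof.
case: k => [|k]; first exact: coord_continuous.
split; first exact: coord_continuous.
move=> i; split=> [x|]; first by have [] := is_derive_coord x i j.
have -> : pderiv i (fun y : V => y ord0 j) = fun=> (i == j)%:R.
  by apply/funext => x; apply: pderivE; exact: is_derive_coord.
exact: Ck_cst.
Qed.

Lemma CkD k f g : Ck k f -> Ck k g -> Ck k (fun x => f x + g x).
Proof.
elim: k f g => [|k IH] f g; first by move=> /= fc gc x; apply: for_contD; [exact: fc|exact: gc].
move=> [fc fd] [gc gd]; split.
  by move=> x; apply: for_contD; [exact: fc|exact: gc].
move=> i; have [fi fS] := fd i; have [gi gS] := gd i; split.
  by move=> x; apply: derivableD; [exact: fi|exact: gi].
have -> : pderiv i (fun x => f x + g x) = fun x => pderiv i f x + pderiv i g x.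
  by apply/funext => x; apply: pderivE; apply: is_deriveD; exact: pderivableP.
exact: IH.
Qed.

Lemma is_derive_mul f g (x d : V) (a b : R) :
  is_derive x d f a -> is_derive x d g b ->
  is_derive x d (fun y => f y * g y) (a * g x + f x * b).
Proof.
move=> fa gb; have := @is_deriveM _ _ f g x d a b fa gb.
by rewrite addrC /GRing.scale/= [g x * a]mulrC.
Qed.

Lemma CkM k f g : Ck k f -> Ck k g -> Ck k (fun x => f x * g x).
Proof.
elim: k f g => [|k IH] f g; first by move=> /= fc gc x; apply: for_contM; [exact: fc|exact: gc].
move=> F G; have [fc fd] := F; have [gc gd] := G; split.
  by move=> x; apply: for_contM; [exact: fc|exact: gc].
move=> i; have [fi fS] := fd i; have [gi gS] := gd i; split.
  by move=> x; apply: derivableM; [exact: fi|exact: gi].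
have -> : pderiv i (fun x => f x * g x) =
    fun x => pderiv i f x * g x + f x * pderiv i g x.
  by apply/funext => x; apply: pderivE; apply: is_derive_mul; exact: pderivableP.
by apply: CkD; apply: IH => //; exact: CkW.
Qed.

Lemma Ck_comp k h f : Ck1 k h -> Ck k f -> Ck k (fun x => h (f x)).
Proof.
elim: k h f => [|k IH] h f.
  by move=> /= hc fc x; apply: for_cont_comp; [exact: fc|exact: hc].
move=> H F; have [hd hS] := H; have [fc fd] := F; split.
  move=> x; apply: for_cont_comp; first exact: fc.
  exact: derivable_cont.
have fD i x : is_derive x (delta_mx ord0 i) (fun x => h (f x)) (derive1 h (f x) * pderiv i f x).
  apply: is_derive_chain; last by apply: pderivableP; exact: (fd i).1.
  by rewrite derive1E; exact/derivableP.
move=> i; split=> [x|]; first by have [] := fD i x.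
have -> : pderiv i (fun x => h (f x)) = fun x => derive1 h (f x) * pderiv i f x.
  by apply/funext => x; apply: pderivE.
apply: CkM; last exact: (fd i).2.
by apply: IH => //; exact: CkW.
Qed.

Lemma smooth_cst (c : R) : smooth (fun _ : V => c). Proof. by move=> k; exact: Ck_cst. Qed.

Lemma smooth_coord j : smooth (fun y : V => y ord0 j).
Proof. by move=> k; exact: Ck_coord. Qed.

Lemma smoothD f g : smooth f -> smooth g -> smooth (fun x => f x + g x).
Proof. by move=> F G k; apply: CkD. Qed.

Lemma smoothM f g : smooth f -> smooth g -> smooth (fun x => f x * g x).
Proof. by move=> F G k; apply: CkM. Qed.

Lemma smooth_comp h f : smooth1 h -> smooth f -> smooth (fun x => h (f x)).
Proof. by move=> H F k; apply: Ck_comp. Qed.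

Lemma smooth_sum (I : Type) (r : seq I) (F : I -> V -> R) :
  (forall i, smooth (F i)) -> smooth (fun x => \sum_(i <- r) F i x).
Proof.
move=> sF; elim: r => [|i r IH].
  by under eq_fun do rewrite big_nil; exact: smooth_cst.
by under eq_fun do rewrite big_cons; exact: smoothD.
Qed.

Lemma smooth_prod (I : Type) (r : seq I) (F : I -> V -> R) :
  (forall i, smooth (F i)) -> smooth (fun x => \prod_(i <- r) F i x).
Proof.
move=> sF; elim: r => [|i r IH].
  by under eq_fun do rewrite big_nil; exact: smooth_cst.
by under eq_fun do rewrite big_cons; exact: smoothM.
Qed.

Lemma smooth_pderivable f i x : smooth f -> pderivable i f x.
Proof. by move=> /(_ 1)[_ /(_ i)[]]. Qed.

Lemma smooth_pderiv f i : smooth f -> smooth (pderiv i f).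
Proof. by move=> sf k; have [_ /(_ i)[]] := sf k.+1. Qed.

Lemma smooth_continuous f : smooth f -> continuous f.
Proof. by move=> /(_ 0). Qed.

End smooth_functions.

(** * The smooth flat functions on the line *)

Section one_variable.
Context {R : realType}.
Implicit Types (h g : R -> R).

Lemma derive1_eq h (s a : R) : is_derive s 1 h a -> derive1 h s = a.
Proof. by rewrite derive1E => -[]. Qed.

Lemma Ck1D k h g : Ck1 k h -> Ck1 k g -> Ck1 k (fun s => h s + g s).
Proof.
elim: k h g => [|k IH] h g; first by move=> /= fc gc x; apply: for_contD; [exact: fc|exact: gc].
move=> [hd hS] [gd gS]; split; first by move=> s; apply: derivableD.
have -> : derive1 (fun s => h s + g s) = fun s => derive1 h s + derive1 g s.
  by apply/funext => s; apply: derive1_eq; rewrite !derive1E; apply: is_deriveD; exact/derivableP.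
exact: IH.
Qed.

Lemma Ck1Z k (c : R) h : Ck1 k h -> Ck1 k (fun s => c * h s).
Proof.
elim: k h => [|k IH] h; first by move=> /= hc x; apply: cvgMl_tmp; exact: hc.
move=> [hd hS]; split; first by move=> s; apply: derivableZ.
have -> : derive1 (fun s => c * h s) = fun s => c * derive1 h s.
  by apply/funext => s; apply: derive1_eq; rewrite !derive1E; apply: is_deriveZ; exact/derivableP.
exact: IH.
Qed.

(* [flat j s = s^-j exp(-1/s)] for [s > 0]; this family is stable under
   differentiation up to linear combinations. *)
Definition flat (j : nat) (s : R) : R := if 0 < s then s ^- j * expR (- s^-1) else 0.

Lemma flat_ge0 j s : 0 <= flat j s.
Proof.
by rewrite /flat; case: ifP => // s0; rewrite mulr_ge0 ?expR_ge0// invr_ge0 exprn_ge0// ltW.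
Qed.

Lemma flat_gt0 j s : (0 < flat j s) = (0 < s).
Proof.
rewrite /flat; case: ifP => [s0|]; last by rewrite ltxx.
by rewrite mulr_gt0 ?expR_gt0// invr_gt0 exprn_gt0.
Qed.

Lemma flat_le0 j s : s <= 0 -> flat j s = 0.
Proof. by rewrite /flat ltNge => ->. Qed.

(** The Taylor bound [y^(j+1) / (j+1)! <= exp y] at [y = 1/s]; it yields the continuity of [flat j]
    at 0. *)
Lemma flat_bound j s : flat j s <= j.+1`!%:R * `|s|.
Proof.
have [s0|s0] := ltP 0 s; last by rewrite flat_le0// mulr_ge0.
rewrite /flat s0 expRN ler_pdivrMr ?expR_gt0// gtr0_norm//.
have y0 : 0 <= s^-1 by rewrite invr_ge0 ltW.
have := expR_ge1Dxn j y0.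
have f0 : 0 < j.+1`!%:R :> R by rewrite ltr0n fact_gt0.
move=> H; have {}H : s^-1 ^+ j.+1 / (j.+1)`!%:R <= expR s^-1.
  by apply: le_trans H; rewrite lerDr.
rewrite ler_pdivrMr// in H.
rewrite mulrAC -ler_pdivrMr// mulrC.
by rewrite -exprVn -exprS mulrC; exact: H.
Qed.

Lemma flat_mulr j s : flat j.+1 s * s = flat j s.
Proof.
rewrite /flat; case: ifPn => s0; last by rewrite mul0r.
by rewrite mulrAC exprS invfM [_ * s]mulrAC mulVf ?mul1r// gt_eqF.
Qed.

Lemma cvg_flat0 j : flat j s @[s --> (0 : R)] --> (0 : R).
Proof.
apply/cvgr0Pnorm_le => e e0.
near=> t; rewrite ger0_norm ?flat_ge0//; apply: le_trans (flat_bound _ _) _.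
rewrite -ler_pdivlMl ?ltr0n ?fact_gt0//.
near: t; apply/nbhs_ballP; exists (j.+1`!%:R^-1 * e) => /=.
  by rewrite mulr_gt0// invr_gt0 ltr0n fact_gt0.
by move=> x /=; rewrite /ball/= sub0r normrN => /ltW.
Unshelve. all: by end_near.
Qed.

Lemma is_derive_flat j (s : R) : is_derive s 1 (flat j) (- j%:R * flat j.+1 s + flat j.+2 s).
Proof.
have [s0|s0|->] := ltgtP s 0.
- rewrite !flat_le0 ?ltW// mulr0 addr0.
  apply: (@near_eq_is_derive _ _ _ (fun=> 0) _ s 1 0 _ (is_derive_cst _ _ _)).
  by near=> t; rewrite flat_le0// ltW//; near: t; exact: lt_nbhsl.
- have s_neq0 : s != 0 by rewrite gt_eqF.
  pose k (t : R) : R := t^-1 ^+ j * expR (- t^-1).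
  apply: (@near_eq_is_derive _ _ _ k).
    near=> t; rewrite /flat ifT /k ?exprVn//.
    by near: t; exact: lt_nbhsr.
  have dV : is_derive s 1 (fun t : R => t^-1) (- s ^- 2).
    by have := is_deriveV s_neq0 (@is_derive_id R R s 1); rewrite scaler1.
  have dX : is_derive s 1 (fun t : R => t^-1 ^+ j) (j%:R * s^-1 ^+ j.-1 * (- s ^- 2)).
    have := is_deriveX j dV. rewrite [X in is_derive _ _ X](_ : _ = (fun t : R => t^-1 ^+ j)); last by apply/funext => t; rewrite fctE. by [].
  have dE : is_derive s 1 (fun t : R => expR (- t^-1)) (expR (- s^-1) * s ^- 2).
    apply: (@is_derive1_comp _ expR (fun t => - t^-1)).
    by have := is_deriveN dV; rewrite opprK.
  have dK : is_derive s 1 k _ := is_deriveM dX dE.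
  apply: (@is_derive_eq _ _ _ _ _ _ _ _ dK); rewrite /GRing.scale/= /flat s0.
  rewrite -!exprVn; set e := expR _; set y := s^-1.
  by case: j {dX dK k} => [|j] /=; rewrite ?exprS; ring.
(* At 0 the difference quotient of [flat j] is [flat j.+1], by [flat_mulr], and it tends to 0. *)
- rewrite !flat_le0// mulr0 addr0.
  have f0 k : flat k 0 = 0 by rewrite flat_le0.
  apply/is_derive1_caratheodory; exists (flat j.+1); split => //.
    by move=> z; rewrite f0 !subr0 flat_mulr.
  by rewrite /prop_for /continuous_at f0; exact: cvg_flat0.
Unshelve. all: by end_near.
Qed.

Lemma smooth_flat j : smooth1 (flat j).
Proof.
move=> k; elim: k j => [|k IH] j.
  by apply: derivable_cont => s; have [] := is_derive_flat j s.
split; first by move=> s; have [] := is_derive_flat j s.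
have -> : derive1 (flat j) = fun s => - j%:R * flat j.+1 s + flat j.+2 s.
  by apply/funext => s; apply: derive1_eq; exact: is_derive_flat.
by apply: Ck1D => //; apply: Ck1Z.
Qed.

End one_variable.

(** * Smooth bump functions *)

Section bump.
Context {R : realType} {n : nat}.
Local Notation V := 'rV[R]_n.
Implicit Types (c x y : V) (r : R).

(** Row vectors carry the sup norm, so for [0 < r] this product over the coordinates is positive
    exactly on the ball of radius [r] around [c]. *)
Definition bump c r x : R :=
  \prod_(i < n) (flat 0 (r + (x ord0 i - c ord0 i)) * flat 0 (r - (x ord0 i - c ord0 i))).

Lemma smooth_bump c r : smooth (bump c r).
Proof.
apply: smooth_prod => i; apply: smoothM; apply: (smooth_comp (smooth_flat 0)).
  apply: smoothD; first exact: smooth_cst.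
  by apply: smoothD; [exact: smooth_coord|exact: smooth_cst].
have -> : (fun x : V => r - (x ord0 i - c ord0 i)) =
   fun x : V => (r + c ord0 i) + (-1) * x ord0 i by apply/funext => x; ring.
apply: smoothD; first exact: smooth_cst.
by apply: smoothM; [exact: smooth_cst|exact: smooth_coord].
Qed.

Lemma bump_ge0 c r x : 0 <= bump c r x.
Proof. by apply: prodr_ge0 => i _; rewrite mulr_ge0 ?flat_ge0. Qed.

Lemma ball_rVP r x y : 0 < r ->
  (`|x - y| < r) <-> (forall i, `|x ord0 i - y ord0 i| < r).
Proof.
move=> r0.
have E : (`|x - y| < r) = ball x r y :> Prop by rewrite mx_norm_ball.
rewrite E; split=> [[_ H] i|H]; first by have := H ord0 i.
by split=> // i j; rewrite (ord1 i); exact: H.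
Qed.

Lemma bump_gt0 c r x : 0 < r -> `|x - c| < r -> 0 < bump c r x.
Proof.
move=> r0 /ball_rVP-/(_ r0) H; apply: prodr_gt0 => i _.
have := H i; rewrite ltr_norml => /andP[h1 h2].
by rewrite mulr_gt0 ?flat_gt0//; lra.
Qed.

Lemma bump_eq0 c r x : 0 < r -> r <= `|x - c| -> bump c r x = 0.
Proof.
move=> r0; rewrite leNgt => /negP xc; apply/eqP; rewrite prodf_seq_eq0.
apply/negbNE/negP => /hasPn H; apply: xc; apply/ball_rVP => // i.
have := H i (mem_index_enum _); rewrite /= mulf_eq0 negb_or => /andP[p1 p2].
have := flat_ge0 0 (r + (x ord0 i - c ord0 i)); rewrite le0r (negbTE p1)/= flat_gt0 => p3.
have := flat_ge0 0 (r - (x ord0 i - c ord0 i)); rewrite le0r (negbTE p2)/= flat_gt0 => p4.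
by rewrite ltr_norml; lra.
Qed.

(** Applied where a nonnegative bump vanishes: there its gradient vanishes too. *)
Lemma pderiv_min0 (f : V -> R) i x : pderivable i f x ->
  (forall y, f x <= f y) -> pderiv i f x = 0.
Proof.
move=> fd fm; set l := pderiv i f x.
apply/eqP; rewrite eq_le; apply/andP; split.
  rewrite leNgt; apply/negP => l0.
  have /is_derive_cvgP := is_derive_dirZ (-1) (pderivableP fd).
  move=> /cvgr_lt/(_ 0); rewrite mulN1r oppr_lt0 => /(_ l0) /nbhs_ballP[e/= e0 he].
  have := he (e / 2); rewrite /ball/= sub0r normrN gtr0_norm ?divr_gt0//.
  rewrite gt_eqF ?divr_gt0// => /(_ ltac:(lra) isT).
  by rewrite pmulr_rlt0 ?invr_gt0 ?divr_gt0// subr_lt0 ltNge fm.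
rewrite leNgt; apply/negP => l0.
have /is_derive_cvgP := pderivableP fd.
move=> /cvgr_lt/(_ 0 l0) /nbhs_ballP[e/= e0 he].
have := he (e / 2); rewrite /ball/= sub0r normrN gtr0_norm ?divr_gt0//.
rewrite gt_eqF ?divr_gt0// => /(_ ltac:(lra) isT).
by rewrite pmulr_rlt0 ?invr_gt0 ?divr_gt0// subr_lt0 ltNge fm.
Qed.

Lemma near_dir_lt0 (f : V -> R) x d l : is_derive x d f l -> l < 0 -> f x <= 0 ->
  exists2 e : R, 0 < e & forall s, 0 < s < e -> f (x + s *: d) < 0.
Proof.
move=> fl l0 fx; move: fl => /is_derive_cvgP/cvgr_lt/(_ 0 l0)/nbhs_ballP[e/= e0 he].
exists e => // s /andP[s0 se]; have := he s.
rewrite /ball/= sub0r normrN gtr0_norm// gt_eqF// => /(_ se isT).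
by rewrite pmulr_rlt0 ?invr_gt0// subr_lt0 => /lt_le_trans; apply.
Qed.

End bump.

(** * Defining functions of a smooth domain *)

Section defining_function.
Context {R : realType} {n : nat}.
Local Notation V := 'rV[R]_n.
Implicit Types (x y nu d : V) (r : R) (rho f : V -> R) (Omega : set V).

Lemma smooth_is_derive rho x d : smooth rho ->
  is_derive x d rho (\sum_i d ord0 i * pderiv i rho x).
Proof.
move=> srho; apply: is_derive_partials.
  by apply: near_all => y i; exact: smooth_pderivable.
by move=> i; apply: smooth_continuous; exact: smooth_pderiv.
Qed.

Lemma local_defining_bdry Omega x rho :
  bdry Omega x -> local_defining Omega x rho -> rho x = 0.
Proof.
move=> [cx nx] [srho _ nr]; apply/eqP; rewrite eq_le; apply/andP; split; last first.
  by rewrite leNgt; apply/negP => /(nbhs_singleton nr).2.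
rewrite leNgt; apply/negP => r0.
have pos := near_gt (@smooth_continuous _ _ _ srho x) r0.
have [y [Oy [Py [/(_ Oy) + _]]]] := cx _ (near_and pos nr).
by rewrite ltNge ltW.
Qed.

Lemma outward_normal_unit Omega x nu : outward_normal Omega x nu ->
  \sum_i nu ord0 i ^+ 2 = 1.
Proof.
move=> [rho [_ [i ri] _] ->]; set S := \sum_(j < n) pderiv j rho x ^+ 2.
have S0 : 0 < S.
  rewrite /S (bigD1 i)//= ltr_pwDl ?exprn_even_gt0//.
  by apply: sumr_ge0 => j _; exact: sqr_ge0.
under eq_bigr do rewrite !mxE exprMn exprVn sqr_sqrtr ?(ltW S0)//.
by rewrite -mulr_sumr mulVf// gt_eqF.
Qed.

Lemma outward_normal_grad Omega x nu : outward_normal Omega x nu ->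
  exists2 rho, local_defining Omega x rho &
  exists2 a : R, 0 < a & forall i, pderiv i rho x = a * nu ord0 i.
Proof.
move=> [rho L nuE]; exists rho => //.
have [_ [i ri] _] := L; set S := \sum_(j < n) pderiv j rho x ^+ 2 in nuE.
have S0 : 0 < S.
  rewrite /S (bigD1 i)//= ltr_pwDl ?exprn_even_gt0//.
  by apply: sumr_ge0 => j _; exact: sqr_ge0.
exists (Num.sqrt S); first by rewrite sqrtr_gt0.
by move=> j; rewrite nuE !mxE mulVKf// gt_eqF// sqrtr_gt0.
Qed.

(* If two outward unit normals differed, moving along their difference would
   lead both into [Omega] and out of it. *)
Lemma outward_normal_uniq Omega x nu1 nu2 : bdry Omega x ->
  outward_normal Omega x nu1 -> outward_normal Omega x nu2 -> nu1 = nu2.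
Proof.
move=> bx n1 n2; apply/eqP; rewrite -subr_eq0; apply/negP => /negP d0.
have u1 := outward_normal_unit n1; have u2 := outward_normal_unit n2.
have [rho1 L1 [a1 a10 g1]] := outward_normal_grad n1.
have [rho2 L2 [a2 a20 g2]] := outward_normal_grad n2.
have r1 := local_defining_bdry bx L1; have r2 := local_defining_bdry bx L2.
have [s1 _ near1] := L1; have [s2 _ near2] := L2.
have P : 0 < \sum_i (nu1 - nu2) ord0 i ^+ 2.
  have [i di] : exists i, (nu1 - nu2) ord0 i != 0.
    apply: contrapT => H; move/negP: d0; apply; apply/eqP/rowP => i.
    rewrite [RHS]mxE; apply/eqP/negPn/negP => K; apply: H; exists i; exact: K.
  rewrite (bigD1 i)//= ltr_pwDl ?exprn_even_gt0//.
  by apply: sumr_ge0 => j _; exact: sqr_ge0.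
have D : \sum_i (nu1 - nu2) ord0 i ^+ 2 = 2 * (1 - \sum_i nu1 ord0 i * nu2 ord0 i).
  rewrite (_ : \sum_i (nu1 - nu2) ord0 i ^+ 2 = \sum_i nu1 ord0 i ^+ 2 +
    \sum_i nu2 ord0 i ^+ 2 - 2 * \sum_i nu1 ord0 i * nu2 ord0 i); first by rewrite u1 u2; ring.
  by rewrite mulr_sumr -big_split/= -sumrB; apply: eq_bigr => i _; rewrite !mxE; ring.
have D0 : \sum_i nu1 ord0 i * nu2 ord0 i < 1 by lra.
(* Unit length turns [nu1 <> nu2] into an inner product below 1, so [d] has a negative product with
   [nu1] and a positive one with [nu2]: along [d], [rho1] decreases and [rho2] increases. *)
pose d := nu2 - nu1.
have lt1 : \sum_i d ord0 i * pderiv i rho1 x < 0.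
  have -> : \sum_i d ord0 i * pderiv i rho1 x =
     a1 * (\sum_i nu1 ord0 i * nu2 ord0 i - \sum_i nu1 ord0 i ^+ 2).
    by rewrite -sumrB mulr_sumr; apply: eq_bigr => i _; rewrite g1 !mxE; ring.
  by rewrite u1 pmulr_rlt0// subr_lt0.
have lt2 : \sum_i (- d) ord0 i * pderiv i rho2 x < 0.
  have -> : \sum_i (- d) ord0 i * pderiv i rho2 x =
     a2 * (\sum_i nu1 ord0 i * nu2 ord0 i - \sum_i nu2 ord0 i ^+ 2).
    by rewrite -sumrB mulr_sumr; apply: eq_bigr => i _; rewrite g2 !mxE; ring.
  by rewrite u2 pmulr_rlt0// subr_lt0.
have r1le : rho1 x <= 0 by rewrite r1.
have [e1 e10 h1] := near_dir_lt0 (smooth_is_derive x d s1) lt1 r1le.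
have [e2 e20 h2] : exists2 e : R, 0 < e & forall s, 0 < s < e -> 0 < rho2 (x + s *: d).
  have dN : is_derive x d (fun y => - rho2 y) (\sum_i (- d) ord0 i * pderiv i rho2 x).
    have := is_deriveN (smooth_is_derive x d s2).
    by rewrite -sumrN; under eq_bigr do rewrite -mulNr; under [in X in _ -> X]eq_bigr do rewrite mxE.
  have r2le : - rho2 x <= 0 by rewrite r2 oppr0.
  have [e e0 h] := near_dir_lt0 dN lt2 r2le; exists e => // s /h.
  by rewrite oppr_lt0.
have [e3 e30 h3] := near_line d (near_and near1 near2).
pose s := Num.min (Num.min (e1 / 2) (e2 / 2)) (e3 / 2).
have s0 : 0 < s by rewrite !lt_min !divr_gt0.
have [S1 S2 S3] : [/\ s < e1, s < e2 & s < e3].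
  by rewrite /s; split; rewrite !gt_min; apply/orP; [left|left|right]; 
   rewrite ?gt_min; try (apply/orP; (left; lra) || (right; lra)); lra.
have [h4 h5] := h3 s (ltac:(by rewrite gtr0_norm)).
have := h1 s (ltac:(by rewrite s0 S1)); move/h4/h5.
by have := h2 s (ltac:(by rewrite s0 S2)) => /ltW; rewrite leNgt => /negP.
Qed.

End defining_function.

Section global_defining_function.
Context {R : realType} {n : nat}.
Local Notation V := 'rV[R]_n.
Implicit Types (x y nu d : V) (r : R) (rho f : V -> R) (Omega : set V).

Let bump_grad0 (c : V) r y i : 0 < r -> r <= `|y - c| -> pderiv i (bump c r) y = 0.
Proof.
move=> r0 yc; apply: pderiv_min0; first exact: smooth_pderivable (smooth_bump _ _).
by move=> z; rewrite (bump_eq0 r0 yc) bump_ge0.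
Qed.

Lemma pderivM f g i y : pderivable i f y -> pderivable i g y ->
  pderiv i (fun z => f z * g z) y = pderiv i f y * g y + f y * pderiv i g y.
Proof. by move=> fd gd; apply: pderivE; apply: is_derive_mul; exact: pderivableP. Qed.

(** A local summand of the global defining function, packed as a radius [p.1] and a function [p.2].
    At a boundary point the gradient of every summand is a nonpositive multiple of the same outward
    normal, so gradients cannot cancel in the sum. *)
Let piece_interior Omega x : open Omega -> Omega x ->
  exists p : R * (V -> R), [/\ 0 < p.1, smooth p.2,
    forall y, (Omega y -> 0 <= p.2 y) /\ (~ Omega y -> p.2 y <= 0),
    forall y, Omega y -> `|y - x| < p.1 -> 0 < p.2 y &
    forall y nu, bdry Omega y -> outward_normal Omega y nu ->
      p.2 y = 0 /\ exists2 a : R, 0 <= a &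
        (`|y - x| < p.1 -> 0 < a) /\ forall i, pderiv i p.2 y = - a * nu ord0 i].
Proof.
move=> oO Ox; have /nbhs_ballP[r/= r0 hr] := near_open oO Ox.
have far y : ~ Omega y -> r <= `|y - x|.
  move=> nOy; rewrite leNgt; apply/negP => yx; apply: nOy; apply: hr.
  by rewrite mx_norm_ball /ball_/= distrC.
exists (r, bump x r); split => //=.
- exact: smooth_bump.
- move=> y; split=> [_|nOy]; first exact: bump_ge0.
  by rewrite bump_eq0// far.
- by move=> y _; exact: bump_gt0.
- move=> y nu [_ nOy] _; split; first by rewrite bump_eq0// far.
  exists 0 => //; split; first by rewrite ltNge far.
  by move=> i; rewrite bump_grad0// ?far// oppr0 mul0r.
Qed.

(** The summand is a bump times [- rho] for a local defining function [rho]. On the boundary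
    [rho = 0], so only the bump times [- grad rho] survives in the gradient, and the uniqueness of
    the normal identifies its direction with that of any given [nu]. *)
Let piece_bdry Omega x : smooth_bounded_domain Omega -> bdry Omega x ->
  exists p : R * (V -> R), [/\ 0 < p.1, smooth p.2,
    forall y, (Omega y -> 0 <= p.2 y) /\ (~ Omega y -> p.2 y <= 0),
    forall y, Omega y -> `|y - x| < p.1 -> 0 < p.2 y &
    forall y nu, bdry Omega y -> outward_normal Omega y nu ->
      p.2 y = 0 /\ exists2 a : R, 0 <= a &
        (`|y - x| < p.1 -> 0 < a) /\ forall i, pderiv i p.2 y = - a * nu ord0 i].
Proof.
move=> [_ oO _ _ hb] bx; have [rho [srho [i ri] nr]] := hb _ bx.
have ci : {for x, continuous (fun y => `|pderiv i rho y|)}.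
  apply: for_cont_comp; last exact: norm_continuous.
  by apply: smooth_continuous; exact: smooth_pderiv.
have pos : 0 < `|pderiv i rho x| by rewrite normr_gt0.
(* Passing to the interior makes [rho] a local defining function at all points near [x], and not
   only at [x]. *)
have := near_and (near_gt ci pos) (nbhs_interior nr).
move=> /nbhs_ballP[r/= r0 hr].
have {hr} hr y : `|y - x| < r -> 0 < `|pderiv i rho y| /\ \forall z \near y, Omega z <-> rho z < 0.
  by move=> yx; apply: hr; rewrite mx_norm_ball /ball_/= distrC.
pose f y := bump x r y * - rho y.
have sN : smooth (fun y => - rho y).
  have -> : (fun y => - rho y) = fun y => (-1) * rho y by apply/funext => y; rewrite mulN1r.
  by apply: smoothM => //; exact: smooth_cst.
have L y : `|y - x| < r -> local_defining Omega y rho.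
  move=> yx; split => //; last exact: (hr y yx).2.
  by exists i; have := (hr y yx).1; rewrite normr_gt0.
exists (r, f); split => //=.
- by apply: smoothM => //; exact: smooth_bump.
- move=> y; rewrite /f; have [yx|yx] := ltP `|y - x| r; last by rewrite bump_eq0// mul0r.
  split=> [Oy|nOy].
    rewrite mulr_ge0 ?bump_ge0// oppr_ge0 ltW//.
    exact/(nbhs_singleton (hr y yx).2).
  rewrite mulr_ge0_le0 ?bump_ge0// oppr_le0 leNgt; apply/negP.
  by move/(nbhs_singleton (hr y yx).2).
- move=> y Oy yx; rewrite mulr_gt0 ?bump_gt0// oppr_gt0.
  exact/(nbhs_singleton (hr y yx).2).
- move=> y nu by_ ny.
  have fE j : pderiv j f y = pderiv j (bump x r) y * - rho y + bump x r y * - pderiv j rho y.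
    rewrite pderivM; [|exact: smooth_pderivable (smooth_bump _ _)|exact: smooth_pderivable].
    congr (_ + _ * _); apply: pderivE; apply: is_deriveN; apply: pderivableP.
    exact: smooth_pderivable.
  have [yx|yx] := ltP `|y - x| r; last first.
    rewrite /f bump_eq0// mul0r; split => //; exists 0 => //; split=> // j.
    by rewrite -/f fE bump_grad0// bump_eq0// !mul0r addr0 oppr0 mul0r.
  have r00 := local_defining_bdry by_ (L y yx).
  rewrite /f r00 oppr0 mulr0; split => //.
  pose S := \sum_(j < n) pderiv j rho y ^+ 2.
  have n2 : outward_normal Omega y ((Num.sqrt S)^-1 *: \row_(j < n) pderiv j rho y).
    by exists rho => //; exact: L.
  have S0 : 0 < S.
    rewrite /S (bigD1 i)//= ltr_pwDl ?exprn_even_gt0//.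
      by have := (hr y yx).1; rewrite normr_gt0.
    by apply: sumr_ge0 => j _; exact: sqr_ge0.
  have b0 : 0 < bump x r y * Num.sqrt S by rewrite mulr_gt0 ?bump_gt0// sqrtr_gt0.
  exists (bump x r y * Num.sqrt S); [exact: ltW|split => // j].
  rewrite -/f fE r00 oppr0 mulr0 add0r (outward_normal_uniq by_ ny n2) !mxE.
  by rewrite mulrN mulNr -mulrA mulVKf// gt_eqF// sqrtr_gt0.
Qed.

Lemma closure_bounded_compact Omega : bounded_set Omega -> compact (closure Omega).
Proof.
move=> bO; apply: bounded_closed_compact; last exact: closed_closure.
have [M [_ /(_ (M + 1))]] := bO; rewrite ltrDl ltr01 => /(_ isT) H.
exists (M + 1); split; first by rewrite num_real.
move=> N MN x cx; have e0 : 0 < N - (M + 1) by rewrite subr_gt0.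
have [y [Oy yx]] := cx _ (nbhsx_ballx x _ e0).
rewrite /= -(subrK y x) (le_trans (ler_normD _ _))// -[leRHS](subrK (M + 1)) lerD//.
  by move: yx; rewrite mx_norm_ball => /ltW.
exact: H.
Qed.

(** The sum of the pieces of a finite subcover of the compact closure. At each point one piece
    contributes strictly and the others have the right sign, which gives positivity inside and a
    strictly inward gradient on the boundary. The sign is opposite to that of [local_defining]. *)
Lemma exists_defining_function Omega : smooth_bounded_domain Omega ->
  exists rho, [/\ smooth rho, forall y, Omega y -> 0 < rho y,
    forall y, bdry Omega y -> rho y = 0, forall y, ~ Omega y -> rho y <= 0 &
    forall y nu, bdry Omega y -> outward_normal Omega y nu ->
      exists2 a : R, 0 < a & forall i, pderiv i rho y = - a * nu ord0 i].
Proof.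
move=> sO; have [_ oO _ bO hb] := sO.
have piece x : exists p : R * (V -> R), smooth p.2 /\ (closure Omega x -> [/\ 0 < p.1, smooth p.2,
    forall y, (Omega y -> 0 <= p.2 y) /\ (~ Omega y -> p.2 y <= 0),
    forall y, Omega y -> `|y - x| < p.1 -> 0 < p.2 y &
    forall y nu, bdry Omega y -> outward_normal Omega y nu ->
      p.2 y = 0 /\ exists2 a : R, 0 <= a &
        (`|y - x| < p.1 -> 0 < a) /\ forall i, pderiv i p.2 y = - a * nu ord0 i]).
  have [cx|ncx] := pselect (closure Omega x); last first.
    (* Outside the closure a dummy pair lets the axiom of choice produce a total function. *)
    by exists (1, fun=> 0); split => //; exact: smooth_cst.
  have [Ox|nOx] := pselect (Omega x).
    by have [p Hp] := piece_interior oO Ox; exists p; split => //; have [] := Hp.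
  by have [p Hp] := piece_bdry sO (conj cx nOx); exists p; split => //; have [] := Hp.
have {piece}[p Hp] := choice piece.
have := closure_bounded_compact bO; rewrite compact_cover.
move=> /(_ _ (closure Omega) (fun x => ball x (p x).1)) [].
- by move=> x /(Hp x).2[p0 _ _ _ _]; exact: ball_open.
- by move=> x cx; exists x => //; apply: ballxx; have [] := (Hp x).2 cx.
move=> D' D'O cover; pose s : seq V := finmap.enum_fset D'.
have sO' x : x \in s -> closure Omega x by move=> xs; have := D'O x xs; rewrite inE.
have cov y : closure Omega y -> exists2 x, x \in s & `|y - x| < (p x).1.
  by move=> /cover[x /= xs]; rewrite mx_norm_ball /ball_/= distrC => yx; exists x.
pose rho y := \sum_(x <- s) (p x).2 y.
exists rho; split.
- by apply: smooth_sum => x; exact: (Hp x).1.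
- move=> y Oy; have [x xs yx] := cov y (subset_closure Oy).
  have [_ _ _ /(_ y Oy yx) fx0 _] := (Hp x).2 (sO' x xs).
  rewrite /rho (big_rem x)//= ltr_pwDl// big_seq; apply: sumr_ge0 => z zs.
  by have [_ _ /(_ y)[+ _] _ _] := (Hp z).2 (sO' z (mem_rem zs)); apply.
- move=> y by_; have [rho' L] := hb _ by_.
  have [nu ny] : exists nu, outward_normal Omega y nu by eexists; exists rho'.
  rewrite /rho big_seq; apply: big1 => z zs.
  by have [_ _ _ _ /(_ y nu by_ ny)[]] := (Hp z).2 (sO' z zs).
- move=> y nOy; rewrite /rho big_seq; apply: sumr_le0 => z zs.
  by have [_ _ /(_ y)[_ +] _ _] := (Hp z).2 (sO' z zs); apply.
- move=> y nu by_ ny.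
  have rE i : pderiv i rho y = \sum_(x <- s) pderiv i (p x).2 y.
    apply: pderivE; rewrite /rho; elim: (s) => [|x s' IH].
      by under eq_fun do rewrite big_nil; rewrite big_nil; exact: is_derive_cst.
    under eq_fun do rewrite big_cons; rewrite big_cons.
    apply: is_deriveD => //; apply: pderivableP; apply: smooth_pderivable.
    exact: (Hp x).1.
  have [c Hc] : exists c : V -> R, forall x, x \in s -> [/\ 0 <= c x,
      (`|y - x| < (p x).1 -> 0 < c x) & forall i, pderiv i (p x).2 y = - c x * nu ord0 i].
    suff /choice[c Hc] : forall x, exists c : R, x \in s -> [/\ 0 <= c,
        (`|y - x| < (p x).1 -> 0 < c) & forall i, pderiv i (p x).2 y = - c * nu ord0 i].
      by exists c.
    move=> x.
    have [xs|_] := boolP (x \in s); last by exists 0.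
    have [_ _ _ _ /(_ y nu by_ ny)[_ [a a0 [H1 H2]]]] := (Hp x).2 (sO' x xs).
    by exists a.
  exists (\sum_(x <- s) c x); last first.
    move=> i; rewrite rE mulNr mulr_suml -sumrN big_seq [RHS]big_seq.
    by apply: eq_bigr => x xs; have [_ _ ->] := Hc x xs; rewrite mulNr.
  have [x xs yx] := cov y by_.1.
  rewrite (big_rem x)//= ltr_pwDl//; first by have [_ /(_ yx)] := Hc x xs.
  rewrite big_seq; apply: sumr_ge0 => z zs.
  by have [] := Hc z (mem_rem zs).
Qed.

End global_defining_function.

(** The arithmetic that closes the elliptic principle: [a] and [b] stand for [w] at an arbitrary
    point and at the maximum, [ra] and [rb] for [eps * rho] at these points, [l] and [lr] for the
    Laplacians of [w] and [eps * rho] at the maximum. *)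
Lemma le_of_perturbation (R : realFieldType) (a b ra rb P l lr D K : R) :
  a + ra <= b + rb -> b - l <= K -> 0 <= ra -> rb <= P -> - lr <= D ->
  l + lr <= 0 -> a <= K + (D + P).
Proof. by move=> *; lra. Qed.

Lemma le_of_addr_le0 (R : realFieldType) (a b d : R) : a + b <= 0 -> - b <= d -> a <= d.
Proof. by move=> *; lra. Qed.

Lemma le1_subr (R : realFieldType) (c k : R) : c <= k -> 1 <= k + 1 - c.
Proof. by move=> *; lra. Qed.

(** * Maximum principles *)

Section maximum_principles.
Context {R : realType} {n : nat}.
Local Notation V := 'rV[R]_n.
Implicit Types (x y nu d : V) (r : R) (w rho f g : V -> R).

(** The regularity on which the maximum principles run. It is stable under linear combinations,
    products and composition, and asks only for the existence of the pure second derivatives. *)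
Definition neumann_regular (Omega : set V) w : Prop :=
  [/\ {within closure Omega, continuous w},
      forall i x, Omega x -> pderivable i w x,
      forall i x, Omega x -> {for x, continuous (pderiv i w)},
      forall i x, Omega x -> pderivable i (pderiv i w) x &
      neumann Omega w].

Lemma is_derive2D f g i x : (\forall y \near x, pderivable i f y) ->
  (\forall y \near x, pderivable i g y) ->
  pderivable i (pderiv i f) x -> pderivable i (pderiv i g) x ->
  is_derive x (delta_mx ord0 i) (pderiv i (fun y => f y + g y))
    (pderiv i (pderiv i f) x + pderiv i (pderiv i g) x).
Proof.
move=> fd gd f2 g2.
apply: (@near_eq_is_derive _ _ _ (fun y => pderiv i f y + pderiv i g y)).
  apply: filterS (near_and fd gd) => y [fy gy].
  by apply/esym; apply: pderivE; apply: is_deriveD; exact: pderivableP.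
by apply: is_deriveD; exact: pderivableP.
Qed.

Lemma is_derive2Z (c : R) f i x : (\forall y \near x, pderivable i f y) ->
  pderivable i (pderiv i f) x ->
  is_derive x (delta_mx ord0 i) (pderiv i (fun y => c * f y))
    (c * pderiv i (pderiv i f) x).
Proof.
move=> fd f2.
apply: (@near_eq_is_derive _ _ _ (fun y => c * pderiv i f y)).
  apply: filterS fd => y fy.
  by apply/esym; apply: pderivE; apply: is_deriveZ; exact: pderivableP.
by apply: is_deriveZ; exact: pderivableP.
Qed.

Variable Omega : set V.
Hypothesis sO : smooth_bounded_domain Omega.

Let oO : open Omega. Proof. by have [] := sO. Qed.
Let bO : bounded_set Omega. Proof. by have [] := sO. Qed.
Let Oinc x : Omega x -> closure Omega x. Proof. exact: subset_closure. Qed.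

Lemma near_in (P : V -> Prop) x : Omega x -> (forall y, Omega y -> P y) ->
  \forall y \near x, P y.
Proof. by move=> Ox HP; apply: filterS (near_open oO Ox). Qed.

Lemma closureE x : closure Omega x -> Omega x \/ bdry Omega x.
Proof. by move=> cx; have [Ox|nOx] := pselect (Omega x); [left|right]. Qed.

(* Near a boundary point, [w + eps rho] increases along the inner normal. *)
Lemma bdry_not_max w rho (eps : R) x nu : 0 < eps -> bdry Omega x ->
  outward_normal Omega x nu ->
  {within closure Omega, continuous w} ->
  (forall i y, Omega y -> pderivable i w y) ->
  (forall i y, Omega y -> {for y, continuous (pderiv i w)}) ->
  neumann Omega w -> smooth rho ->
  (exists2 a : R, 0 < a & forall i, pderiv i rho x = - a * nu ord0 i) ->
  exists2 y, Omega y & w x + eps * rho x < w y + eps * rho y.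
Proof.
move=> eps0 bx nx cw dw cdw nw srho [a a0 ra].
have u1 := outward_normal_unit nx.
pose F y := w y + eps * rho y.
pose DF y := \sum_(i < n) (- nu) ord0 i * (pderiv i w y + eps * pderiv i rho y).
have FD y : Omega y -> is_derive y (- nu) F (DF y).
  move=> Oy.
  have dw' : is_derive y (- nu) w (\sum_i (- nu) ord0 i * pderiv i w y).
    by apply: is_derive_partials => [|i]; [apply: near_in => // z Oz i; exact: dw|exact: cdw].
  have dr := is_deriveZ eps (smooth_is_derive y (- nu) srho).
  have := is_deriveD dw' dr; rewrite /GRing.scale/= mulr_sumr -big_split/=.
  by rewrite /DF; under eq_bigr do [rewrite [eps * _]mulrCA -mulrDr]; apply.
(* A local defining function whose normal is [nu] shows that [x - s nu] lies in [Omega] for small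
   positive [s]. *)
have [rho1 L1 [b b0 rb]] := outward_normal_grad nx.
have [s1 _ near1] := L1.
have [e1 e10 h1] : exists2 e, 0 < e & forall s, 0 < s < e -> rho1 (x + s *: - nu) < 0.
  apply: (near_dir_lt0 (smooth_is_derive x (- nu) s1)).
    have -> : \sum_i (- nu) ord0 i * pderiv i rho1 x = - b * \sum_i nu ord0 i ^+ 2.
      by rewrite mulr_sumr; apply: eq_bigr => i _; rewrite rb !mxE; ring.
    by rewrite u1 mulr1 oppr_lt0.
  by rewrite (local_defining_bdry bx L1).
(* Near [x] the Neumann condition keeps the derivative of [w] along [nu] below [eps * a / 2], while
   that of [eps * rho] is below [- eps * a / 2]. *)
have near2 : \forall y \near x, Omega y -> 0 < DF y.
  have ea : 0 < eps * a / 2 by rewrite divr_gt0 ?mulr_gt0.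
  have n1 : \forall y \near x, Omega y -> \sum_(i < n) pderiv i w y * nu ord0 i < eps * a / 2.
    by have := nw x nu bx nx => /cvgr_lt/(_ _ ea).
  have cr : {for x, continuous (fun y => \sum_(i < n) nu ord0 i * pderiv i rho y)}.
    apply: smooth_continuous; apply: smooth_sum => i; apply: smoothM; first exact: smooth_cst.
    exact: smooth_pderiv.
  have rx : \sum_(i < n) nu ord0 i * pderiv i rho x < - (a / 2).
    have -> : \sum_(i < n) nu ord0 i * pderiv i rho x = - a * \sum_(i < n) nu ord0 i ^+ 2.
      by rewrite mulr_sumr; apply: eq_bigr => i _; rewrite ra; ring.
    by rewrite u1; lra.
  apply: filterS (near_and n1 (near_lt cr rx)) => y [h2 h3] Oy.
  have -> : DF y = - (\sum_(i < n) pderiv i w y * nu ord0 i) -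
      eps * \sum_(i < n) nu ord0 i * pderiv i rho y.
    rewrite mulr_sumr -!sumrN -big_split/=; apply: eq_bigr => i _; rewrite mxE; ring.
  have := h2 Oy; have : eps * \sum_(i < n) nu ord0 i * pderiv i rho y < eps * - (a / 2).
    by rewrite ltr_pM2l.
  by move: ea => ?; lra.
have [e2 e20 h2] := near_line (- nu) (near_and near1 near2).
pose s := Num.min (e1 / 2) (e2 / 2).
have s0 : 0 < s by rewrite lt_min !divr_gt0.
have [se1 se2] : s < e1 /\ s < e2.
  by rewrite /s; split; rewrite gt_min; apply/orP; [left|right]; lra.
have inO t : 0 < t <= s -> Omega (x + t *: - nu).
  move=> /andP[t0 ts]; have [_ ] := (h2 t (ltac:(rewrite gtr0_norm//; lra))).1.
  by apply; apply: h1; lra.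
have [c /andP[c0 cs] E] : exists2 c : R, 0 < c < s & F (x + s *: - nu) - F x = DF (x + c *: - nu) * s.
  apply: (@MVT_line _ _ F (fun t => DF (x + t *: - nu))) => // [t /andP[t0 ts]|].
    by apply: FD; apply: inO; lra.
  refine (@within_comp R V R _ (closure Omega) (fun t : R => x + t *: - nu) F _ _ _).
  - exact: continuous_line.
  - move=> t /=; rewrite in_itv/= => /andP[t0 ts]; move: t0; rewrite le_eqVlt => /predU1P[<-|t0].
      by rewrite scale0r addr0; exact: bx.1.
    by apply/Oinc/inO; lra.
  - apply: within_contD => //; apply: within_contM; first by move=> ?; exact: cst_continuous.
    by apply: continuous_subspaceT; exact: smooth_continuous.
exists (x + s *: - nu); first by apply: inO; lra.
rewrite -subr_gt0 [X in 0 < X]E mulr_gt0// (h2 c _).2//; first by rewrite gtr0_norm//; lra.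
by apply: inO; lra.
Qed.

Lemma laplacian_smooth f : smooth f -> smooth (laplacian f).
Proof. by move=> sf; apply: smooth_sum => i; do 2!apply: smooth_pderiv. Qed.

Lemma interior_max_laplacian w rho (eps : R) y : smooth rho -> Omega y ->
  (forall i x, Omega x -> pderivable i w x) ->
  (forall i x, Omega x -> pderivable i (pderiv i w) x) ->
  (forall z, Omega z -> w z + eps * rho z <= w y + eps * rho y) ->
  laplacian w y + eps * laplacian rho y <= 0.
Proof.
move=> srho Oy dw d2w ymax; pose F z := w z + eps * rho z.
rewrite mulr_sumr -big_split/=; apply: sumr_le0 => i _.
have dr z : pderivable i rho z by exact: smooth_pderivable.
have d2r z : pderivable i (pderiv i rho) z by apply: smooth_pderivable; exact: smooth_pderiv.
have der := is_derive2Z eps (near_all y dr) (d2r y).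
have dwn : \forall z \near y, pderivable i w z by apply: near_in => // z; exact: dw.
have drn : \forall z \near y, pderivable i (fun z => eps * rho z) z.
  by apply: near_all => z; apply: derivableZ; exact: dr.
have [erd erv] := der.
have dF := is_derive2D dwn drn (d2w i y Oy) erd.
have := pderivE dF; rewrite -/F => FE.
rewrite -(pderivE der) -FE {FE}; apply: derive2_max.
- apply: near_in => // z Oz; apply: derivableD; first exact: dw.
  by apply: derivableZ; exact: dr.
- by case: dF.
- by apply: near_in => // z Oz; exact: ymax.
Qed.

(** By [bdry_not_max] a maximum of [w + eps rho] over the closure lies inside, where the Laplacian
    of the sum is nonpositive. This bounds [w] by [K] up to a fixed multiple of [eps], and [eps]
    tends to 0. *)
Lemma elliptic_max_principle w (K : R) : neumann_regular Omega w ->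
  (forall x, Omega x -> w x - laplacian w x <= K) ->
  forall x, closure Omega x -> w x <= K.
Proof.
move=> [cw dw cdw d2w nw] wK.
have [rho [srho rpos r0 _ rgrad]] := exists_defining_function sO.
have cc := closure_bounded_compact bO.
have crho : {within closure Omega, continuous rho}.
  by apply: continuous_subspaceT; exact: smooth_continuous.
have [P P0 HP] := compact_bounded_above cc crho.
have clap : {within closure Omega, continuous (laplacian rho)}.
  by apply: continuous_subspaceT; apply: smooth_continuous; exact: laplacian_smooth.
have [D D0 HD] := compact_bounded_above cc clap.
have rho0 y : closure Omega y -> 0 <= rho y.
  by move=> /closureE[/rpos/ltW//|/r0 ->].
suff H eps : 0 < eps -> forall x, closure Omega x -> w x <= K + eps * (D + P).
  move=> x cx; apply/ler_addgt0Pr => e e0.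
  have DP : 0 < D + P + 1 by lra.
  apply: le_trans (H (e / (D + P + 1)) _ x cx) _; first by rewrite divr_gt0.
  rewrite lerD2l// mulrAC ler_pdivrMr// ler_pM2l//; lra.
move=> eps0 x cx; pose F y := w y + eps * rho y.
have cF : {within closure Omega, continuous F}.
  apply: within_contD => //; apply: within_contM => //.
  by move=> ?; exact: cst_continuous.
have [y] := compact_EVT_max (ex_intro _ x cx) cc cF; rewrite inE => cy ymax.
have ymax' z : closure Omega z -> F z <= F y by move=> cz; apply: ymax; rewrite inE.
have [Oy|by_] := closureE cy; last first.
  have [_ _ _ _ /(_ y by_)[rho1 L1]] := sO.
  have [nu ny] : exists nu, outward_normal Omega y nu by eexists; exists rho1.
  have [z Oz] := bdry_not_max eps0 by_ ny cw dw cdw nw srho (rgrad y nu by_ ny).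
  by rewrite ltNge => /negP[]; exact/ymax'/Oinc.
have lap0 : laplacian w y + eps * laplacian rho y <= 0.
  by apply: interior_max_laplacian => // z Oz; exact/ymax'/Oinc.
have := ymax' x cx; rewrite /F => h1; have h2 := wK y Oy.
have h3 : eps * rho x >= 0 by rewrite mulr_ge0 ?rho0// ltW.
have h4 : eps * rho y <= eps * P.
  by rewrite ler_pM2l// (le_trans _ (HP y cy))// ler_norm.
have h5 : - (eps * laplacian rho y) <= eps * D.
  rewrite -mulrN ler_pM2l// (le_trans _ (HD y cy))// -normrN ler_norm//.
by rewrite mulrDr; apply: le_of_perturbation h1 h2 h3 h4 h5 lap0.
Qed.

(** Argued on [exp(-(k+1) t) w + eps rho]: the exponential makes the zero-order coefficient at most
    -1, so a positive value of [w] at the maximum is at most [a] times its Laplacian there, and that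
    Laplacian is of order [eps]. *)
Lemma parabolic_max_principle (w : V -> R -> R) (t1 A k : R) : 0 <= A ->
  {within closure Omega `*` `[0, t1], continuous (fun p : V * R => w p.1 p.2)} ->
  (forall t, 0 < t <= t1 -> neumann_regular Omega (w^~ t)) ->
  (forall x t, Omega x -> 0 < t <= t1 -> exists a c : R, [/\ 0 <= a <= A, c <= k &
     is_derive t 1 (w x) (a * laplacian (w^~ t) x + c * w x t)]) ->
  (forall x, closure Omega x -> w x 0 <= 0) ->
  forall x t, closure Omega x -> 0 <= t <= t1 -> w x t <= 0.
Proof.
move=> A0 cw rw eqw w0 x0 t0 cx0 t0in.
have [rho [srho rpos r0 _ rgrad]] := exists_defining_function sO.
have cc := closure_bounded_compact bO.
have crho : {within closure Omega, continuous rho}.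
  by apply: continuous_subspaceT; exact: smooth_continuous.
have [P P0 HP] := compact_bounded_above cc crho.
have clap : {within closure Omega, continuous (laplacian rho)}.
  by apply: continuous_subspaceT; apply: smooth_continuous; exact: laplacian_smooth.
have [D D0 HD] := compact_bounded_above cc clap.
have rho0 y : closure Omega y -> 0 <= rho y.
  by move=> /closureE[/rpos/ltW//|/r0 ->].
pose E (t : R) := expR (- (k + 1) * t).
have E0 t : 0 < E t by exact: expR_gt0.
suff H eps : 0 < eps -> E t0 * w x0 t0 <= eps * (A * D + P).
  rewrite leNgt; apply/negP => wpos.
  have q0 : 0 < E t0 * w x0 t0 by rewrite mulr_gt0.
  have AP : 0 < A * D + P + 1 by rewrite ltr_wpDl// addr_ge0// mulr_ge0.
  have := H (E t0 * w x0 t0 / (A * D + P + 1)) (ltac:(by rewrite divr_gt0)).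
  rewrite mulrAC ler_pdivlMr// ler_pM2l//; lra.
move=> eps0; pose F (p : V * R) := E p.2 * w p.1 p.2 + eps * rho p.1.
have cK : compact (closure Omega `*` `[0, t1]).
  by apply: compact_setX => //; exact: segment_compact.
have cF : {within closure Omega `*` `[0, t1], continuous F}.
  apply: within_contD.
    apply: within_contM => //; apply: continuous_subspaceT => p.
    apply: (@for_cont_comp R _ expR (fun q : V * R => - (k + 1) * q.2) p); last exact: continuous_expR.
    apply: (@for_contM R _ (fun=> - (k + 1)) snd p); [exact: cst_continuous|exact: cvg_snd].
  apply: within_contM; first by move=> ?; exact: cst_continuous.
  apply: continuous_subspaceT => p.
  apply: continuous_comp; [exact: cvg_fst|exact: smooth_continuous].
have [|[y s]] := compact_EVT_max _ cK cF.
  by exists (x0, t0); split => //=; rewrite in_itv.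
rewrite inE => -[/= cy]; rewrite in_itv/= => /andP[s0 s1] ymax0.
have ymax z t : closure Omega z -> 0 <= t <= t1 -> F (z, t) <= F (y, s).
  by move=> cz t01; apply: ymax0; rewrite inE; split => //=; rewrite in_itv.
have Fy : F (y, s) <= eps * (A * D + P) -> E t0 * w x0 t0 <= eps * (A * D + P).
  apply: le_trans; apply: le_trans (ymax x0 t0 cx0 t0in).
  by rewrite /F/= lerDl mulr_ge0 ?rho0// ltW.
apply: Fy.
have Pbound : eps * rho y <= eps * P.
  by rewrite ler_pM2l// (le_trans _ (HP y cy))// ler_norm.
have AD0 : 0 <= eps * (A * D) by rewrite !mulr_ge0// ltW.
have [w0y|wpos] := leP (w y s) 0.
  rewrite /F/= mulrDr lerD// (le_trans _ AD0)// pmulr_rle0//.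
have {}s0 : 0 < s.
  rewrite lt_neqAle s0 andbT; apply/eqP => s00; move: wpos; rewrite -s00.
  by rewrite ltNge w0.
have sin : 0 < s <= t1 by rewrite s0.
have [cw' dw cdw d2w nw] := rw s sin.
(* At the fixed time [s], [F] equals [E s] times [w + eps' rho], so the lemmas about functions of
   space apply with [eps']. *)
pose eps' := eps / E s; have eps'0 : 0 < eps' by rewrite divr_gt0.
have FE z : F (z, s) = E s * (w z s + eps' * rho z).
  by rewrite /F/= mulrDr mulrA [E s * eps']mulrC divfK// gt_eqF.
have max' z : closure Omega z -> w z s + eps' * rho z <= w y s + eps' * rho y.
  by move=> cz; rewrite -(ler_pM2l (E0 s)) -!FE ymax// ltW.
have [Oy|by_] := closureE cy; last first.
  have [_ _ _ _ /(_ y by_)[rho1 L1]] := sO.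
  have [nu ny] : exists nu, outward_normal Omega y nu by eexists; exists rho1.
  have [z Oz] := bdry_not_max eps'0 by_ ny cw' dw cdw nw srho (rgrad y nu by_ ny).
  by rewrite ltNge => /negP[]; exact/max'/Oinc.
have lap0 : laplacian (w^~ s) y + eps' * laplacian rho y <= 0.
  by apply: interior_max_laplacian => // z Oz; exact/max'/Oinc.
have [a [c [/andP[a0 aA] ck wd]]] := eqw y s Oy sin.
have Ed : is_derive s 1 E (- (k + 1) * E s).
  have := @is_derive1_comp _ expR (fun t => - (k + 1) * t) s _ _ (is_derive_expR _)
    (is_deriveZ (- (k + 1)) (is_derive_id s 1)).
  by rewrite scaler1 mulrC.
have Fd : is_derive s 1 (fun t => F (y, t)) (- (k + 1) * E s * w y s +
    E s * (a * laplacian (w^~ s) y + c * w y s)).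
  have dF : is_derive s 1 (fun t => F (y, t)) _ :=
    is_deriveD (is_deriveM Ed wd) (@is_derive_cst R R R (eps * rho y) s 1).
  by apply: (@is_derive_eq _ _ _ _ _ _ _ _ dF); rewrite /GRing.scale/=; ring.
have inc : exists2 e : R, 0 < e & forall t, s - e < t < s -> F (y, t) <= F (y, s).
  exists s => // t /andP[t0' ts]; apply: ymax; first exact: cy.
  by rewrite subrr in t0'; rewrite (ltW t0') (ltW (lt_le_trans ts s1)).
have := left_max_derive Fd inc.
have -> : - (k + 1) * E s * w y s + E s * (a * laplacian (w^~ s) y + c * w y s) =
   E s * (a * laplacian (w^~ s) y - (k + 1 - c) * w y s) by ring.
rewrite pmulr_rge0// subr_ge0 => H1.
have H2 : w y s <= a * laplacian (w^~ s) y.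
  by apply: le_trans H1; rewrite ler_peMl ?(ltW wpos)//; exact: le1_subr.
have H3 : laplacian (w^~ s) y <= eps' * D.
  have : - laplacian rho y <= D by rewrite (le_trans (ler_norm _))// normrN HD.
  move=> /(ler_wpM2l (ltW eps'0)); rewrite mulrN => h.
  exact: le_of_addr_le0 lap0 h.
have H4 : w y s <= eps' * (A * D).
  apply: le_trans H2 _; rewrite mulrCA; apply: (@le_trans _ _ (a * (eps' * D))).
    by rewrite ler_wpM2l.
  by rewrite ler_wpM2r// mulr_ge0// ltW.
rewrite /F/= mulrDr lerD//.
have -> : eps * (A * D) = E s * (eps' * (A * D)) by rewrite [RHS]mulrA [E s * eps']mulrC divfK// gt_eqF.
by rewrite ler_pM2l.
Qed.

End maximum_principles.

(** * Lebesgue measure on row vectors *)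

Section measurability.
Context {R : realType} {n : nat}.
Local Notation V := 'rV[R]_n.
Implicit Types (x y : V) (Omega : set V).

(** The open cube, equal to the sup-norm ball when [0 < r]. The coordinatewise form exhibits it as a
    finite intersection of preimages of intervals. *)
Definition box (c : V) (r : R) : set V := [set x | forall i, `|x ord0 i - c ord0 i| < r].

Lemma measurable_box c r : measurable (box c r).
Proof.
have -> : box c r = \bigcap_(i in [set: 'I_n])
    ((fun x : V => x ord0 i) @^-1` `]c ord0 i - r, c ord0 i + r[%classic).
  apply/seteqP; split=> x /= H i.
    by move=> _; have := H i; rewrite /= in_itv/= ltr_norml; lra.
  by have := H i I; rewrite /= in_itv/= ltr_norml; lra.
apply: fin_bigcap_measurable; first exact: finite_finset.
move=> i _; rewrite -[X in measurable X]setTI.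
by apply: measurable_coord => //; exact: measurable_itv.
Qed.

(** The sigma-algebra is generated by the coordinates and not by the topology, so an open set is
    written as the countable union of the boxes of rational centre and radius [1/(k+1)] that it
    contains. *)
Lemma open_measurable_rV (U : set V) : open U -> measurable U.
Proof.
move=> oU.
pose q_ (q : 'rV[rat]_n) : V := \row_i ratr (q ord0 i).
pose F (p : 'rV[rat]_n * nat) := if `[< box (q_ p.1) p.2.+1%:R^-1 `<=` U >]
  then box (q_ p.1) p.2.+1%:R^-1 else set0.
have -> : U = \bigcup_p F p.
  apply/seteqP; split=> [x Ux|x [p _]]; last by rewrite /F; case: asboolP => // H; exact: H.
  have /nbhs_ballP[r/= r0 hr] := near_open oU Ux.
  have [k hk] : exists k : nat, (k.+1%:R^-1 : R) < r / 2.
    have [k _ /(_ k (leqnn k)) /= hk] := near_infty_natSinv_lt (PosNum (ltac:(rewrite divr_gt0//) : 0 < r / 2)).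
    by exists k.
  have qi i : exists q : rat, `|x ord0 i - ratr q| < k.+1%:R^-1.
    have k0 : 0 < k.+1%:R^-1 :> R by rewrite invr_gt0.
    set e := k.+1%:R^-1 in k0 *.
    have xe : x ord0 i < x ord0 i + e by rewrite ltrDl.
    have [q] := rat_in_itvoo xe.
    by rewrite in_itv/= => /andP[h1 h2]; exists q; rewrite ltr_norml; lra.
  have /choice[q hq] := qi.
  exists (\row_i q i, k) => //; rewrite /F; case: asboolP => [_|]; last first.
    case=> y /= hy; apply: hr; rewrite mx_norm_ball /ball_/=; apply/ball_rVP => // i.
    have := hy i; have := hq i; rewrite /q_/= !mxE => h1 h2.
    apply: le_lt_trans (ler_distD (ratr (q i)) _ _) _.
    rewrite (distrC (ratr (q i)) (y ord0 i)).
    by rewrite (lt_trans (ltrD h1 h2))// [ltRHS](splitr r) ltrD.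
  by move=> i /=; rewrite /q_ !mxE.
apply: countable_bigcupT_measurable; first exact: countableP.
by move=> p; rewrite /F; case: asboolP => // _; exact: measurable_box.
Qed.

Lemma cont_measurable_fun Omega (f : V -> R) : open Omega ->
  (forall x, Omega x -> {for x, continuous f}) -> measurable_fun Omega f.
Proof.
move=> oO fc; apply: (measurability _ (RGenOInfty.measurableE R)).
move=> /= _ [_ [a ->]] <-; apply: open_measurable_rV.
rewrite openE => x [Ox fx]; rewrite /interior.
move: fx; rewrite /= in_itv/= andbT => fx.
have := near_and (near_open oO Ox) (near_gt (fc x Ox) fx).
by apply: filterS => y [Oy fy]; split => //; rewrite /= in_itv/= andbT.
Qed.

End measurability.

Section lebesgue_measure_rv.
Context {R : realType}.

Lemma rv_cons0 n (p : measurableTypeR R * 'rV[R]_n) : rv_cons p ord0 ord0 = p.1.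
Proof. by rewrite -[in RHS](rv_consK p). Qed.

Lemma rv_consS n (p : measurableTypeR R * 'rV[R]_n) j :
  rv_cons p ord0 (lift ord0 j) = p.2 ord0 j.
Proof. by rewrite -[in RHS](rv_consK p) /= [RHS]mxE. Qed.

Lemma lebesgue_rv_box n (c : 'rV[R]_n) r : 0 < r ->
  lebesgue_rv n (box c r) = ((2 * r) ^+ n)%:E.
Proof.
move=> r0; elim: n c => [|m IH] c.
  rewrite /= (_ : box c r = setT); last by apply/seteqP; split=> // x _ [].
  by rewrite diracT expr0.
rewrite /= /lebesgue_step/= /pushforward.
have -> : rv_cons @^-1` box c r =
    `]c ord0 ord0 - r, c ord0 ord0 + r[%classic `*` box (rv_uncons c).2 r.
  apply/seteqP; split=> [[x y] /= H|[x y] /= [x1 y1]].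
    split=> [|i]; first by have := H ord0; rewrite rv_cons0 in_itv/= ltr_norml; lra.
    by have := H (lift ord0 i); rewrite rv_consS mxE.
  move=> i; case: (unliftP ord0 i) => [j ->|->].
    by rewrite rv_consS; have := y1 j; rewrite mxE.
  by rewrite rv_cons0; move: x1; rewrite in_itv/= ltr_norml; lra.
rewrite product_measure1E; [|exact: measurable_itv|exact: measurable_box].
rewrite IH exprS EFinM; congr (_ * _)%E.
transitivity (@lebesgue_measure R `]c ord0 ord0 - r, c ord0 ord0 + r[%classic) => //.
rewrite lebesgue_measure_itv/= lte_fin ifT; last lra.
by rewrite -EFinD; congr (_%:E); ring.
Qed.

Lemma bounded_finite_measure n (A : set 'rV[R]_n) : measurable A -> bounded_set A ->
  (lebesgue_rv n A < +oo)%E.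
Proof.
move=> mA [M [_ /(_ (Num.max M 0 + 1))]].
have M1 : M < Num.max M 0 + 1 by rewrite (@le_lt_trans _ _ (Num.max M 0))// ?le_max ?lexx// ltrDl.
have M0 : 0 < Num.max M 0 + 1 by rewrite (@le_lt_trans _ _ (Num.max M 0))// ?le_max ?lexx ?orbT// ltrDl.
move: M1 M0; set N := Num.max M 0 + 1 => M1 N0 /(_ M1) H.
have r0 : 0 < N + 1 by lra.
apply: (@le_lt_trans _ _ (lebesgue_rv n (box 0 (N + 1)))).
  apply: le_measure; rewrite ?inE//; first exact: measurable_box.
  move=> x /H /= xN; have : `|x - 0| < N + 1 by rewrite subr0; lra.
  by move/(ball_rVP _ _ r0).
by rewrite lebesgue_rv_box// ltry.
Qed.

Lemma bounded_fun_integrable n (A : set 'rV[R]_n) (f : 'rV[R]_n -> R) (M : R) :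
  measurable A -> (lebesgue_rv n A < +oo)%E -> measurable_fun A f ->
  (forall x, A x -> `|f x| <= M) -> (lebesgue_rv n).-integrable A (EFin \o f).
Proof.
move=> mA Aoo mf fM; apply: measurable_bounded_integrable => //.
exists M; split; first by rewrite num_real.
by move=> N MN x Ax /=; rewrite (le_trans (fM _ Ax))// ltW.
Qed.

End lebesgue_measure_rv.

(** * Integrals of partial derivatives of compactly supported functions *)

Section integral_of_derivative.
Context {R : realType}.

Lemma integral_derivative0 (f : R -> R) (L : R) : 0 < L ->
  (forall x, derivable f x 1) -> continuous (derive1 f) ->
  (forall x, L <= `|x| -> f x = 0) -> (forall x, L < `|x| -> derive1 f x = 0) ->
  (\int[lebesgue_measure]_x (derive1 f x)%:E = 0)%E.
Proof.
move=> L0 df cf f0 f'0.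
have cf0 : continuous f by move=> x; apply: differentiable_continuous; apply/derivable1_diffP.
pose I := `[- L, L]%classic : set R.
transitivity (\int[lebesgue_measure]_(x in I) (derive1 f x)%:E)%E.
  rewrite [RHS]integral_mkcond; apply: eq_integral => x _; rewrite patchE.
  case: ifPn => //; rewrite notin_setE /I/= in_itv/= => /negP.
  by rewrite -ler_norml -ltNge => /f'0 ->.
rewrite (@continuous_FTC2 _ (derive1 f) f) //.
- by rewrite !f0 ?normrN ?gtr0_norm// sube0.
- by lra.
- exact: continuous_subspaceT.
- by split=> [x _||]; [exact: df|apply: cvg_at_right_filter|apply: cvg_at_left_filter]; exact: cf0.
Qed.

Lemma rv_cons_add0 n (p : measurableTypeR R * 'rV[R]_n) (s : R) :
  rv_cons p + s *: delta_mx ord0 ord0 = rv_cons (p.1 + s, p.2).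
Proof.
apply/rowP => i; case: (unliftP ord0 i) => [j ->|->]; rewrite [LHS]mxE [X in _ + X]mxE [X in _ + _ * X]mxE /=.
  by rewrite !rv_consS/= mulr0 addr0.
by rewrite !rv_cons0/= mulr1.
Qed.

Lemma rv_cons_addS n (p : measurableTypeR R * 'rV[R]_n) (s : R) j :
  rv_cons p + s *: delta_mx ord0 (lift ord0 j) = rv_cons (p.1, p.2 + s *: delta_mx ord0 j).
Proof.
apply/rowP => i; case: (unliftP ord0 i) => [k ->|->]; rewrite [LHS]mxE [X in _ + X]mxE [X in _ + _ * X]mxE /=.
  by rewrite !rv_consS/= !mxE/= (inj_eq lift_inj).
by rewrite !rv_cons0/= mulr0 addr0.
Qed.

Lemma continuous_rv_consl n (y : 'rV[R]_n) : continuous (fun x : R => rv_cons (x : measurableTypeR R, y)).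
Proof.
have -> : (fun x : R => rv_cons (x : measurableTypeR R, y)) =
    fun x => rv_cons (0, y) + x *: delta_mx ord0 ord0.
  by apply/funext => x; rewrite rv_cons_add0 add0r.
exact: continuous_line.
Qed.

Lemma continuous_rv_consr n (x : R) : continuous (fun y : 'rV[R]_n => rv_cons (x : measurableTypeR R, y)).
Proof.
apply: norm_continuousP => y e e0; exists e => // z; move=> /ball_rVP-/(_ e0) yz.
apply/ball_rVP => // i; case: (unliftP ord0 i) => [j ->|->]; last by rewrite !rv_cons0 subrr normr0.
by rewrite !rv_consS/=.
Qed.

(** Fubini splits off the first coordinate. If [i] is that coordinate, the inner integral runs along
    it and vanishes by the fundamental theorem of calculus; otherwise the slice in the remaining
    coordinates falls under the induction hypothesis. *)
Lemma integral_pderiv0 n (i : 'I_n) (F : 'rV[R]_n -> R) (L : R) : 0 < L ->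
  (forall x, pderivable i F x) -> continuous (pderiv i F) ->
  (forall x, ~ box 0 L x -> F x = 0) ->
  (\int[lebesgue_rv n]_x (pderiv i F x)%:E = 0)%E.
Proof.
elim: n i F L => [[]//|m IH] i F L L0 dF cF F0; set g := pderiv i F.
(* The margin 1 leaves a whole neighbourhood of [x] on which [F] vanishes. *)
have g0 x : ~ box 0 (L + 1) x -> g x = 0.
  move=> nx; have [j xj] : exists j, L + 1 <= `|x ord0 j|.
    apply: contrapT => H; apply: nx => j; rewrite mxE subr0 ltNge; apply/negP => Lx.
    by apply: H; exists j.
  apply: pderivE; apply: (@near_eq_is_derive _ _ _ (fun=> 0) _ x _ 0 _ (is_derive_cst _ _ _)).
  have Lx : L < `|x ord0 j| by lra.
  have cj : {for x, continuous (fun y : 'rV[R]_m.+1 => `|y ord0 j|)}.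
    by apply: for_cont_comp; [exact: coord_continuous|exact: norm_continuous].
  apply: filterS (near_gt cj Lx) => y Ly; rewrite F0// => /(_ j).
  by rewrite mxE subr0 ltNge ltW.
have L10 : 0 < L + 1 by lra.
have bbox : bounded_set (box (0 : 'rV[R]_m.+1) (L + 1)).
  exists (L + 1); split; first by rewrite num_real.
  move=> M LM x /(ball_rVP _ _ L10); rewrite subr0 /= => h; lra.
have [M M0 gM] := compact_bounded_above (closure_bounded_compact bbox) (continuous_subspaceT cF).
have mg : measurable_fun setT g.
  by apply: cont_measurable_fun => [|x _]; [exact: openT|exact: cF].
have mB := @measurable_box R m.+1 0 (L + 1).
pose h := (EFin \o g) \o (@rv_cons R m).
have mh : measurable_fun setT h.
  by apply: measurableT_comp; [apply: measurableT_comp|exact: measurable_rv_cons].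
pose B := @rv_cons R m @^-1` box 0 (L + 1).
have mBp : measurable B.
  by rewrite -[X in measurable X]setTI; apply: measurable_rv_cons.
pose P := (@lebesgue_measure R \x lebesgue_rv m)%E.
have PB : (P B < +oo)%E.
  have := lebesgue_rv_box (0 : 'rV[R]_m.+1) L10.
  by rewrite /= /lebesgue_step/= /pushforward -/B /P => ->; rewrite ltry.
have hE : h = h \_ B.
  apply/funext => p; rewrite patchE; case: ifPn => //; rewrite notin_setE => nB.
  by rewrite /h/= g0.
have ih : P.-integrable setT h.
  suff : P.-integrable B (EFin \o (g \o @rv_cons R m)).
    by move=> H; rewrite hE; apply/(integrable_mkcond _ mBp).
  apply: measurable_bounded_integrable => //.
    by apply: measurable_funTS; apply: measurableT_comp => //; exact: measurable_rv_cons.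
  exists M; split; first by rewrite num_real.
  move=> N MN p Bp /=; rewrite (le_trans _ (ltW MN))// gM//.
  exact: subset_closure.
transitivity (\int[P]_p h p)%E.
  have := @integral_pushforward _ _ _ _ R (@rv_cons R m) (@measurable_rv_cons R m) P setT (EFin \o g).
  rewrite preimage_setT; apply=> //.
  by apply: measurableT_comp.
case: (unliftP ord0 i) => [j iE|iE].
  rewrite -(@fubini1 _ _ _ _ _ (@lebesgue_measure R) (lebesgue_rv m)) //.
  apply: integral0_eq => x _; rewrite /fubini_F.
  pose Fx y := F (rv_cons (x, y)).
  have dFx y : is_derive y (delta_mx ord0 j) Fx (g (rv_cons (x, y))).
    apply/is_derive_line0; rewrite /Fx.
    have -> : (fun s : R => F (rv_cons (x, y + s *: delta_mx ord0 j))) =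
        (fun s : R => F (rv_cons (x, y) + s *: delta_mx ord0 i)).
      by apply/funext => s; rewrite iE rv_cons_addS.
    by apply/is_derive_line0; exact: pderivableP.
  have gE : pderiv j Fx = fun y => g (rv_cons (x, y)).
    by apply/funext => y; apply: pderivE.
  have := IH j Fx L L0; rewrite gE; apply.
  - by move=> y; have [] := dFx y.
  - move=> y; apply: continuous_comp; [exact: continuous_rv_consr|exact: cF].
  - move=> y ny; apply: F0 => Hy; apply: ny => k; have := Hy (lift ord0 k).
    by rewrite rv_consS !mxE.
rewrite -(@fubini2 _ _ _ _ _ (@lebesgue_measure R) (lebesgue_rv m)) //.
apply: integral0_eq => y _; rewrite /fubini_G.
pose Fy (x : R) := F (rv_cons (x : measurableTypeR R, y)).
have dFy (x : R) : is_derive x 1 Fy (g (rv_cons (x : measurableTypeR R, y))).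
  have := is_derive_line (x := rv_cons (0 : measurableTypeR R, y)) (t := x) (d := delta_mx ord0 ord0)
    (df := g (rv_cons (x : measurableTypeR R, y))) (f := F).
  have -> : (fun s : R => F (rv_cons (0, y) + s *: delta_mx ord0 ord0)) = Fy.
    by apply/funext => s; rewrite rv_cons_add0/= add0r.
  by apply; rewrite rv_cons_add0/= add0r -iE; exact: pderivableP.
have gE : derive1 Fy = fun x => g (rv_cons (x, y)).
  by apply/funext => x; apply: derive1_eq.
have := @integral_derivative0 Fy (L + 1) L10; rewrite gE; apply.
- by move=> x; have [] := dFy x.
- move=> x; apply: continuous_comp; [exact: continuous_rv_consl|exact: cF].
- move=> x Lx; apply: F0 => /(_ ord0); rewrite rv_cons0/= mxE subr0; lra.
- move=> x Lx; apply: g0 => /(_ ord0); rewrite rv_cons0/= mxE subr0; lra.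
Qed.

End integral_of_derivative.

(** * Smooth approximation *)

Section bernstein.
Context {R : realType}.
Implicit Types (L x : R).

(* Bernstein weights in the variable [s = (x + L) / (2 L)], by the recursion of
   a sum of Bernoulli trials. *)
Definition bern_var L : {poly R} := (2 * L)^-1 *: ('X + L%:P).

Fixpoint bern L (N a : nat) : {poly R} :=
  match N, a with
  | 0, 0 => 1
  | 0, _.+1 => 0
  | N'.+1, 0 => (1 - bern_var L) * bern L N' 0
  | N'.+1, a'.+1 => bern_var L * bern L N' a' + (1 - bern_var L) * bern L N' a'.+1
  end.

Lemma bern_big L N a : (N < a)%N -> bern L N a = 0.
Proof.
elim: N a => [|N IH] [|a]//= Na; rewrite !IH ?mulr0 ?addr0//.
by rewrite ltnW.
Qed.

Lemma bern_sumS L N (F : nat -> R) x :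
  \sum_(0 <= a < N.+2) F a * (bern L N.+1 a).[x] =
  (bern_var L).[x] * (\sum_(0 <= a < N.+1) F a.+1 * (bern L N a).[x]) +
  (1 - (bern_var L).[x]) * (\sum_(0 <= a < N.+1) F a * (bern L N a).[x]).
Proof.
set s := (bern_var L).[x]; rewrite big_nat_recl//= hornerM hornerD hornerN hornerC -/s.
under eq_bigr do rewrite hornerD !hornerM hornerD hornerN hornerC -/s mulrDr.
rewrite big_split/= addrCA; congr (_ + _).
  by rewrite mulr_sumr; apply: eq_bigr => a _; rewrite mulrCA.
have -> : \sum_(0 <= a < N.+1) F a * (bern L N a).[x] =
    \sum_(0 <= a < N.+2) F a * (bern L N a).[x].
  by rewrite [RHS]big_nat_recr//= bern_big// horner0 mulr0 addr0.
rewrite [in RHS]big_nat_recl// mulrDr mulrCA; congr (_ + _).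
by rewrite mulr_sumr; apply: eq_bigr => a _; rewrite mulrCA.
Qed.

Lemma bern_sum1 L N x : \sum_(0 <= a < N.+1) (bern L N a).[x] = 1.
Proof.
elim: N => [|N IH]; first by rewrite big_nat1/= hornerC.
have E M m : \sum_(0 <= a < m) 1 * (bern L M a).[x] = \sum_(0 <= a < m) (bern L M a).[x].
  by apply: eq_bigr => a _; rewrite mul1r.
by have := bern_sumS L N (fun=> 1) x; rewrite !E IH => ->; ring.
Qed.

(** The variance of a binomial variable. The shift [d] lets the induction close: conditioning on one
    trial replaces it by [1 - s + d] or [- s + d]. *)
Lemma bern_variance L N x d :
  \sum_(0 <= a < N.+1) (a%:R - N%:R * (bern_var L).[x] + d) ^+ 2 * (bern L N a).[x] =
  N%:R * (bern_var L).[x] * (1 - (bern_var L).[x]) + d ^+ 2.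
Proof.
set s := (bern_var L).[x]; elim: N d => [|N IH] d; first by rewrite big_nat1/= hornerC; ring.
rewrite (bern_sumS L N (fun a => (a%:R - N.+1%:R * s + d) ^+ 2)) -/s.
have E1 : \sum_(0 <= a < N.+1) (a.+1%:R - N.+1%:R * s + d) ^+ 2 * (bern L N a).[x] =
    N%:R * s * (1 - s) + (1 - s + d) ^+ 2.
  rewrite -IH; apply: eq_bigr => a _; congr (_ ^+ 2 * _).
  by rewrite -!natr1; ring.
have E2 : \sum_(0 <= a < N.+1) (a%:R - N.+1%:R * s + d) ^+ 2 * (bern L N a).[x] =
    N%:R * s * (1 - s) + (- s + d) ^+ 2.
  rewrite -IH; apply: eq_bigr => a _; congr (_ ^+ 2 * _).
  by rewrite -!natr1; ring.
by rewrite E1 E2 -natr1; ring.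
Qed.

Lemma bern_ge0 L N a x : 0 < L -> `|x| <= L -> 0 <= (bern L N a).[x].
Proof.
move=> L0 xL; have L2 : 0 < 2 * L by rewrite mulr_gt0.
have [s0 s1] : 0 <= (bern_var L).[x] /\ 0 <= 1 - (bern_var L).[x].
  rewrite /bern_var hornerZ hornerD hornerX hornerC; move: xL; rewrite ler_norml => /andP[h1 h2].
  split; first by rewrite mulr_ge0// ?invr_ge0 ?(ltW L2)//; lra.
  by rewrite subr_ge0 mulrC ler_pdivrMr//; lra.
elim: N a => [|N IH] [|a] /=; rewrite ?hornerC ?horner0//.
  by rewrite hornerM hornerD hornerN hornerC mulr_ge0.
by rewrite hornerD !hornerM hornerD hornerN hornerC addr_ge0// mulr_ge0.
Qed.

(** The point that [bern_var] maps to [a / N]. *)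
Definition bern_node L N (a : nat) : R := 2 * L * (a%:R / N%:R) - L.

Lemma bern_node_variance L N x : 0 < L -> `|x| <= L ->
  \sum_(0 <= a < N.+2) (bern_node L N.+1 a - x) ^+ 2 * (bern L N.+1 a).[x] <= L ^+ 2 / N.+1%:R.
Proof.
move=> L0 xL; set s := (bern_var L).[x].
have L2 : 0 < 2 * L by rewrite mulr_gt0.
have sE : x = 2 * L * s - L.
  by rewrite /s /bern_var hornerZ hornerD hornerX hornerC mulVKf ?gt_eqF// addrK.
have N0 : N.+1%:R != 0 :> R by rewrite pnatr_eq0.
have Np : 0 < N.+1%:R :> R by rewrite ltr0n.
have -> : \sum_(0 <= a < N.+2) (bern_node L N.+1 a - x) ^+ 2 * (bern L N.+1 a).[x] =
    (2 * L / N.+1%:R) ^+ 2 * (N.+1%:R * s * (1 - s) + 0 ^+ 2).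
  rewrite -bern_variance mulr_sumr; apply: eq_bigr => a _; rewrite mulrA -exprMn.
  congr (_ ^+ 2 * _); rewrite /bern_node [in LHS]sE -/s.
  by move: (N.+1%:R : R) N0 => c c0; field.
have -> : (2 * L / N.+1%:R) ^+ 2 * (N.+1%:R * s * (1 - s) + 0 ^+ 2) =
    L ^+ 2 / N.+1%:R * (4 * (s * (1 - s))).
  by move: (N.+1%:R : R) N0 => c c0; field.
rewrite ler_piMr//; first by rewrite divr_ge0 ?sqr_ge0// ltW.
by have := sqr_ge0 (2 * s - 1); rewrite expr2; lra.
Qed.

End bernstein.

(** * Uniform approximation by Bernstein polynomials in several variables *)

Section weierstrass.
Context {R : realType} {n : nat}.
Local Notation V := 'rV[R]_n.
Implicit Types (x y : V) (L : R).

Lemma compact_uniformly_continuous (q : V -> R) (K : set V) (e : R) : compact K ->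
  continuous q -> 0 < e ->
  exists2 d : R, 0 < d & forall x y, K x -> `|x - y| < d -> `|q x - q y| < e.
Proof.
move=> /compact_near_coveringP cK cq e0.
pose P (d : R) x := forall y, `|x - y| < d -> `|q x - q y| < e.
have H : \forall d \near 0^'+, K `<=` P d.
  apply: cK => x _; have e2 : 0 < e / 2 by rewrite divr_gt0.
  have /cvgrPdist_lt/(_ _ e2) := cq x.
  move=> /nbhs_ballP[r/= r0 hr].
  have hr' y : `|x - y| < r -> `|q x - q y| < e / 2.
    by move=> xy; apply: hr; rewrite mx_norm_ball.
  exists (ball x (r / 2), [set d | 0 < d < r / 2]) => /=.
    split; first by apply: nbhsx_ballx; rewrite divr_gt0.
    near=> d; apply/andP; split; first by near: d; exact: nbhs_right_gt.
    by near: d; apply: nbhs_right_lt; rewrite divr_gt0.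
  move=> [y d] /= []; rewrite mx_norm_ball /ball_/= => xy /andP[d0 dr] z yz.
  have h1 : `|q x - q y| < e / 2 by apply: hr'; lra.
  have h2 : `|q x - q z| < e / 2.
    apply: hr'; rewrite (le_lt_trans (ler_distD y _ _))//; lra.
  rewrite (le_lt_trans (ler_distD (q x) _ _))// [X in X + _]distrC; lra.
have H2 : \forall d \near 0^'+, K `<=` P d /\ 0 < d.
  by apply: filterI; [exact: H|exact: nbhs_right_gt].
have [d [hd d0]] : exists d, K `<=` P d /\ 0 < d := @filter_ex _ _ (at_right_proper_filter 0) _ H2.
by exists d => // x y Kx; exact: hd.
Unshelve. all: by end_near.
Qed.

Lemma bounded_box (c : V) (r : R) : bounded_set (box c r).
Proof.
have [r0|r0] := ltP 0 r.
  exists (`|c| + r); split; first by rewrite num_real.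
  move=> M LM x /(ball_rVP _ _ r0) xc /=.
  rewrite -(subrK c x) (le_trans (ler_normD _ _))//; lra.
exists `|c|; split; first by rewrite num_real.
move=> M LM x H /=; have x0 : `|x - c| < 1.
  apply/ball_rVP => // i; have := H i; have := normr_ge0 (x ord0 i - c ord0 i); lra.
have -> : x = c; last exact: ltW.
apply/rowP => i; have := H i; have := normr_ge0 (x ord0 i - c ord0 i); lra.
Qed.

Definition bern_grid L N (f : {ffun 'I_n -> 'I_N.+2}) : V := \row_j bern_node L N.+1 (f j).

(** The tensor-product Bernstein polynomial of [q] on the cube [[-L, L]^n], with [N.+1] trials in
    each variable. *)
Definition bernstein (q : V -> R) L N x : R :=
  \sum_(f : {ffun 'I_n -> 'I_N.+2})
    q (bern_grid L f) * \prod_j (bern L N.+1 (f j)).[x ord0 j].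

Lemma bern_node_bound L N a : 0 < L -> (a <= N.+1)%N -> `|bern_node L N.+1 a| <= L.
Proof.
move=> L0 aN; rewrite /bern_node ler_norml.
have N0 : 0 < N.+1%:R :> R by rewrite ltr0n.
have a0 : 0 <= a%:R / N.+1%:R :> R by rewrite divr_ge0.
have a1 : a%:R / N.+1%:R <= 1 :> R by rewrite ler_pdivrMr// mul1r ler_nat.
move: (a%:R / N.+1%:R) a0 a1 => t t0 t1.
have : 0 <= 2 * L * t by rewrite !mulr_ge0// ltW.
have : 2 * L * t <= 2 * L by rewrite ler_piMr// mulr_ge0// ltW.
by move=> *; apply/andP; split; lra.
Qed.

Lemma bern_weight1 L N x :
  \sum_(f : {ffun 'I_n -> 'I_N.+2}) \prod_j (bern L N.+1 (f j)).[x ord0 j] = 1.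
Proof.
rewrite -(bigA_distr_bigA (fun j (a : 'I_N.+2) => (bern L N.+1 a).[x ord0 j])).
by apply: big1 => j _; rewrite -(bern_sum1 L N.+1 (x ord0 j)) big_mkord.
Qed.

(** The weights form a product distribution: the factors with [j != k] sum to 1 and the [k]-th one
    contributes the one-variable variance. *)
Lemma bern_weight_variance L N x (k : 'I_n) : 0 < L -> (forall j, `|x ord0 j| <= L) ->
  \sum_(f : {ffun 'I_n -> 'I_N.+2}) (bern_node L N.+1 (f k) - x ord0 k) ^+ 2 *
     \prod_j (bern L N.+1 (f j)).[x ord0 j] <= L ^+ 2 / N.+1%:R.
Proof.
move=> L0 xL; pose t j (a : 'I_N.+2) : R :=
  (if j == k then (bern_node L N.+1 a - x ord0 k) ^+ 2 else 1) * (bern L N.+1 a).[x ord0 j].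
have -> : \sum_(f : {ffun 'I_n -> 'I_N.+2}) (bern_node L N.+1 (f k) - x ord0 k) ^+ 2 *
     \prod_j (bern L N.+1 (f j)).[x ord0 j] = \sum_(f : {ffun 'I_n -> 'I_N.+2}) \prod_j t j (f j).
  apply: eq_bigr => f _; rewrite (bigD1 k)//= [in RHS](bigD1 k)//= /t eqxx mulrA.
  by congr (_ * _); apply: eq_bigr => j /negbTE ->; rewrite mul1r.
rewrite -(bigA_distr_bigA t) (bigD1 k)//= [X in _ * X]big1 => [|j jk].
  rewrite mulr1; apply: le_trans (bern_node_variance N L0 (xL k)).
  by rewrite big_mkord /t eqxx.
rewrite -(bern_sum1 L N.+1 (x ord0 j)) big_mkord; apply: eq_bigr => a _.
by rewrite /t (negbTE jk) mul1r.
Qed.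

(** Nodes closer to [x] than [d] cost at most [e / 2] by uniform continuity; the others are
    controlled through the variance, as in Chebyshev's inequality. *)
Lemma bernstein_approx (q : V -> R) L (e : R) : 0 < L -> continuous q -> 0 < e ->
  exists N, forall x, (forall j, `|x ord0 j| <= L) -> `|bernstein q L N x - q x| <= e.
Proof.
move=> L0 cq e0; pose K := closure (box (0 : V) (L + 1)).
have cK : compact K by apply: closure_bounded_compact; exact: bounded_box.
have inK x : (forall j, `|x ord0 j| <= L) -> K x.
  by move=> H; apply: subset_closure => j; rewrite mxE subr0; have := H j; lra.
have [M M0 HM] := compact_bounded_above cK (continuous_subspaceT cq).
have e2 : 0 < e / 2 by rewrite divr_gt0.
have [d d0 hd] := compact_uniformly_continuous cK cq e2.
(* For a node at distance at least [d], the trivial bound [2 M] is at most [c] times the sum of the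
   squared coordinate distances. *)
pose c := 2 * M / d ^+ 2.
have c0 : 0 <= c by apply: divr_ge0; [exact: mulr_ge0|exact: sqr_ge0].
pose D := c * n%:R * L ^+ 2 + 1.
have D0 : 0 < D by rewrite ltr_wpDl// mulr_ge0 ?sqr_ge0// mulr_ge0.
have eD : 0 < e / 2 / D by rewrite divr_gt0.
have [N _ /(_ N (leqnn N)) /= hN] := near_infty_natSinv_lt (PosNum eD).
exists N => x xL.
have gridL f j : `|(bern_grid L f : V) ord0 j| <= L.
  by rewrite mxE bern_node_bound// -ltnS.
have W0 f : 0 <= \prod_j (bern L N.+1 ((f : {ffun 'I_n -> 'I_N.+2}) j)).[x ord0 j].
  by apply: prodr_ge0 => j _; exact: bern_ge0.
have -> : bernstein q L N x - q x = \sum_(f : {ffun 'I_n -> 'I_N.+2})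
    (q (bern_grid L f) - q x) * \prod_j (bern L N.+1 (f j)).[x ord0 j].
  under eq_bigr do rewrite mulrBl; rewrite sumrB -mulr_sumr bern_weight1 mulr1//.
apply: le_trans (ler_norm_sum _ _ _) _.
have pt f : `|q (bern_grid L f) - q x| <= e / 2 +
    c * \sum_j (bern_node L N.+1 ((f : {ffun 'I_n -> 'I_N.+2}) j) - x ord0 j) ^+ 2.
  set S := \sum_j _; have S0 : 0 <= S by apply: sumr_ge0 => j _; exact: sqr_ge0.
  have [xf|xf] := ltP `|x - bern_grid L f| d.
    have := hd x _ (inK x xL) xf; rewrite distrC => /ltW h.
    by rewrite (le_trans h)// lerDl mulr_ge0.
  have [j hj] : exists j, d <= `|x ord0 j - (bern_grid L f : V) ord0 j|.
    apply: contrapT => H; have : `|x - bern_grid L f| < d; last by rewrite ltNge xf.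
    apply/ball_rVP => // j; rewrite ltNge; apply/negP => hj; apply: H.
    by exists j.
  have dS : d ^+ 2 <= S.
    rewrite /S (bigD1 j)//= ler_wpDr//; first by apply: sumr_ge0 => i _; exact: sqr_ge0.
    rewrite mxE distrC in hj; rewrite -[leRHS]real_normK ?num_real//.
    by rewrite lerXn2r// ?nnegrE// ltW.
  apply: (@le_trans _ _ (2 * M)).
    rewrite (le_trans (ler_normB _ _))// mulr2n mulrDl mul1r lerD// HM//; exact: inK.
  have : 2 * M <= c * S.
    by rewrite /c mulrAC ler_pdivlMr ?exprn_gt0// ler_wpM2l// mulr_ge0.
  lra.
apply: (@le_trans _ _ (\sum_(f : {ffun 'I_n -> 'I_N.+2}) (e / 2 +
    c * \sum_j (bern_node L N.+1 (f j) - x ord0 j) ^+ 2) *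
    \prod_j (bern L N.+1 (f j)).[x ord0 j])).
  by apply: ler_sum => f _; rewrite normrM [X in _ * X]ger0_norm// ler_wpM2r.
under eq_bigr do rewrite mulrDl -[c * _ * _]mulrA mulr_suml.
rewrite big_split/= -mulr_sumr bern_weight1 mulr1 -mulr_sumr exchange_big/=.
rewrite [leRHS](splitr e) lerD2l.
apply: (@le_trans _ _ (c * (n%:R * (L ^+ 2 / N.+1%:R)))).
  rewrite ler_wpM2l// mulr_natl -[n in X in _ <= X]card_ord -sumr_const.
  apply: ler_sum => k _; exact: bern_weight_variance.
apply: (@le_trans _ _ (D * N.+1%:R^-1)).
  rewrite !mulrA ler_wpM2r ?invr_ge0// /D; lra.
by rewrite -ler_pdivlMl// mulrC ltW.
Qed.

End weierstrass.

(** * Integrals of real-valued functions and dominated convergence *)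

Section real_integrals.
Context {d} {T : measurableType d} {R : realType}.
Variables (mu : {measure set T -> \bar R}) (D : set T).
Hypothesis mD : measurable D.
Implicit Types (f g a : T -> R).

Local Notation ri f := (mu.-integrable D (EFin \o f)).

Lemma integrable_measurable f : ri f -> measurable_fun D f.
Proof. by move=> /measurable_int/measurable_EFinP. Qed.

Lemma integrable_mul_bounded f a (M : R) : ri f -> measurable_fun D a ->
  (forall x, D x -> `|a x| <= M) -> ri (fun x => f x * a x).
Proof.
move=> rf ma aM.
suff : mu.-integrable D ((EFin \o f) \* (EFin \o a))%E.
  by apply: eq_integrable => // x _ /=; rewrite EFinM.
apply: integrableMl => //; exists M; split; first by rewrite num_real.
by move=> N MN x Dx /=; rewrite (le_trans (aM x Dx))// ltW.
Qed.

Lemma integrableD_R f g : ri f -> ri g -> ri (fun x => f x + g x).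
Proof.
move=> rf rg; suff : mu.-integrable D ((EFin \o f) \+ (EFin \o g))%E by apply: eq_integrable.
exact: integrableD.
Qed.

Lemma integrableZ_R f (c : R) : ri f -> ri (fun x => c * f x).
Proof.
move=> rf; suff : mu.-integrable D (fun x => c%:E * (EFin \o f) x)%E by apply: eq_integrable.
exact: integrableZl.
Qed.

Lemma integrableB_R f g : ri f -> ri g -> ri (fun x => f x - g x).
Proof.
move=> rf rg; suff : mu.-integrable D ((EFin \o f) \- (EFin \o g))%E by apply: eq_integrable.
exact: integrableB.
Qed.

Lemma integrable_norm_R f : ri f -> ri (fun x => `|f x|).
Proof. by move=> /integrable_abse; apply: eq_integrable. Qed.

Lemma integrable_le_R f g : measurable_fun D f -> (forall x, D x -> `|f x| <= g x) ->
  ri g -> ri f.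
Proof.
move=> mf fg rg; apply: (le_integrable _ _ _ rg) => //; first exact/measurable_EFinP.
by move=> x Dx /=; rewrite lee_fin (le_trans (fg x Dx))// ler_norm.
Qed.

Lemma norm_Rintegral_mul_le f a (M : R) : ri f -> measurable_fun D a ->
  (forall x, D x -> `|a x| <= M) ->
  `|\int[mu]_(x in D) (f x * a x)| <= M * \int[mu]_(x in D) `|f x|.
Proof.
move=> rf ma aM; have rfa := integrable_mul_bounded rf ma aM.
apply: le_trans (le_normr_Rintegral mD rfa) _.
rewrite -RintegralZl//; last exact: integrable_norm_R.
apply: le_Rintegral => //; first exact: integrable_norm_R.
  by apply: integrableZ_R; exact: integrable_norm_R.
by move=> x Dx; rewrite normrM mulrC ler_wpM2r// aM.
Qed.

Lemma eq_Rintegral_in f g : (forall x, D x -> f x = g x) ->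
  \int[mu]_(x in D) f x = \int[mu]_(x in D) g x.
Proof. by move=> fg; apply: eq_Rintegral => x; rewrite inE => /fg. Qed.

Lemma Rintegral_sum (I : Type) (s : seq I) (F : I -> T -> R) : (forall i, ri (F i)) ->
  ri (fun x => \sum_(i <- s) F i x) /\
  \int[mu]_(x in D) (\sum_(i <- s) F i x) = \sum_(i <- s) \int[mu]_(x in D) F i x.
Proof.
move=> rF; elim: s => [|i s [IH1 IH2]].
  split; first by under eq_fun do rewrite big_nil; exact: integrable0.
  by under eq_Rintegral do rewrite big_nil; rewrite big_nil Rintegral_cst// mul0r.
split; first by under eq_fun do rewrite big_cons; exact: integrableD_R.
by under eq_Rintegral do rewrite big_cons; rewrite big_cons RintegralD// IH2.
Qed.

Lemma Rintegral_dominated_cvg (f_ : (T -> R)^nat) f g :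
  (forall k, measurable_fun D (f_ k)) -> (forall x, D x -> f_ k x @[k --> \oo] --> f x) ->
  ri g -> (forall k x, D x -> `|f_ k x| <= g x) ->
  \int[mu]_(x in D) f_ k x @[k --> \oo] --> \int[mu]_(x in D) f x.
Proof.
move=> mf_ ff rg fg.
have mf : measurable_fun D f by apply: (measurable_fun_cvg mf_).
have rf : ri f.
  apply: integrable_le_R rg => // x Dx.
  rewrite leNgt; apply/negP => gf.
  have fn : `|f_ k x| @[k --> \oo] --> `|f x|  by apply: cvg_norm; exact: ff.
  have [k _ /(_ k (leqnn k))/=] := cvgr_gt _ fn _ gf.
  by rewrite ltNge fg.
apply: fine_cvg; rewrite fineK; last exact: integrable_fin_num.
apply: (@dominated_cvg _ _ _ mu D mD (fun k => EFin \o f_ k) (EFin \o f) (EFin \o g)) => //.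
  by move=> k; apply/measurable_EFinP.
move=> x Dx; apply: cvg_EFin; first by near=> k.
exact: ff.
Unshelve. all: by end_near.
Qed.

End real_integrals.

Section smooth_approximation.
Context {R : realType} {n : nat}.
Local Notation V := 'rV[R]_n.
Implicit Types (x : V) (g : V -> R).

Lemma smooth_horner (p : {poly R}) : smooth1 (horner p).
Proof.
move=> k; elim: k p => [|k IH] p; first exact: continuous_horner.
by split=> [s|]; [exact: derivable_horner|rewrite -derivE].
Qed.

Lemma line_coord x (s : R) i j :
  (x + s *: delta_mx ord0 i : V) ord0 j = x ord0 j + s *+ (j == i).
Proof. by rewrite !mxE/=; case: eqP => _; rewrite ?mulr1 ?mulr0. Qed.

Definition antideriv (p : {poly R}) : {poly R} :=
  \poly_(k < (size p).+1) (p`_k.-1 / k%:R *+ (0 < k)%N).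

Lemma antiderivK p : (antideriv p)^`() = p.
Proof.
apply/polyP => k; rewrite coef_deriv coef_poly ltnS/= mulr1n.
have [kp|kp] := ltnP k (size p); last by rewrite mul0rn nth_default.
by rewrite -[LHS]mulr_natr ?mulr1n divfK// pnatr_eq0.
Qed.

Lemma is_derive_bigsum (U : normedModType R) (I : Type) (r : seq I) (F : I -> U -> R) (x d : U)
    (dF : I -> R) : (forall i, is_derive x d (F i) (dF i)) ->
  is_derive x d (fun y => \sum_(i <- r) F i y) (\sum_(i <- r) dF i).
Proof.
move=> H; elim: r => [|i r IH].
  by under eq_fun do rewrite big_nil; rewrite big_nil; exact: is_derive_cst.
by under eq_fun do rewrite big_cons; rewrite big_cons; exact: is_deriveD.
Qed.

(* A Bernstein polynomial of [pderiv i g] is integrated in the variable [x_i]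
   from the face [x_i = -L], where [g] vanishes. *)
Lemma smooth_approx g (i : 'I_n) (L e : R) : 0 < L -> 0 < e ->
  (forall x, pderivable i g x) -> continuous (pderiv i g) ->
  (forall x, ~ box 0 L x -> g x = 0) ->
  exists2 Phi : V -> R, smooth Phi & forall x, (forall j, `|x ord0 j| <= L) ->
    `|Phi x - g x| <= 2 * L * e /\ `|pderiv i Phi x - pderiv i g x| <= e.
Proof.
move=> L0 e0 dg cg g0; set q := pderiv i g.
have [N HN] := bernstein_approx L0 cg e0.
pose B (f : {ffun 'I_n -> 'I_N.+2}) j : {poly R} :=
  if j == i then antideriv (bern L N.+1 (f j)) - (antideriv (bern L N.+1 (f j))).[- L]%:P
  else bern L N.+1 (f j).
pose Phi x := \sum_(f : {ffun 'I_n -> 'I_N.+2})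
  q (bern_grid L f) * \prod_j (B f j).[x ord0 j].
have sPhi : smooth Phi.
  apply: smooth_sum => f; apply: smoothM; first exact: smooth_cst.
  apply: smooth_prod => j; apply: (smooth_comp (smooth_horner _)); exact: smooth_coord.
have dPhi x : is_derive x (delta_mx ord0 i) Phi (bernstein q L N x).
  apply: is_derive_bigsum => f; rewrite (bigD1 i)//=.
  set K := \prod_(j < n | j != i) _.
  pose h (y : V) := \prod_(j < n | j != i) (B f j).[y ord0 j].
  have hE s : h (x + s *: delta_mx ord0 i) = K.
    by apply: eq_bigr => j ji; rewrite line_coord (negbTE ji) mulr0n addr0 /B (negbTE ji).
  apply/is_derive_line0.
  have -> : (fun s : R => q (bern_grid L f) * \prod_j (B f j).[(x + s *: delta_mx ord0 i : V) ord0 j]) =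
     (fun s : R => (q (bern_grid L f) * K) * (B f i).[x ord0 i + s]).
    apply/funext => s; rewrite (bigD1 i)//= -/(h _) hE line_coord eqxx mulr1n.
    by rewrite mulrA mulrAC.
  have D : is_derive (0 : R) 1 (fun s => (B f i).[x ord0 i + s]) (bern L N.+1 (f i)).[x ord0 i].
    rewrite -[X in is_derive _ _ _ X]mulr1.
    apply: (@is_derive1_comp _ (horner (B f i)) (fun s => x ord0 i + s)).
      rewrite addr0; have := is_derive_poly (B f i) (x ord0 i).
      by rewrite /B eqxx derivB derivC subr0 antiderivK.
    rewrite -[X in is_derive _ _ _ X]add0r.
    exact: (is_deriveD (is_derive_cst _ _ _) (is_derive_id _ _)).
  apply: (is_derive_eq (is_deriveZ (q (bern_grid L f) * K) D)).
  by rewrite /GRing.scale/= -mulrA [K * _]mulrC.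
exists Phi => // x xL.
have pE y : pderiv i Phi y = bernstein q L N y by apply: pderivE.
split; last by rewrite pE HN.
(* The projection of [x] to the face [x_i = -L], where [Phi] and [g] both vanish. The mean value
   theorem along the [i]-th axis turns the derivative error [e] into a value error over a length of
   at most [2 L]. *)
pose y : V := x + (- (x ord0 i + L)) *: delta_mx ord0 i.
have yi : y ord0 i = - L by rewrite line_coord eqxx mulr1n; ring.
have yj t j : j != i -> (y + t *: delta_mx ord0 i : V) ord0 j = x ord0 j.
  by move=> ji; rewrite !line_coord (negbTE ji) !mulr0n !addr0.
have Phiy : Phi y = 0.
  apply: big1 => f _; rewrite (bigD1 i)//= yi /B eqxx hornerD hornerN hornerC subrr.
  by rewrite mul0r mulr0.
have gy : g y = 0.
  by apply: g0 => /(_ i); rewrite yi mxE subr0 normrN gtr0_norm// ltxx.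
have xE : x = y + (x ord0 i + L) *: delta_mx ord0 i.
  by rewrite /y scaleNr subrK.
have [h0 h1] : 0 <= x ord0 i + L /\ x ord0 i + L <= 2 * L.
  by have := xL i; rewrite ler_norml => /andP[]; lra.
move: h0; rewrite le_eqVlt => /predU1P[h0|h0].
  have -> : x = y by rewrite xE -h0 scale0r addr0.
  by rewrite Phiy gy subrr normr0 !mulr_ge0// ltW.
pose D z := Phi z - g z; pose dD z := pderiv i Phi z - q z.
have DD z : is_derive z (delta_mx ord0 i) D (dD z).
  by apply: is_deriveB; [rewrite pE|exact: pderivableP].
have DDl (t : R) : 0 < t < x ord0 i + L ->
  is_derive (y + t *: delta_mx ord0 i) (delta_mx ord0 i) D (dD (y + t *: delta_mx ord0 i)).
  by move=> _; exact: DD.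
have cD : {within `[0, x ord0 i + L], continuous (fun t : R => D (y + t *: delta_mx ord0 i))}.
  apply: derivable_within_continuous => t _.
  by have [] := is_derive_line (DD (y + t *: delta_mx ord0 i)).
have [c /andP[c0 c1]] := MVT_line h0 DDl cD.
rewrite -xE {1 2}/D Phiy gy subrr subr0 => ->; rewrite /dD.
rewrite normrM mulrC (gtr0_norm h0) pE; apply: ler_pM => //; first exact: ltW.
apply: HN => j; have [->|ji] := eqVneq j i; last by rewrite yj.
by rewrite line_coord eqxx mulr1n yi ler_norml; lra.
Qed.

End smooth_approximation.

(** * Green's formula for weakly differentiable functions *)

Section vanishing_at_the_boundary.
Context {R : realType} {n : nat}.
Local Notation V := 'rV[R]_n.
Implicit Types (x y z d : V) (g rho : V -> R) (Omega : set V).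

(** The infimum of the exit times is itself an exit time because [A] is open and [p] continuous, and
    it is positive because [p 0] lies in [A]. *)
Lemma exit_time (A : set V) (p : R -> V) (b : R) : open A -> continuous p ->
  A (p 0) -> 0 <= b -> ~ A (p b) ->
  exists s : R, [/\ 0 < s <= b, forall t, 0 <= t < s -> A (p t) & ~ A (p s)].
Proof.
move=> oA cp A0 b0 nb; pose S := [set s : R | 0 <= s /\ ~ A (p s)].
have hS : has_inf S by split; [exists b|exists 0 => s [] ].
have Sb : inf S <= b by apply: ge_inf => //; exact: hS.2.
have S0 : 0 <= inf S by apply: lb_le_inf; [exact: hS.1|move=> s []].
have nS : ~ A (p (inf S)).
  move=> AS; have /nbhs_ballP[r/= r0 hr] := cp _ _ (near_open oA AS).
  have [s [s0 nAs] sr] := inf_adherent r0 hS.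
  apply: (nAs); apply: hr; rewrite /ball/= distrC ger0_norm; first by rewrite ltrBlDl.
  by rewrite subr_ge0; apply: ge_inf; [exact: hS.2|split].
exists (inf S); split => //.
  rewrite Sb andbT lt_neqAle S0 andbT; apply/eqP => E; exact: nS (eq_ind _ (fun t => A (p t)) A0 _ E).
move=> t /andP[t0 tS]; apply: contrapT => nt; move: tS; rewrite ltNge => /negP; apply.
by apply: ge_inf; [exact: hS.2|].
Qed.

Lemma within_cvg_ball (f : V -> R) Omega z (e : R) : f @ within Omega (nbhs z) --> (0 : R) ->
  0 < e -> exists2 r : R, 0 < r & forall y, Omega y -> `|z - y| < r -> `|f y| < e.
Proof.
move=> fz e0; have /cvgr0Pnorm_lt/(_ _ e0) := fz.
move=> /nbhs_ballP[r/= r0 hr]; exists r => // y Oy zy; apply: hr => //.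
by rewrite mx_norm_ball.
Qed.

Lemma coordinate_lipschitz Omega g (M : R) i (sg : R) x (b : R) : `|sg| = 1 ->
  (forall y, Omega y -> pderivable i g y) -> (forall y, Omega y -> `|pderiv i g y| <= M) ->
  0 <= b -> (forall t, 0 <= t <= b -> Omega (x + t *: (sg *: delta_mx ord0 i))) ->
  `|g (x + b *: (sg *: delta_mx ord0 i)) - g x| <= M * b.
Proof.
move=> sg1 dg gM; rewrite le_eqVlt => /predU1P[<-|b0] inO.
  by rewrite scale0r addr0 subrr normr0 mulr0.
have dl t : 0 <= t <= b ->
    is_derive (x + t *: (sg *: delta_mx ord0 i)) (sg *: delta_mx ord0 i) g
      (sg * pderiv i g (x + t *: (sg *: delta_mx ord0 i))).
  by move=> tb; apply: is_derive_dirZ; apply: pderivableP; apply: dg; exact: inO.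
have [c /andP[c0 cb] ->] : exists2 c : R, 0 < c < b &
    g (x + b *: (sg *: delta_mx ord0 i)) - g x =
    (sg * pderiv i g (x + c *: (sg *: delta_mx ord0 i))) * b.
  apply: (@MVT_line _ _ g (fun t => sg * pderiv i g (x + t *: (sg *: delta_mx ord0 i)))) => //.
    by move=> t /andP[t0 tb]; apply: dl; rewrite !ltW.
  apply: derivable_within_continuous => t; rewrite in_itv/= => tb.
  by have [] := is_derive_line (dl t tb).
rewrite !normrM sg1 mul1r (gtr0_norm b0) ler_wpM2r ?(ltW b0)//.
by apply: gM; apply: inO; rewrite !ltW.
Qed.

(* A function with bounded partial derivatives that vanishes on the boundary is
   dominated by the defining function: from a point close to the boundary, one
   leaves [Omega] along a coordinate axis within a time of order [rho]. *)
Lemma vanishing_bound Omega g rho (M : R) : open Omega -> bounded_set Omega -> smooth rho ->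
  (forall x, Omega x -> 0 < rho x) -> (forall x, bdry Omega x -> rho x = 0) ->
  (forall x, ~ Omega x -> rho x <= 0) ->
  (forall x, bdry Omega x -> exists i, pderiv i rho x != 0) ->
  (forall i x, Omega x -> pderivable i g x) -> (forall i x, Omega x -> `|pderiv i g x| <= M) ->
  (forall x, Omega x -> {for x, continuous g}) ->
  (forall x, bdry Omega x -> g @ within Omega (nbhs x) --> (0 : R)) ->
  exists2 C : R, 0 <= C & forall x, Omega x -> `|g x| <= C * rho x.
Proof.
move=> oO bO srho rpos r0 rneg rgrad dg gM cg g0.
have cc := closure_bounded_compact bO.
move/compact_near_coveringP : cc => cov.
pose P (C : R) x := Omega x -> `|g x| <= C * rho x.
have crho := smooth_continuous srho.
(* A bound with constant [C] persists for larger constants, since [rho > 0] on [Omega]; this lets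
   compactness merge the local constants into one. *)
suff H : \forall C \near +oo, closure Omega `<=` P C.
  have [C [C0 HC]] : exists C : R, 0 <= C /\ closure Omega `<=` P C.
    have H2 : \forall C \near +oo, 0 <= C /\ closure Omega `<=` P C.
      by apply: filterI; [exact: nbhs_pinfty_ge|exact: H].
    exact: filter_ex H2.
  by exists C => // x Ox; apply: HC => //; exact: subset_closure.
suff local x0 : closure Omega x0 -> exists r C : R, 0 < r /\
    forall x, `|x0 - x| < r -> Omega x -> `|g x| <= C * rho x.
  apply: cov => x0 /local[r [C [rpos' Hr]]].
  exists (ball x0 r, [set C' | C <= C']) => /=.
    by split; [exact: nbhsx_ballx|apply: nbhs_pinfty_ge; rewrite num_real].
  move=> [x C'] /= []; rewrite mx_norm_ball /ball_/= => xr CC' Ox.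
  by rewrite (le_trans (Hr x xr Ox))// ler_wpM2r// ltW// rpos.
move=> cx0; have [Ox0|nOx0] := pselect (Omega x0).
  have rx := rpos _ Ox0; have rx2 : rho x0 / 2 < rho x0 by lra.
  have cgn : {for x0, continuous (fun y => `|g y|)}.
    by apply: for_cont_comp; [exact: cg|exact: norm_continuous].
  have gx1 : `|g x0| < `|g x0| + 1 by rewrite ltrDl.
  have := near_and (near_gt (crho x0) rx2) (near_lt cgn gx1).
  move=> /nbhs_ballP[r/= rr hr]; exists r, ((`|g x0| + 1) / (rho x0 / 2)); split => // x xr Ox.
  have [h1 h2] : rho x0 / 2 < rho x /\ `|g x| < `|g x0| + 1.
    by apply: hr; rewrite mx_norm_ball.
  rewrite (le_trans (ltW h2))// mulrAC ler_pdivlMr ?divr_gt0//.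
  by apply: ler_wpM2l; [exact: addr_ge0|exact: ltW].
have bx0 : bdry Omega x0 by [].
have [i ri] := rgrad _ bx0.
pose c := `|pderiv i rho x0| / 2; have c0 : 0 < c by rewrite divr_gt0// normr_gt0.
(* The orientation of the [i]-th axis along which [rho] decreases, at a rate above [c] near [x0]. *)
pose sg := - Num.sg (pderiv i rho x0).
have sg1 : `|sg| = 1 by rewrite /sg normrN normr_sg ri.
have crhoi : {for x0, continuous (fun y => sg * pderiv i rho y)}.
  by apply: for_contM; [exact: cst_continuous|apply: smooth_continuous; exact: smooth_pderiv].
have sgc : sg * pderiv i rho x0 < - c.
  rewrite /sg mulNr -normrEsg /c.
  by have := normr_gt0 (pderiv i rho x0); rewrite ri => h; lra.
have /nbhs_ballP[r/= rr hr] := near_lt crhoi sgc.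
have {}hr y : `|x0 - y| < r -> sg * pderiv i rho y < - c.
  by move=> xy; apply: hr; rewrite mx_norm_ball.
have rx0 : rho x0 < c * (r / 2) by rewrite r0// mulr_gt0// divr_gt0.
have /nbhs_ballP[r1/= rr1 hr1] := near_lt (crho x0) rx0.
have {}hr1 y : `|x0 - y| < r1 -> rho y < c * (r / 2).
  by move=> xy; apply: hr1; rewrite mx_norm_ball.
exists (Num.min r1 (r / 2)), (M / c); split; first by rewrite lt_min rr1 divr_gt0.
move=> x; rewrite lt_min => /andP[xr1 xr2] Ox.
pose d : V := sg *: delta_mx ord0 i.
(* Decreasing at a rate above [c], [rho] is negative by time [b], so the line has left [Omega] by
   then. For [x] close to [x0] the time [b] is below [r / 2], which keeps the path in the ball where
   that rate holds. *)
pose b := rho x / c; have b0 : 0 < b by rewrite divr_gt0// rpos.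
have br : b < r / 2 by rewrite /b ltr_pdivrMr// mulrC hr1.
have dn : `|d| <= 1.
  rewrite /d normrZ sg1 mul1r.
  have : `|(0 : V) - - delta_mx ord0 i| <= 1; last by rewrite sub0r opprK.
  apply/ler_addgt0Pr => e e0; apply: ltW; apply/ball_rVP; first by rewrite ltr_wpDl.
  move=> j; rewrite !mxE/= sub0r opprK; case: (j == i).
    by rewrite normr1 ltrDl.
  by rewrite normr0 ltr_wpDl.
have inB t : 0 <= t <= b -> `|x0 - (x + t *: d)| < r.
  move=> /andP[t0 tb]; rewrite opprD addrA (le_lt_trans (ler_normB _ _))//.
  rewrite normrZ (ger0_norm t0).
  have : t * `|d| <= t by rewrite ler_piMr.
  lra.
have neg : ~ Omega (x + b *: d).
  have [e /andP[e0 eb] E] : exists2 e : R, 0 < e < b & rho (x + b *: d) - rho x =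
      (sg * pderiv i rho (x + e *: d)) * b.
    apply: (@MVT_line _ _ rho (fun t => sg * pderiv i rho (x + t *: d))) => //.
      move=> t _; apply: is_derive_dirZ; apply: pderivableP; exact: smooth_pderivable.
    apply: continuous_subspaceT => t; apply: continuous_comp; first exact: continuous_line.
    exact: crho.
  move=> /rpos; rewrite -[rho (x + b *: d)](subrK (rho x)) E.
  have H : sg * pderiv i rho (x + e *: d) < - c by apply: hr; apply: inB; rewrite !ltW.
  have : sg * pderiv i rho (x + e *: d) * b < - c * b by rewrite ltr_pM2r.
  have -> : - c * b = - rho x by rewrite /b mulNr mulrC divfK// gt_eqF.
  lra.
have Ox' : Omega (x + 0 *: d) by rewrite scale0r addr0.
have [s [/andP[s0 sb] ins nos]] := exit_time oO (@continuous_line _ _ x d) Ox' (ltW b0) neg.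
have bz : bdry Omega (x + s *: d).
  split => //; move=> U /nbhs_ballP[e/= e0 he].
  pose t := Num.max 0 (s - e / 2).
  have ts : t < s by rewrite /t gt_max s0; lra.
  have t0 : 0 <= t by rewrite le_max lexx.
  exists (x + t *: d); split; first by apply: ins; rewrite t0.
  apply: he; rewrite mx_norm_ball /ball_/= opprD addrACA subrr add0r -scalerBl normrZ.
  rewrite gtr0_norm ?subr_gt0//.
  have se : s - t <= e / 2 by rewrite lerBlDr -lerBlDl le_max lexx orbT.
  have : (s - t) * `|d| <= s - t by rewrite ler_piMr// subr_ge0 ltW.
  lra.
(* At the exit point [g] is known only through its limit from inside, so times [t] slightly before
   [s] are used. *)
have Ms : `|g x| <= M * s.
  apply/ler_addgt0Pr => e e0.
  have [q q0 hq] := within_cvg_ball (g0 _ bz) e0.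
  pose t := Num.max 0 (s - q / 2).
  have ts : t < s by rewrite /t gt_max s0; lra.
  have t0 : 0 <= t by rewrite le_max lexx.
  have gt : `|g (x + t *: d)| < e.
    apply: hq; first by apply: ins; rewrite t0.
    rewrite opprD addrACA subrr add0r -scalerBl normrZ gtr0_norm ?subr_gt0//.
    have se : s - t <= q / 2 by rewrite lerBlDr -lerBlDl le_max lexx orbT.
    have : (s - t) * `|d| <= s - t by rewrite ler_piMr// subr_ge0 ltW.
    lra.
  have Mt : `|g (x + t *: d) - g x| <= M * t.
    apply: (coordinate_lipschitz sg1 (dg i) (gM i) t0) => t' /andP[h1 h2].
    by apply: ins; rewrite h1 (le_lt_trans h2).
  have M0 : 0 <= M by exact: le_trans (normr_ge0 _) (gM i _ Ox).
  have : M * t <= M * s by rewrite ler_wpM2l// ltW.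
  have : `|g x| <= `|g (x + t *: d)| + `|g (x + t *: d) - g x|.
    by rewrite -[X in `|X| <= _](subKr (g (x + t *: d))) (ler_normB _ _).
  lra.
have M0 : 0 <= M by exact: le_trans (normr_ge0 _) (gM i _ Ox).
rewrite (le_trans Ms)// mulrAC -mulrA ler_wpM2l//.
Qed.

End vanishing_at_the_boundary.

(** * Testing a weak gradient against C^1 functions *)

Section weak_gradient_extension.
Context {R : realType} {n : nat}.
Local Notation V := 'rV[R]_n.
Local Notation leb := (@lebesgue_rv R n).
Implicit Types (x : V) (f G g theta : V -> R).

Lemma test_function_mul Omega theta g : test_function Omega theta -> smooth g ->
  test_function Omega (fun x => theta x * g x).
Proof.
move=> [sth cth th] sg.
have sub : closure [set x | theta x * g x != 0] `<=` closure [set x | theta x != 0].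
  by apply: closureS => x /=; rewrite mulf_eq0 negb_or => /andP[].
split; first exact: smoothM.
- by apply: (subclosed_compact (@closed_closure _ _) cth).
- exact: subset_trans sub th.
Qed.

Variable Omega : set V.
Hypotheses (oO : open Omega) (bO : bounded_set Omega).

Lemma measurable_domain : measurable Omega. Proof. exact: open_measurable_rV. Qed.

Lemma finite_domain : (leb Omega < +oo)%E.
Proof. exact: bounded_finite_measure measurable_domain bO. Qed.

Lemma continuous_measurable_domain f : (forall x, Omega x -> {for x, continuous f}) ->
  measurable_fun Omega f.
Proof. exact: cont_measurable_fun. Qed.

Lemma continuous_bounded_domain f : continuous f ->
  exists2 M : R, 0 <= M & forall x, Omega x -> `|f x| <= M.
Proof.
move=> cf; have [M M0 HM] :=
  compact_bounded_above (closure_bounded_compact bO) (continuous_subspaceT cf).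
by exists M => // x Ox; apply: HM; exact: subset_closure.
Qed.

Lemma continuous_fD f g : continuous f -> continuous g -> continuous (fun x => f x + g x).
Proof. by move=> cf cg x; exact: (for_contD (cf x) (cg x)). Qed.

Lemma continuous_fM f g : continuous f -> continuous g -> continuous (fun x => f x * g x).
Proof. by move=> cf cg x; exact: (for_contM (cf x) (cg x)). Qed.

Lemma continuous_fB f g : continuous f -> continuous g -> continuous (fun x => f x - g x).
Proof.
move=> cf cg x; apply: (for_contD (cf x)).
by apply: (for_cont_comp (cg x)); exact: opp_continuous.
Qed.

(** The factor [g] is replaced by the smooth [Phi] of [smooth_approx], close to [g] in value and in
    the [i]-th derivative. The factor [theta] keeps the support inside [Omega], since [Phi] need not
    be compactly supported there. The error is linear in the L1 norms of [f] and [G]. *)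
Lemma weak_gradient_ext f G theta g (i : 'I_n) (L : R) :
  leb.-integrable Omega (EFin \o f) -> leb.-integrable Omega (EFin \o G) ->
  (forall phi, test_function Omega phi ->
     \int[leb]_(x in Omega) (f x * pderiv i phi x) = - \int[leb]_(x in Omega) (G x * phi x)) ->
  test_function Omega theta -> 0 < L -> Omega `<=` box 0 L ->
  continuous g -> (forall x, pderivable i g x) -> continuous (pderiv i g) ->
  (forall x, ~ box 0 L x -> g x = 0) ->
  \int[leb]_(x in Omega) (f x * (pderiv i theta x * g x + theta x * pderiv i g x)) =
  - \int[leb]_(x in Omega) (G x * (theta x * g x)).
Proof.
move=> rf rG weak tth L0 OL cg dg cdg g0; have [sth _ _] := tth.
have mO := measurable_domain.
have cth := smooth_continuous sth; have cdth := smooth_continuous (smooth_pderiv i sth).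
have [T0 T00 HT0] := continuous_bounded_domain cth.
have [T1 T10 HT1] := continuous_bounded_domain cdth.
have cts_m (h : V -> R) : continuous h -> measurable_fun Omega h.
  by move=> ch; apply: continuous_measurable_domain => x _; exact: ch.
pose psi' x := pderiv i theta x * g x + theta x * pderiv i g x.
have cpsi' : continuous psi'.
  by apply: continuous_fD; exact: continuous_fM.
have cpsi : continuous (fun x => theta x * g x).
  exact: continuous_fM.
have int_ct (h k : V -> R) : leb.-integrable Omega (EFin \o h) -> continuous k ->
    leb.-integrable Omega (EFin \o (fun x => h x * k x)).
  move=> rh ck; have [M _ HM] := continuous_bounded_domain ck.
  exact: (integrable_mul_bounded mO rh (cts_m _ ck) HM).
set I1 := \int[leb]_(x in Omega) (f x * _); set I2 := \int[leb]_(x in Omega) (G x * _).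
pose If := \int[leb]_(x in Omega) `|f x|; pose IG := \int[leb]_(x in Omega) `|G x|.
(* [2 L e] bounds the error on [g] and [e] the error on its derivative, while [T0] and [T1] bound
   [theta] and its derivative. *)
pose C := (T1 * (2 * L) + T0) * If + T0 * (2 * L) * IG.
have If0 : 0 <= If by apply: Rintegral_ge0.
have IG0 : 0 <= IG by apply: Rintegral_ge0.
suff H e : 0 < e -> `|I1 + I2| <= e * C.
  have L2 : 0 <= 2 * L by rewrite mulr_ge0// ltW.
  have C0 : 0 <= C.
    apply: addr_ge0; apply: mulr_ge0 => //; last exact: mulr_ge0.
    by apply: addr_ge0 => //; exact: mulr_ge0.
  apply/eqP; rewrite -addr_eq0 -normr_le0; apply/ler_addgt0Pr => e e0; rewrite add0r.
  have C1 : 0 < C + 1 by rewrite ltr_wpDl.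
  have := H (e / (C + 1)) (ltac:(by rewrite divr_gt0)) => /le_trans; apply.
  by rewrite mulrAC ler_pdivrMr// ler_pM2l// lerDl.
move=> e0; have [Phi sPhi HPhi] := smooth_approx L0 e0 dg cdg g0.
have tphi := test_function_mul tth sPhi.
have cPhi := smooth_continuous sPhi; have cdPhi := smooth_continuous (smooth_pderiv i sPhi).
have OLe x : Omega x -> forall j, `|x ord0 j| <= L.
  by move=> /OL H j; have := H j; rewrite mxE subr0 => /ltW.
pose phi' x := pderiv i theta x * Phi x + theta x * pderiv i Phi x.
have phi'E x : pderiv i (fun x => theta x * Phi x) x = phi' x.
  by rewrite pderivM//; exact: smooth_pderivable.
have cphi' : continuous phi'.
  by apply: continuous_fD; exact: continuous_fM.
have cphi : continuous (fun x => theta x * Phi x).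
  exact: continuous_fM.
have := weak _ tphi; set J1 := \int[leb]_(x in Omega) _; set J2 := \int[leb]_(x in Omega) _.
have J1E : J1 = \int[leb]_(x in Omega) (f x * phi' x).
  by apply: eq_Rintegral_in => x _; rewrite phi'E.
have d1 : I1 - J1 = \int[leb]_(x in Omega) (f x * (psi' x - phi' x)).
  rewrite J1E -RintegralB//; [|exact: int_ct|exact: int_ct].
  by apply: eq_Rintegral_in => x _; rewrite mulrBr.
have d2 : I2 - J2 = \int[leb]_(x in Omega) (G x * (theta x * g x - theta x * Phi x)).
  rewrite -RintegralB//; [|exact: int_ct|exact: int_ct].
  by apply: eq_Rintegral_in => x _; rewrite mulrBr.
have b1 : `|I1 - J1| <= (e * (T1 * (2 * L) + T0)) * If.
  rewrite d1; apply: norm_Rintegral_mul_le => //; first by apply: cts_m; exact: continuous_fB.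
  move=> x Ox; have [h1 h2] := HPhi x (OLe x Ox).
  have -> : psi' x - phi' x = pderiv i theta x * (g x - Phi x) + theta x * (pderiv i g x - pderiv i Phi x).
    by rewrite /psi' /phi'; ring.
  rewrite (le_trans (ler_normD _ _))// !normrM mulrDr lerD//.
    rewrite mulrCA; apply: ler_pM => //; first exact: HT1.
    by rewrite distrC mulrC.
  by rewrite mulrC; apply: ler_pM => //; [rewrite distrC|exact: HT0].
have b2 : `|I2 - J2| <= (T0 * (2 * L * e)) * IG.
  rewrite d2; apply: norm_Rintegral_mul_le => //; first by apply: cts_m; exact: continuous_fB.
  move=> x Ox; have [h1 h2] := HPhi x (OLe x Ox).
  by rewrite -mulrBr normrM; apply: ler_pM => //; [exact: HT0|rewrite distrC].
move=> JJ; have -> : I1 + I2 = (I1 - J1) + (I2 - J2) by rewrite JJ; ring.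
rewrite (le_trans (ler_normD _ _))// (le_trans (lerD b1 b2))// /C.
rewrite le_eqVlt; apply/orP; left; apply/eqP; ring.
Qed.

End weak_gradient_extension.

(** * Pointwise limits of the cutoff and of the factors in its derivative *)

Section cutoff_limits.
Context {R : realType}.

Lemma flat_le_fact j (s : R) : flat j s <= j`!%:R.
Proof.
have [s0|s0] := ltP 0 s; last by rewrite flat_le0.
have y0 : 0 <= s^-1 by rewrite invr_ge0 ltW.
rewrite /flat s0 expRN ler_pdivrMr ?expR_gt0// -exprVn.
have f0 : 0 < j`!%:R :> R by rewrite ltr0n fact_gt0.
rewrite -ler_pdivrMl// mulrC; case: j f0 => [|j] f0.
  by rewrite expr0 fact0 invr1 mulr1 (le_trans _ (expR_ge1Dx _))// lerDl.
by rewrite (le_trans _ (expR_ge1Dxn j y0))// lerDr.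
Qed.

Lemma flat_le_inv j (s : R) : 1 <= s -> flat j.+1 s <= s^-1.
Proof.
move=> s1; have s0 : 0 < s by exact: lt_le_trans s1.
rewrite /flat s0 exprS invfM -mulrA ler_piMr ?invr_ge0 ?(ltW s0)//.
apply: mulr_ile1; rewrite ?expR_ge0 ?invr_ge0 ?exprn_ge0 ?(ltW s0)//.
  by rewrite invf_le1 ?exprn_gt0// exprn_ege1.
by rewrite expR_le1 oppr_le0 invr_ge0 ltW.
Qed.

Lemma cvg_scaled_inv (r : R) : 0 < r -> (k.+1%:R * r - 1)^-1 @[k --> \oo] --> (0 : R).
Proof.
move=> r0; apply/cvgr0Pnorm_lt => e e0.
have d0 : 0 < r / (e^-1 + 1) by rewrite divr_gt0// addr_gt0// invr_gt0.
have ei : 0 < e^-1 by rewrite invr_gt0.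
have [N _ HN] := near_infty_natSinv_lt (PosNum d0).
exists N => // k /= Nk; have := HN k Nk => /=.
rewrite invf_plt ?qualifE//= ?ltr0n// invf_div => h.
have {}h : e^-1 < k.+1%:R * r - 1.
  by move: h; rewrite ltr_pdivrMr// ltrBrDr.
by rewrite gtr0_norm ?invr_gt0 ?(lt_trans ei)// invf_plt// qualifE/= ?(lt_trans ei).
Qed.

Lemma near_ge1 (r : R) : 0 < r -> \forall k \near \oo, 1 <= k.+1%:R * r - 1 :> R.
Proof.
move=> r0; have d0 : 0 < r / 2 by rewrite divr_gt0.
have [N _ HN] := near_infty_natSinv_lt (PosNum d0).
exists N => // k /= Nk; have := HN k Nk => /=.
by rewrite invf_plt ?qualifE//= ?ltr0n// invf_div ltr_pdivrMr// lerBrDr => /ltW.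
Qed.

(** In Green's formula the derivative of the cutoff, once its factor [k+1] is absorbed by [rho],
    leaves only [flat 1] and [flat 2] at [(k+1) rho - 1]; these die out in the limit. *)
Lemma cvg_flatS j (r : R) : 0 < r -> flat j.+1 (k.+1%:R * r - 1) @[k --> \oo] --> (0 : R).
Proof.
move=> r0; apply: (@squeeze_cvgr _ _ _ _ (fun=> 0) (fun k => (k.+1%:R * r - 1)^-1)).
- near=> k; rewrite flat_ge0 /= flat_le_inv//; near: k; exact: near_ge1.
- exact: cvg_cst.
- exact: cvg_scaled_inv.
Unshelve. all: by end_near.
Qed.

Lemma cvg_flat1 (r : R) : 0 < r -> flat 0 (k.+1%:R * r - 1) @[k --> \oo] --> (1 : R).
Proof.
move=> r0; apply: (@squeeze_cvgr _ _ _ _ (fun k => 1 - (k.+1%:R * r - 1)^-1) (fun=> 1)).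
- near=> k; apply/andP; split; last by have := flat_le_fact 0 (k.+1%:R * r - 1).
  have s1 : 1 <= k.+1%:R * r - 1 by near: k; exact: near_ge1.
  by rewrite /flat (lt_le_trans _ s1)// expr0 invr1 mul1r expR_ge1Dx.
- rewrite -[X in _ --> X]subr0; apply: cvgB; first exact: cvg_cst.
  exact: cvg_scaled_inv.
- exact: cvg_cst.
Unshelve. all: by end_near.
Qed.

End cutoff_limits.

(** * Behaviour of the gradient at the boundary *)

Section green_formula.
Context {R : realType} {n : nat}.
Local Notation V := 'rV[R]_n.
Implicit Types (x : V) (f g w rho : V -> R).

(** The regularity that a function of class [C21] has at each fixed time. *)
Definition C2_closure (Omega : set V) w : Prop :=
  [/\ {within closure Omega, continuous w},
      forall i x, Omega x -> pderivable i w x,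
      forall i, extends_continuously Omega (closure Omega) (pderiv i w),
      forall i j x, Omega x -> pderivable j (pderiv i w) x &
      forall i j, extends_continuously Omega (closure Omega) (pderiv j (pderiv i w))].

Lemma near_eq_for_cont (T : topologicalType) (f g : T -> R) (x : T) : (\forall y \near x, f y = g y) ->
  {for x, continuous f} -> {for x, continuous g}.
Proof.
move=> fg fc P; have <- := nbhs_singleton fg => /fc fP.
have {}fP : nbhs x [set y | P (f y)] := fP.
suff : nbhs x [set y | P (g y)] by [].
by apply: filterS2 fg fP => y /= <-.
Qed.

Lemma near_forall (T : topologicalType) (I : finType) (P : I -> T -> Prop) (x : T) :
  (forall i, \forall y \near x, P i y) -> \forall y \near x, forall i, P i y.
Proof. by move=> H; apply: filter_forall. Qed.

Lemma for_cont_bigsum (T : topologicalType) (I : Type) (r : seq I) (F : I -> T -> R) (x : T) :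
  (forall i, {for x, continuous (F i)}) -> {for x, continuous (fun y => \sum_(i <- r) F i y)}.
Proof.
move=> cF; elim: r => [|i r IH].
  apply: (@near_eq_for_cont _ (fun=> 0)); last exact: cst_continuous.
  by apply: near_all => y; rewrite big_nil.
apply: (@near_eq_for_cont _ (fun y => F i y + \sum_(j <- r) F j y)); last exact: for_contD.
by apply: near_all => y; rewrite big_cons.
Qed.

Variable Omega : set V.
Hypothesis sO : smooth_bounded_domain Omega.

Let oO : open Omega. Proof. by have [] := sO. Qed.
Let bO : bounded_set Omega. Proof. by have [] := sO. Qed.
Let Oinc x : Omega x -> closure Omega x. Proof. exact: subset_closure. Qed.

Lemma ext_for_cont f x : extends_continuously Omega (closure Omega) f -> Omega x ->
  {for x, continuous f}.
Proof.
move=> [k /subspace_continuousP kc fk] Ox; apply: (@near_eq_for_cont _ k).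
  by apply: filterS (near_open oO Ox) => y Oy; rewrite fk.
move=> P /(kc x (Oinc Ox)) kP.
have {}kP : nbhs x [set y | closure Omega y -> P (k y)] := kP.
suff : nbhs x [set y | P (k y)] by [].
by apply: filterS2 kP (near_open oO Ox) => y h /Oinc.
Qed.

Lemma ext_bounded f : extends_continuously Omega (closure Omega) f ->
  exists2 M : R, 0 <= M & forall x, Omega x -> `|f x| <= M.
Proof.
move=> [k kc fk]; have [M M0 HM] := compact_bounded_above (closure_bounded_compact bO) kc.
by exists M => // x Ox; rewrite fk// HM//; exact: Oinc.
Qed.

Lemma ext_uniform_bound (I : finType) (F : I -> V -> R) :
  (forall i, extends_continuously Omega (closure Omega) (F i)) ->
  exists2 M : R, 0 <= M & forall i x, Omega x -> `|F i x| <= M.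
Proof.
move=> eF; have /choice[M HM] : forall i, exists M : R, 0 <= M /\ forall x, Omega x -> `|F i x| <= M.
  by move=> i; have [M M0 HM] := ext_bounded (eF i); exists M.
exists (\sum_i M i); first by apply: sumr_ge0 => i _; exact: (HM i).1.
move=> i x Ox; rewrite (le_trans ((HM i).2 x Ox))// (bigD1 i)//= lerDl.
by apply: sumr_ge0 => j _; exact: (HM j).1.
Qed.

(** On the boundary [grad rho] is a multiple of the normal, so the Neumann condition makes the
    product tend to 0 there; its partial derivatives are bounded by the C2 regularity, and
    [vanishing_bound] applies. *)
Lemma grad_dot_bound w rho : C2_closure Omega w -> neumann Omega w -> smooth rho ->
  (forall x, Omega x -> 0 < rho x) -> (forall x, bdry Omega x -> rho x = 0) ->
  (forall x, ~ Omega x -> rho x <= 0) ->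
  (forall x nu, bdry Omega x -> outward_normal Omega x nu ->
     exists2 a : R, 0 < a & forall i, pderiv i rho x = - a * nu ord0 i) ->
  exists2 C : R, 0 <= C & forall x, Omega x ->
    `|\sum_i pderiv i rho x * pderiv i w x| <= C * rho x.
Proof.
move=> [cw dw edw d2w ed2w] nw srho rpos r0 rneg rgrad.
have [M1 M10 HM1] := ext_uniform_bound edw.
have [M2 M20 HM2] := ext_uniform_bound
  (fun p : 'I_n * 'I_n => ed2w p.1 p.2).
have sr1 i : smooth (pderiv i rho) by exact: smooth_pderiv.
have sr2 i j : smooth (pderiv i (pderiv j rho)) by exact: smooth_pderiv.
have ext_smooth f : smooth f -> extends_continuously Omega (closure Omega) f.
  by move=> sf; exists f => //; apply: continuous_subspaceT; exact: smooth_continuous.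
have [M3 M30 HM3] := ext_uniform_bound (fun i => ext_smooth _ (sr1 i)).
have [M4 M40 HM4] := ext_uniform_bound (fun p : 'I_n * 'I_n => ext_smooth _ (sr2 p.1 p.2)).
pose gg x := \sum_i pderiv i rho x * pderiv i w x.
have dgg i x : Omega x -> is_derive x (delta_mx ord0 i) gg
    (\sum_j (pderiv i (pderiv j rho) x * pderiv j w x + pderiv j rho x * pderiv i (pderiv j w) x)).
  move=> Ox; apply: is_derive_bigsum => j; apply: is_derive_mul; apply: pderivableP.
    by apply: smooth_pderivable.
  exact: d2w.
have nu_ex x : bdry Omega x -> exists nu, outward_normal Omega x nu.
  by move=> bx; have [_ _ _ _ /(_ x bx)[rho1 L1]] := sO; eexists; exists rho1.
apply: (@vanishing_bound _ _ Omega gg rho (n%:R * (M4 * M1 + M3 * M2))) => //.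
- move=> x bx; have [nu ny] := nu_ex x bx.
  have [a a0 ra] := rgrad x nu bx ny.
  apply: contrapT => H; have u1 := outward_normal_unit ny.
  have nu0 i : nu ord0 i = 0.
    apply: contrapT => /eqP nui; apply: H; exists i; rewrite ra mulf_neq0//.
    by rewrite oppr_eq0 gt_eqF.
  move: u1; rewrite big1 => [/eqP|i _]; last by rewrite nu0 expr0n.
  by rewrite eq_sym oner_eq0.
- by move=> i x Ox; have [] := dgg i x Ox.
- move=> i x Ox; rewrite (pderivE (dgg i x Ox)) (le_trans (ler_norm_sum _ _ _))//.
  have -> : n%:R * (M4 * M1 + M3 * M2) = \sum_(j < n) (M4 * M1 + M3 * M2).
    by rewrite sumr_const card_ord mulr_natl.
  apply: ler_sum => j _; rewrite (le_trans (ler_normD _ _))// !normrM lerD//; apply: ler_pM => //.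
  + exact: (HM4 (i, j)).
  + exact: HM1.
  + exact: HM3.
  + exact: (HM2 (j, i)).
- move=> x Ox; apply: for_cont_bigsum => i; apply: for_contM.
    exact: smooth_continuous.
  exact: ext_for_cont.
- move=> x bx; have [nu ny] := nu_ex x bx.
  have [a a0 ra] := rgrad x nu bx ny.
  apply/cvgr0Pnorm_lt => e e0.
  have e2 : 0 < e / 2 / a by rewrite !divr_gt0.
  have [r rr hr] := within_cvg_ball (nw x nu bx ny) e2.
  pose q : R := e / 2 / (n%:R * M1 + 1).
  have nM : 0 < n%:R * M1 + 1 by rewrite ltr_wpDl// mulr_ge0.
  have q0 : 0 < q by rewrite !divr_gt0.
  have near_grad : \forall y \near x, forall i, `|pderiv i rho y - pderiv i rho x| < q.
    have H i : \forall y \near x, `|pderiv i rho y - pderiv i rho x| < q.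
      have c : {for x, continuous (fun y => `|pderiv i rho y - pderiv i rho x|)}.
        apply: (@for_cont_comp _ _ _ (fun y => pderiv i rho y - pderiv i rho x)); last exact: norm_continuous.
        apply: for_contD; [exact: smooth_continuous|exact: cst_continuous].
      by apply: (near_lt c); rewrite subrr normr0.
    exact: near_forall.
  have nr : \forall y \near x, `|x - y| < r.
    by apply/nbhs_ballP; exists r => //= y; rewrite mx_norm_ball.
  apply: filterS2 near_grad nr => y h1 h2 Oy.
  (* Freezing [grad rho] at the boundary point [x] leaves a normal derivative of [w], small by the
     Neumann condition, and an error that is small by the continuity of [grad rho]. *)
  have -> : gg y = \sum_i (pderiv i rho y - pderiv i rho x) * pderiv i w y
      - a * \sum_i pderiv i w y * nu ord0 i.
    by rewrite mulr_sumr -sumrB; apply: eq_bigr => i _; rewrite [in RHS]ra; ring.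
  have p1 : `|a * \sum_i pderiv i w y * nu ord0 i| < e / 2.
    by rewrite normrM (gtr0_norm a0) mulrC -ltr_pdivlMr// hr.
  have p2 : `|\sum_i (pderiv i rho y - pderiv i rho x) * pderiv i w y| <= e / 2.
    apply: (@le_trans _ _ (\sum_(i < n) q * M1)).
      rewrite (le_trans (ler_norm_sum _ _ _))//; apply: ler_sum => i _.
      by rewrite normrM; apply: ler_pM => //; [exact: ltW|exact: HM1].
    rewrite sumr_const card_ord -[leLHS]mulr_natl mulrCA /q mulrAC ler_pdivrMr//.
    by apply: ler_wpM2l; [rewrite divr_ge0// ltW|rewrite lerDl].
  apply: le_lt_trans (ler_normB _ _) _; rewrite [ltRHS](splitr e); exact: ler_ltD.
Qed.

End green_formula.

Lemma cvg_bigsum (R : realType) (I : Type) (r : seq I) (F : I -> nat -> R) (l : I -> R) :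
  (forall i, F i k @[k --> \oo] --> l i) ->
  \sum_(i <- r) F i k @[k --> \oo] --> \sum_(i <- r) l i.
Proof.
move=> Fl; elim: r => [|i r IH].
  by under eq_cvg do rewrite big_nil; rewrite big_nil; exact: cvg_cst.
by under eq_cvg do rewrite big_cons; rewrite big_cons; exact: cvgD.
Qed.

(** * Cutoffs and the proof of Green's formula *)

Section green_formula_proof.
Context {R : realType} {n : nat}.
Local Notation V := 'rV[R]_n.
Local Notation leb := (@lebesgue_rv R n).
Implicit Types (x : V) (f g w rho phi theta : V -> R) (G H : 'I_n -> V -> R).

Variable Omega : set V.
Hypothesis sO : smooth_bounded_domain Omega.

Let oO : open Omega. Proof. by have [] := sO. Qed.
Let bO : bounded_set Omega. Proof. by have [] := sO. Qed.
Let mO : measurable Omega := measurable_domain oO.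
Let Ofin : (leb Omega < +oo)%E := finite_domain oO bO.

Lemma L2_integrable f : L2 Omega f -> leb.-integrable Omega (EFin \o f).
Proof.
move=> [mf f2]; apply: (@integrable_le_R _ _ _ _ _ mO f (fun x => 1 + f x ^+ 2)) => //.
  move=> x _; rewrite -[f x ^+ 2]real_normK ?num_real//.
  have := sqr_ge0 (`|f x| - 1); rewrite expr2; have := sqr_ge0 `|f x|; rewrite expr2; lra.
apply: integrableD_R => //; apply: (bounded_fun_integrable (M := 1)) => //.
by move=> x _; rewrite normr1.
Qed.

Lemma test_near0 theta x : test_function Omega theta -> ~ Omega x ->
  \forall y \near x, theta y = 0.
Proof.
move=> [_ _ sub] nx; have nc : (~` closure [set y | theta y != 0]) x by move/sub.
have oC : open (~` closure [set y | theta y != 0]) by apply: closed_openC; exact: closed_closure.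
apply: filterS (near_open oC nc) => y ny; apply: contrapT => /eqP ty.
by apply: ny; exact: subset_closure.
Qed.

(** Nothing is known of [f] outside [Omega], but [theta] vanishes near every such point, so the
    product behaves there like the zero function. *)
Lemma test_mul_regular theta f i : test_function Omega theta -> (forall x, Omega x -> {for x, continuous f}) ->
  (forall x, Omega x -> pderivable i f x) ->
  (forall x, Omega x -> {for x, continuous (pderiv i f)}) ->
  [/\ continuous (fun x => theta x * f x),
      forall x, pderivable i (fun x => theta x * f x) x &
      continuous (pderiv i (fun x => theta x * f x))].
Proof.
move=> tt cf df cdf; have [st _ _] := tt; pose g x := theta x * f x.
have g0 x : ~ Omega x -> \forall y \near x, g y = 0.
  by move=> nx; apply: filterS (test_near0 tt nx) => y; rewrite /g => ->; rewrite mul0r.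
have c0 x : {for x, continuous ((fun=> 0) : V -> R)} by exact: cst_continuous.
have dg0 x : ~ Omega x -> is_derive x (delta_mx ord0 i) g 0.
  move=> nx; apply: (@near_eq_is_derive _ _ _ (fun=> 0) _ x _ 0 _ (is_derive_cst _ _ _)).
  by apply: filterS (g0 x nx) => y ->.
have dg x : Omega x -> is_derive x (delta_mx ord0 i) g (pderiv i theta x * f x + theta x * pderiv i f x).
  move=> Ox; apply: is_derive_mul; apply: pderivableP; last exact: df.
  exact: smooth_pderivable st.
have cc := smooth_continuous st.
split.
- move=> x; have [Ox|nx] := pselect (Omega x).
    by apply: for_contM; [exact: cc|exact: cf].
  apply: (@near_eq_for_cont _ _ (fun=> 0) g) => //.
  by apply: filterS (g0 x nx) => y ->.
- by move=> x; have [/dg[]|/dg0[]] := pselect (Omega x).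
- move=> x; have [Ox|nx] := pselect (Omega x).
    apply: (@near_eq_for_cont _ _ (fun x => pderiv i theta x * f x + theta x * pderiv i f x)).
      by apply: filterS (near_open oO Ox) => y Oy; rewrite (pderivE (dg y Oy)).
    apply: for_contD; apply: for_contM.
    + exact: smooth_continuous (smooth_pderiv i st) _.
    + exact: cf.
    + exact: cc.
    + exact: cdf.
  apply: (@near_eq_for_cont _ _ (fun=> 0)) => //.
  apply: filterS (nbhs_interior (g0 x nx)) => y gy0.
  apply/esym/pderivE; apply: (@near_eq_is_derive _ _ _ (fun=> 0) _ y _ 0 _ (is_derive_cst _ _ _)).
  by apply: filterS gy0 => z gz0; exact: esym gz0.
Qed.

Section cutoff.
Variables (rho : V -> R) (k : nat).
Hypotheses (srho : smooth rho) (rneg : forall x, ~ Omega x -> rho x <= 0).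

(** Zero where [rho <= 1/(k+1)], hence supported inside [Omega], and tending to 1 wherever
    [rho > 0]. There is no plateau: [flat 0 s] is [exp(-1/s)] for [s > 0], always below 1. *)
Definition cutoff x : R := flat 0 (k.+1%:R * rho x - 1).

Lemma cutoff_smooth : smooth cutoff.
Proof.
apply: (smooth_comp (smooth_flat 0)).
by apply: smoothD; [apply: smoothM => //; exact: smooth_cst|exact: smooth_cst].
Qed.

Lemma cutoff_ge0 x : 0 <= cutoff x. Proof. exact: flat_ge0. Qed.

Lemma cutoff_le1 x : cutoff x <= 1.
Proof. by have := flat_le_fact 0 (k.+1%:R * rho x - 1). Qed.

Lemma pderiv_cutoff i x :
  pderiv i cutoff x = flat 2 (k.+1%:R * rho x - 1) * (k.+1%:R * pderiv i rho x).
Proof.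
apply: pderivE; apply: is_derive_chain.
  by have := is_derive_flat 0 (k.+1%:R * rho x - 1); rewrite oppr0 mul0r add0r.
have := is_deriveD (is_deriveZ k.+1%:R (pderivableP (@smooth_pderivable _ _ _ i x srho)))
  (@is_derive_cst R V R (-1) x (delta_mx ord0 i)).
by rewrite addr0.
Qed.

Lemma cutoff_out x : ~ Omega x -> cutoff x = 0.
Proof.
move=> /rneg rx; rewrite /cutoff flat_le0// subr_le0.
by rewrite (@le_trans _ _ 0)// mulr_ge0_le0.
Qed.

Lemma test_function_cutoff : test_function Omega cutoff.
Proof.
pose S := [set x | k.+1%:R^-1 <= rho x].
have cS : closed S.
  rewrite (_ : S = rho @^-1` [set r | k.+1%:R^-1 <= r])//.
  by apply: closed_comp; [move=> x _; exact: smooth_continuous|exact: closed_ge].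
have SO : S `<=` Omega.
  move=> x /= xS; apply: contrapT => /rneg rx.
  by move: (le_trans xS rx); rewrite leNgt invr_gt0 ltr0n.
have sub : closure [set x | cutoff x != 0] `<=` S.
  rewrite [X in _ `<=` X](_ : S = closure S); last exact/closure_id.
  apply: closureS => x /=; apply: contraR; rewrite -ltNge => h.
  by rewrite /cutoff flat_le0// subr_le0 mulrC -ler_pdivlMr// mul1r ltW.
split; [exact: cutoff_smooth| |exact: subset_trans sub SO].
apply: bounded_closed_compact; last exact: closed_closure.
have [M [Mr HM]] := bO; exists M; split => // N MN x /sub/SO; exact: HM.
Qed.

End cutoff.

Lemma domain_in_box : exists2 L : R, 0 < L & Omega `<=` box 0 L.
Proof.
have [M [Mr HM]] := bO; pose N := `|M| + 1.
have MN : M < N by rewrite /N (le_lt_trans (ler_norm _))// ltrDl.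
have N0 : 0 <= N by rewrite /N addr_ge0.
exists (N + 1) => [|x /(HM N MN) /= xN]; first by rewrite ltr_wpDl.
have : `|x - 0| < N + 1 by rewrite subr0 (le_lt_trans xN)// ltrDl.
by move/ball_rVP => /(_ (ltr_wpDl N0 ltr01)).
Qed.

(** The weak gradient of [phi] is tested on the field [chi^2 grad w], whose divergence is [chi^2]
    times the Laplacian of [w] plus a term carrying [grad chi . grad w]. Dominated convergence in
    [k] removes the cutoff on both sides and kills the extra term. *)
Lemma green w phi H : C2_closure Omega w -> neumann Omega w -> H1 Omega phi H ->
  \int[leb]_(x in Omega) (\sum_i pderiv i w x * H i x) =
  - \int[leb]_(x in Omega) (laplacian w x * phi x).
Proof.
move=> w2 nw [phi2 HH]; have [cw dw edw d2w ed2w] := w2.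
have [rho [srho rpos r0 rneg rgrad]] := exists_defining_function sO.
have [C C0 HC] := grad_dot_bound sO w2 nw srho rpos r0 rneg rgrad.
have [L L0 OL] := domain_in_box.
have rphi := L2_integrable phi2.
have rH i : leb.-integrable Omega (EFin \o H i) by apply: L2_integrable; exact: (HH i).1.
have [M1 M10 HM1] := ext_uniform_bound sO edw.
have [M2 M20 HM2] := ext_uniform_bound sO (fun i => ed2w i i).
pose chi := cutoff rho.
(* Two cutoffs are spent: the one inside [g] extends the product by zero to the whole space with a
   continuous [i]-th derivative, the other is the test function that [weak_gradient_ext] asks
   for. *)
pose g k i x := chi k x * pderiv i w x.
pose F k i x := pderiv i (chi k) x * g k i x + chi k x * pderiv i (g k i) x.
have gR k i := test_mul_regular (test_function_cutoff k srho rneg) (fun x Ox => ext_for_cont sO (edw i) Ox)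
  (fun x Ox => d2w i i x Ox) (fun x Ox => ext_for_cont sO (ed2w i i) Ox).
have cchi k : continuous (chi k) by apply: smooth_continuous; exact: cutoff_smooth.
have cdchi k i : continuous (pderiv i (chi k)).
  by apply: smooth_continuous; apply: smooth_pderiv; exact: cutoff_smooth.
have cF k i : continuous (F k i).
  have [c1 c2 c3] := gR k i.
  by apply: continuous_fD; exact: continuous_fM.
have cm (h : V -> R) : continuous h -> measurable_fun Omega h.
  by move=> ch; apply: continuous_measurable_domain => // x _; exact: ch.
have ridx k i : leb.-integrable Omega (EFin \o (fun x => phi x * F k i x)).
  have [M _ HM] := continuous_bounded_domain bO (cF k i).
  exact: (integrable_mul_bounded mO rphi (cm _ (cF k i)) HM).
have riH k i : leb.-integrable Omega (EFin \o (fun x => H i x * (chi k x * g k i x))).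
  have c : continuous (fun x => chi k x * g k i x).
    by apply: continuous_fM; [exact: cchi|have [] := gR k i].
  have [M _ HM] := continuous_bounded_domain bO c.
  exact: (integrable_mul_bounded mO (rH i) (cm _ c) HM).
have E1 k i : \int[leb]_(x in Omega) (phi x * F k i x) =
    - \int[leb]_(x in Omega) (H i x * (chi k x * g k i x)).
  have [c1 c2 c3] := gR k i.
  apply: (weak_gradient_ext oO bO rphi (rH i) (HH i).2 (test_function_cutoff k srho rneg) L0 OL c1 c2 c3).
  by move=> x nx; rewrite cutoff_out ?mul0r// => Ox; apply: nx; exact: OL.
have E2 k : \int[leb]_(x in Omega) (\sum_i phi x * F k i x) =
    - \int[leb]_(x in Omega) (\sum_i H i x * (chi k x * g k i x)).
  rewrite (Rintegral_sum mO _ (ridx k)).2 (Rintegral_sum mO _ (riH k)).2 -sumrN.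
  by apply: eq_bigr => i _; exact: E1.
pose gg x := \sum_i pderiv i rho x * pderiv i w x.
have FE k x : Omega x -> \sum_i phi x * F k i x = phi x *
    (2 * chi k x * (flat 1 (k.+1%:R * rho x - 1) + flat 2 (k.+1%:R * rho x - 1)) * (gg x / rho x)
     + chi k x ^+ 2 * laplacian w x).
  move=> Ox; have rx : rho x != 0 by rewrite gt_eqF// rpos.
  (* With [s = (k+1) rho - 1], the identity [flat 2 s * (s + 1) = flat 1 s + flat 2 s] trades the
     growing factor [k+1] for [1 / rho], which [grad_dot_bound] absorbs. *)
  have fE : flat 1 (k.+1%:R * rho x - 1) + flat 2 (k.+1%:R * rho x - 1) =
      flat 2 (k.+1%:R * rho x - 1) * (k.+1%:R * rho x).
    by rewrite -[flat 1 _]flat_mulr; ring.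
  rewrite -mulr_sumr; congr (_ * _).
  transitivity (\sum_i (2 * chi k x * flat 2 (k.+1%:R * rho x - 1) * k.+1%:R *
      (pderiv i rho x * pderiv i w x) + chi k x ^+ 2 * pderiv i (pderiv i w) x)).
    apply: eq_bigr => i _; rewrite /F /g pderivM; first last.
    - exact: d2w.
    - exact: smooth_pderivable (cutoff_smooth k srho).
    by rewrite /chi pderiv_cutoff// -/(chi k x) expr2; ring.
  rewrite big_split/= -!mulr_sumr -/(gg x) -/(laplacian w x) fE; congr (_ + _).
  by rewrite !mulrA; field.
have ggb x : Omega x -> `|gg x / rho x| <= C.
  move=> Ox; rewrite normrM normfV (gtr0_norm (rpos x Ox)) ler_pdivrMr ?rpos//.
  exact: HC.
have lapb x : Omega x -> `|laplacian w x| <= n%:R * M2.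
  move=> Ox; rewrite (le_trans (ler_norm_sum _ _ _))//.
  apply: (@le_trans _ _ (\sum_(i < n) M2)); last by rewrite sumr_const card_ord mulr_natl.
  by apply: ler_sum => i _; exact: HM2.
have chi01 k x : `|chi k x| <= 1 by rewrite ger0_norm ?cutoff_ge0// cutoff_le1.
have lim1 : \int[leb]_(x in Omega) (\sum_i phi x * F k i x) @[k --> \oo] -->
    \int[leb]_(x in Omega) (phi x * laplacian w x).
  (* In the dominating constant, 2 comes from differentiating the square of the cutoff, 3 is
     [1! + 2!] bounding [flat 1 + flat 2], and [C] bounds [gg / rho]. *)
  apply: (@Rintegral_dominated_cvg _ _ _ _ _ mO (fun k x => \sum_i phi x * F k i x)
    (fun x => phi x * laplacian w x) (fun x => (2 * 3 * C + n%:R * M2) * `|phi x|)).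
  - by move=> k; apply: integrable_measurable; exact: (Rintegral_sum mO _ (ridx k)).1.
  - move=> x Ox; under eq_cvg do rewrite FE//.
    have rx := rpos x Ox.
    have l0 := cvg_flat1 rx; have l1 := cvg_flatS 0 rx; have l2 := cvg_flatS 1 rx.
    apply: cvgMl_tmp.
    rewrite -[X in _ --> X]add0r; apply: cvgD.
      rewrite -[X in _ --> X](mul0r (gg x / rho x)); apply: cvgMr_tmp.
      have -> : 0 = 2 * 1 * (0 + 0) :> R by rewrite addr0 mulr0.
      by apply: cvgM; [apply: cvgMl_tmp; exact: l0|exact: cvgD].
    rewrite -[X in _ --> X](mul1r (laplacian w x)); apply: cvgMr_tmp.
    have -> : 1 = 1 * 1 :> R by rewrite mulr1.
    by under eq_cvg do rewrite expr2; apply: cvgM.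
  - by apply: integrableZ_R => //; exact: integrable_norm_R.
  - move=> k x Ox; rewrite FE// normrM mulrC ler_wpM2r//.
    rewrite (le_trans (ler_normD _ _))// lerD//.
      rewrite normrM; apply: ler_pM => //; last exact: ggb.
      rewrite normrM; apply: ler_pM => //; last first.
        rewrite ger0_norm ?addr_ge0 ?flat_ge0//.
        have := flat_le_fact 1 (k.+1%:R * rho x - 1); have := flat_le_fact 2 (k.+1%:R * rho x - 1).
        rewrite (_ : 2`! = 2)%N// (_ : 1`! = 1)%N//; lra.
      by rewrite normrM (ger0_norm (ler0n _ 2)) ler_piMr// chi01.
    rewrite normrM -[leRHS]mul1r; apply: ler_pM => //; last exact: lapb.
    by rewrite normrX expr_le1.
have lim2 : \int[leb]_(x in Omega) (\sum_i H i x * (chi k x * g k i x)) @[k --> \oo] -->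
    \int[leb]_(x in Omega) (\sum_i H i x * pderiv i w x).
  apply: (@Rintegral_dominated_cvg _ _ _ _ _ mO (fun k x => \sum_i H i x * (chi k x * g k i x))
    (fun x => \sum_i H i x * pderiv i w x) (fun x => \sum_i M1 * `|H i x|)).
  - by move=> k; apply: integrable_measurable; exact: (Rintegral_sum mO _ (riH k)).1.
  - move=> x Ox; apply: cvg_bigsum => i; apply: cvgMl_tmp.
    have l0 := cvg_flat1 (rpos x Ox).
    rewrite -[X in _ --> X]mul1r; apply: cvgM; first exact: l0.
    by rewrite -[X in _ --> X]mul1r; apply: cvgMr_tmp; exact: l0.
  - apply: (Rintegral_sum mO _ _).1 => i.
    by apply: integrableZ_R => //; exact: integrable_norm_R.
  - move=> k x Ox; rewrite (le_trans (ler_norm_sum _ _ _))//; apply: ler_sum => i _.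
    rewrite normrM mulrC ler_wpM2r// /g !normrM -[leRHS]mul1r -[X in _ <= X * _]mulr1 -mulrA.
    by apply: ler_pM => //; apply: ler_pM => //; exact: HM1.
have lim2' : (- \int[leb]_(x in Omega) (\sum_i H i x * (chi k x * g k i x))) @[k --> \oo] -->
    - \int[leb]_(x in Omega) (\sum_i H i x * pderiv i w x) by apply: cvgN; exact: lim2.
have lim1' : (- \int[leb]_(x in Omega) (\sum_i H i x * (chi k x * g k i x))) @[k --> \oo] -->
    \int[leb]_(x in Omega) (phi x * laplacian w x) by under eq_cvg do rewrite -E2.
have EE := cvg_unique (@Rhausdorff R) lim1' lim2'.
have -> : \int[leb]_(x in Omega) (laplacian w x * phi x) =
    \int[leb]_(x in Omega) (phi x * laplacian w x) by apply: eq_Rintegral_in => x _; rewrite mulrC.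
rewrite EE// opprK; apply: eq_Rintegral_in => x _.
by apply: eq_bigr => i _; rewrite mulrC.
Qed.

End green_formula_proof.

(** * The Neumann resolvent *)

Section resolvent.
Context {R : realType} {n : nat}.
Local Notation V := 'rV[R]_n.
Local Notation leb := (@lebesgue_rv R n).
Implicit Types (x : V) (f g w phi theta : V -> R) (G H : 'I_n -> V -> R).

Variable Omega : set V.
Hypothesis sO : smooth_bounded_domain Omega.

Let oO : open Omega. Proof. by have [] := sO. Qed.
Let bO : bounded_set Omega. Proof. by have [] := sO. Qed.
Let mO : measurable Omega := measurable_domain oO.
Let Ofin : (leb Omega < +oo)%E := finite_domain oO bO.

Lemma bounded_L2 f (M : R) : (forall x, Omega x -> {for x, continuous f}) ->
  (forall x, Omega x -> `|f x| <= M) -> L2 Omega f.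
Proof.
move=> cf fM; have mf := continuous_measurable_domain oO cf.
split => //; apply: (@bounded_fun_integrable _ _ Omega (fun x => f x ^+ 2) (M ^+ 2)) => //.
  by apply: measurable_funX.
move=> x Ox; rewrite normrX lerXn2r ?nnegrE ?fM//.
exact: le_trans (normr_ge0 _) (fM x Ox).
Qed.

Lemma L2_mul f g : L2 Omega f -> L2 Omega g ->
  leb.-integrable Omega (EFin \o (fun x => f x * g x)).
Proof.
move=> [mf f2] [mg g2].
apply: (@integrable_le_R _ _ _ _ _ mO _ (fun x => f x ^+ 2 + g x ^+ 2)).
- exact: measurable_funM.
- move=> x _; rewrite normrM -[f x ^+ 2]real_normK ?num_real// -[g x ^+ 2]real_normK ?num_real//.
  have := sqr_ge0 (`|f x| - `|g x|); rewrite !expr2.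
  have : 0 <= `|f x| * `|g x| by rewrite mulr_ge0.
  lra.
- exact: integrableD_R.
Qed.

Lemma L2_sub f g : L2 Omega f -> L2 Omega g -> L2 Omega (fun x => f x - g x).
Proof.
move=> F G; have [mf f2] := F; have [mg g2] := G; split; first exact: measurable_funB.
have fg := L2_mul F G.
have : leb.-integrable Omega (EFin \o (fun x => f x ^+ 2 + (g x ^+ 2 + (- 2) * (f x * g x)))).
  by apply: integrableD_R => //; apply: integrableD_R => //; exact: integrableZ_R.
by apply: eq_integrable => // x _; congr (_%:E); ring.
Qed.

Lemma test_function_bounded theta i : test_function Omega theta ->
  exists2 M : R, 0 <= M & (forall x, Omega x -> `|theta x| <= M) /\
     forall x, Omega x -> `|pderiv i theta x| <= M.
Proof.
move=> [st _ _].
have [M1 M10 H1] := continuous_bounded_domain bO (smooth_continuous st).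
have [M2 M20 H2] := continuous_bounded_domain bO (smooth_continuous (smooth_pderiv i st)).
exists (M1 + M2); first exact: addr_ge0.
by split=> x Ox; [rewrite (le_trans (H1 x Ox))// lerDl|rewrite (le_trans (H2 x Ox))// lerDr].
Qed.

Lemma integrable_mul_test f theta i : leb.-integrable Omega (EFin \o f) ->
  test_function Omega theta ->
  leb.-integrable Omega (EFin \o (fun x => f x * theta x)) /\
  leb.-integrable Omega (EFin \o (fun x => f x * pderiv i theta x)).
Proof.
move=> rf tt; have [M _ [H1 H2]] := test_function_bounded i tt; have [st _ _] := tt.
split; [apply: (@integrable_mul_bounded _ _ _ _ _ mO f theta M rf _ H1)|
  apply: (@integrable_mul_bounded _ _ _ _ _ mO f (pderiv i theta) M rf _ H2)].
  by apply: continuous_measurable_domain => // x _; exact: smooth_continuous.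
apply: continuous_measurable_domain => // x _; apply: smooth_continuous; exact: smooth_pderiv.
Qed.

Lemma H1_sub f G g H : H1 Omega f G -> H1 Omega g H ->
  H1 Omega (fun x => f x - g x) (fun i x => G i x - H i x).
Proof.
move=> [f2 HG] [g2 HH]; split; first exact: L2_sub.
move=> i; have [Gi2 wf] := HG i; have [Hi2 wg] := HH i; split; first exact: L2_sub.
move=> theta tt.
have rL h : L2 Omega h -> leb.-integrable Omega (EFin \o h) by exact: L2_integrable.
have [_ i1] := integrable_mul_test i (rL _ f2) tt.
have [_ i2] := integrable_mul_test i (rL _ g2) tt.
have [i3 _] := integrable_mul_test i (rL _ Gi2) tt.
have [i4 _] := integrable_mul_test i (rL _ Hi2) tt.
transitivity (\int[leb]_(x in Omega) (f x * pderiv i theta x) -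
    \int[leb]_(x in Omega) (g x * pderiv i theta x)).
  by rewrite -RintegralB//; apply: eq_Rintegral_in => x _; rewrite mulrBl.
rewrite wf// wg// opprK addrC -opprB -RintegralB//; congr (- _).
by apply: eq_Rintegral_in => x _; rewrite mulrBl.
Qed.

(** For a test function [theta] the derivative of [theta w], extended by zero, integrates to 0 by
    [integral_pderiv0]; the product rule turns this into the weak derivative identity. *)
Lemma classical_H1 w : C2_closure Omega w -> H1 Omega w (fun i => pderiv i w).
Proof.
move=> [cw dw edw d2w ed2w].
have cwO x : Omega x -> {for x, continuous w}.
  by apply: ext_for_cont => //; exists w.
have [M0 _ HM0] : exists2 M : R, 0 <= M & forall x, Omega x -> `|w x| <= M.
  by apply: ext_bounded => //; exists w.
have w2 : L2 Omega w by apply: bounded_L2 HM0.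
split => // i.
have [M1 _ HM1] := ext_bounded sO (edw i).
have dw2 : L2 Omega (pderiv i w).
  by apply: (bounded_L2 _ HM1) => x; exact: ext_for_cont.
split => // theta tt; have [st _ sub] := tt.
have [c1 c2 c3] := test_mul_regular sO tt cwO (dw i) (fun x Ox => ext_for_cont sO (edw i) Ox).
have [L L0 OL] := domain_in_box sO.
have z := integral_pderiv0 L0 c2 c3.
have out x : ~ Omega x -> theta x * w x = 0.
  by move=> nx; rewrite (nbhs_singleton (test_near0 tt nx)) mul0r.
have {z} : \int[leb]_(x in Omega) (pderiv i theta x * w x + theta x * pderiv i w x) = 0.
  rewrite Rintegral_mkcond /Rintegral.
  rewrite (_ : (fun x => _) = fun x => (pderiv i (fun x => theta x * w x) x)%:E).
    by rewrite z// => x nx; apply: out => Ox; apply: nx; exact: OL.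
  apply/funext => x; congr (_%:E); rewrite patchE; case: ifPn => [|].
    by rewrite inE => Ox; rewrite pderivM//; [exact: smooth_pderivable|exact: dw].
  rewrite notin_setE => nx; apply/esym/pderivE.
  apply: (@near_eq_is_derive _ _ _ (fun=> 0) _ x _ 0 _ (is_derive_cst _ _ _)).
  by apply: filterS (test_near0 tt nx) => y ->; rewrite mul0r.
have [_ i1] := integrable_mul_test i (L2_integrable sO w2) tt.
have [i2 _] := integrable_mul_test i (L2_integrable sO dw2) tt.
have -> : \int[leb]_(x in Omega) (pderiv i theta x * w x + theta x * pderiv i w x) =
    \int[leb]_(x in Omega) (w x * pderiv i theta x) + \int[leb]_(x in Omega) (pderiv i w x * theta x).
  by rewrite -RintegralD//; apply: eq_Rintegral_in => x _; rewrite mulrC [theta x * _]mulrC.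
by move/eqP; rewrite addr_eq0 => /eqP.
Qed.

(** An energy estimate: testing both weak equations with [phi = w - v0] and subtracting gives [int
    |grad phi|^2 + int phi^2 = int (u - u0) phi]. As [v0] is only in [H1], so is [phi], which is why
    [green] is stated for any [H1] function. *)
Lemma resolvent_distance w (u u0 v0 : V -> R) (e : R) : 0 <= e ->
  C2_closure Omega w -> neumann Omega w ->
  (forall x, Omega x -> w x - laplacian w x = u x) ->
  (forall x, Omega x -> {for x, continuous u}) -> (forall x, Omega x -> {for x, continuous u0}) ->
  (exists M : R, forall x, Omega x -> `|u0 x| <= M) ->
  neumann_resolvent Omega u0 v0 ->
  (forall x, Omega x -> `|u x - u0 x| <= e) ->
  leb.-integrable Omega (EFin \o (fun x => (w x - v0 x) ^+ 2)) /\
  \int[leb]_(x in Omega) (w x - v0 x) ^+ 2 <= e ^+ 2 * fine (leb Omega).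
Proof.
move=> e0 w2 nw wu cu cu0 [M HM] [G HG test] ue.
pose phi x := w x - v0 x; pose H i x := pderiv i w x - G i x.
have Hw := classical_H1 w2; have HP : H1 Omega phi H := H1_sub Hw HG.
have [phi2 HH] := HP; have [wL2 dwL2] := Hw; have [v0L2 GL2] := HG.
have u0L2 : L2 Omega u0 := bounded_L2 cu0 HM.
have uM x : Omega x -> `|u x| <= e + M.
  by move=> Ox; rewrite -(subrK (u0 x) (u x)) (le_trans (ler_normD _ _))// lerD ?ue ?HM.
have uL2 : L2 Omega u := bounded_L2 cu uM.
have rHH : leb.-integrable Omega (EFin \o (fun x => \sum_i H i x * H i x)).
  by apply: (Rintegral_sum mO _ _).1 => i; apply: L2_mul; exact: (HH i).1.
have rGH : leb.-integrable Omega (EFin \o (fun x => \sum_i G i x * H i x)).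
  by apply: (Rintegral_sum mO _ _).1 => i; apply: L2_mul; [exact: (GL2 i).1|exact: (HH i).1].
have rwH : leb.-integrable Omega (EFin \o (fun x => \sum_i pderiv i w x * H i x)).
  by apply: (Rintegral_sum mO _ _).1 => i; apply: L2_mul; [exact: (dwL2 i).1|exact: (HH i).1].
have rpp := L2_mul phi2 phi2; have rvp := L2_mul v0L2 phi2; have rwp := L2_mul wL2 phi2.
have rup := L2_mul uL2 phi2; have ru0p := L2_mul u0L2 phi2.
have rlap : leb.-integrable Omega (EFin \o (fun x => laplacian w x * phi x)).
  have := integrableB_R mO rwp rup; apply: eq_integrable => // x; rewrite inE => Ox /=.
  by congr (_%:E); rewrite -(wu x Ox); ring.
have E1 := test phi H HP.
have E2 : \int[leb]_(x in Omega) (\sum_i pderiv i w x * H i x) =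
  \int[leb]_(x in Omega) (u x * phi x) - \int[leb]_(x in Omega) (w x * phi x).
  rewrite (green sO w2 nw HP) -[RHS]opprK opprB -RintegralB//; congr (- _).
  by apply: eq_Rintegral_in => x Ox; rewrite -(wu x Ox); ring.
have E3 : \int[leb]_(x in Omega) (\sum_i H i x * H i x) + \int[leb]_(x in Omega) (phi x * phi x) =
    \int[leb]_(x in Omega) (u x * phi x) - \int[leb]_(x in Omega) (u0 x * phi x).
  rewrite -E1 RintegralD//.
  have -> : \int[leb]_(x in Omega) (\sum_i H i x * H i x) =
     \int[leb]_(x in Omega) (\sum_i pderiv i w x * H i x) - \int[leb]_(x in Omega) (\sum_i G i x * H i x).
    rewrite -RintegralB//; apply: eq_Rintegral_in => x _; rewrite -sumrB.
    by apply: eq_bigr => i _; rewrite /H mulrBl.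
  have -> : \int[leb]_(x in Omega) (phi x * phi x) =
     \int[leb]_(x in Omega) (w x * phi x) - \int[leb]_(x in Omega) (v0 x * phi x).
    by rewrite -RintegralB//; apply: eq_Rintegral_in => x _; rewrite /phi mulrBl.
  by rewrite E2; ring.
(* Young's inequality; the half of [int phi^2] on the right is later absorbed on the left. *)
have E4 : \int[leb]_(x in Omega) (u x * phi x) - \int[leb]_(x in Omega) (u0 x * phi x) <=
    2^-1 * (e ^+ 2 * fine (leb Omega)) + 2^-1 * \int[leb]_(x in Omega) (phi x * phi x).
  have re : leb.-integrable Omega (EFin \o (fun=> e ^+ 2)).
    by apply: (bounded_fun_integrable (M := e ^+ 2)) => // x _; rewrite ger0_norm// sqr_ge0.
  rewrite -Rintegral_cst// -!RintegralZl// -RintegralB// -RintegralD//; [|exact: integrableZ_R|exact: integrableZ_R].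
  apply: le_Rintegral => //; first exact: integrableB_R.
    by apply: integrableD_R => //; exact: integrableZ_R.
  move=> x Ox; rewrite -mulrBl.
  have h1 : `|u x - u0 x| <= e := ue x Ox.
  have h2 : (u x - u0 x) * phi x <= `|u x - u0 x| * `|phi x| by rewrite -normrM ler_norm.
  have h3 : `|u x - u0 x| * `|phi x| <= e * `|phi x| by rewrite ler_wpM2r.
  have h4 : phi x * phi x = `|phi x| ^+ 2 by rewrite real_normK ?num_real// expr2.
  have h5 := sqr_ge0 (e - `|phi x|).
  rewrite h4; move: h5; rewrite sqrrB; lra.
have HH0 : 0 <= \int[leb]_(x in Omega) (\sum_i H i x * H i x).
  by apply: Rintegral_ge0 => x _; apply: sumr_ge0 => i _; rewrite -expr2 sqr_ge0.
have EP : \int[leb]_(x in Omega) (w x - v0 x) ^+ 2 = \int[leb]_(x in Omega) (phi x * phi x).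
  by apply: eq_Rintegral_in => x _; rewrite expr2.
split; first by apply: eq_integrable rpp => // x _; rewrite /= expr2.
rewrite EP; move: E3 E4 HH0; lra.
Qed.

(** If the two continuous functions differ by [2 d] at [x], they differ by more than [d] on a box
    around it, and any [w] uniformly close to [z] then has a squared L2 distance to [v0] of at least
    a multiple of the volume of that box. *)
Lemma eq_of_L2_approx (z v0 : V -> R) : (forall x, Omega x -> {for x, continuous z}) ->
  (forall x, Omega x -> {for x, continuous v0}) ->
  (forall e : R, 0 < e -> exists w, [/\ forall x, Omega x -> `|w x - z x| <= e,
     leb.-integrable Omega (EFin \o (fun x => (w x - v0 x) ^+ 2)) &
     \int[leb]_(x in Omega) (w x - v0 x) ^+ 2 <= e]) ->
  forall x, Omega x -> z x = v0 x.
Proof.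
move=> cz cv approx x Ox; apply/eqP; rewrite -subr_eq0; apply/negP => /negP nz.
pose d := `|z x - v0 x| / 2; have d0 : 0 < d by rewrite divr_gt0// normr_gt0.
have cf : {for x, continuous (fun y => `|z y - v0 y|)}.
  apply: (@for_cont_comp _ _ _ (fun y => z y - v0 y)); last exact: norm_continuous.
  apply: for_contD; first exact: cz.
  by apply: for_cont_comp; [exact: cv|exact: opp_continuous].
have dx : d < `|z x - v0 x| by rewrite /d; have := d0; rewrite /d; lra.
have /nbhs_ballP[r/= r0 hr] := near_and (near_gt cf dx) (near_open oO Ox).
pose B := box x r.
have BO y : B y -> d < `|z y - v0 y| /\ Omega y.
  by move=> By; apply: hr; rewrite mx_norm_ball /ball_/= distrC; apply/ball_rVP.
have mB : measurable B by exact: measurable_box.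
have m0 : 0 < (2 * r) ^+ n by rewrite exprn_gt0// mulr_gt0.
pose c := (d / 2) ^+ 2; have c0 : 0 < c by rewrite exprn_gt0// divr_gt0.
(* The first bound keeps the gap between [w] and [v0] above [d / 2] on the box; the second is half
   of the resulting lower bound for the integral, which gives the contradiction. *)
pose e := Num.min (d / 2) (c * (2 * r) ^+ n / 2).
have e0 : 0 < e.
  rewrite lt_min; apply/andP; split; first exact: divr_gt0.
  by apply: divr_gt0 => //; exact: mulr_gt0.
have [w [wz rw Iw]] := approx e e0.
have low : (c%:E * leb B <= \int[leb]_(x in Omega) ((w x - v0 x) ^+ 2)%:E)%E.
  rewrite -integral_cst//; apply: (@le_trans _ _ (\int[leb]_(x in B) ((w x - v0 x) ^+ 2)%:E)%E).
    apply: ge0_le_integral => //.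
    - by move=> y _; rewrite lee_fin ltW.
    - apply/measurable_EFinP; apply: (measurable_funS mO) => [y /BO[]//|].
      exact: integrable_measurable rw.
    - move=> y /BO[h1 Oy]; rewrite lee_fin -[leRHS]real_normK ?num_real// /c.
      have h2 := wz y Oy; have he : e <= d / 2 by rewrite ge_min lexx.
      have : `|z y - v0 y| <= `|w y - v0 y| + `|w y - z y|.
        have -> : z y - v0 y = (w y - v0 y) - (w y - z y) by ring.
        exact: ler_normB.
      by move=> h3; rewrite lerXn2r// ?nnegrE ?divr_ge0 ?(ltW d0)//; lra.
  apply: ge0_subset_integral => //.
  - apply/measurable_EFinP; exact: integrable_measurable rw.
  - by move=> y _; rewrite lee_fin sqr_ge0.
  - by move=> y /BO[].
have := low; rewrite lebesgue_rv_box//.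
have -> : (\int[leb]_(x in Omega) ((w x - v0 x) ^+ 2)%:E)%E =
    (\int[leb]_(x in Omega) (w x - v0 x) ^+ 2)%:E.
  by rewrite /Rintegral fineK//; exact: integrable_fin_num.
rewrite -EFinM lee_fin => h; have := le_trans h Iw.
have cm : 0 < c * (2 * r) ^+ n by rewrite mulr_gt0.
have : e <= c * (2 * r) ^+ n / 2 by rewrite ge_min lexx orbT.
lra.
Qed.

End resolvent.

(** * The evolution problem *)

Section halfline.
Context {R : realType}.
Implicit Types (f g df : R -> R).

Lemma is_derive_for_cont f (s a : R) : is_derive s 1 f a -> {for s, continuous f}.
Proof. by move=> [fd _]; apply: differentiable_continuous; apply/derivable1_diffP. Qed.

(** By the mean value theorem the difference quotient at 0 is a value of [df] at an intermediate
    point, and [df] is continuous at 0. This glues the two halves of the extension of [gamma]. *)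
Lemma is_derive_junction f df : continuous f -> {for 0, continuous df} ->
  (forall s : R, s != 0 -> is_derive s 1 f (df s)) -> is_derive (0 : R) 1 f (df 0).
Proof.
move=> cf cdf fd; apply/is_derive1_caratheodory.
exists (fun z => if z == 0 then df 0 else (f z - f 0) / z); split.
- move=> z; rewrite subr0; case: eqP => [->|/eqP z0]; first by rewrite subrr mulr0.
  by rewrite divfK.
- rewrite /prop_for /continuous_at eqxx; apply/cvgrPdist_lt => e e0.
  have /cvgrPdist_lt/(_ _ e0)/nbhs_ballP[d/= d0 hd] := cdf.
  apply/nbhs_ballP; exists d => //= z; rewrite /ball/= sub0r normrN => zd.
  case: eqP => [_|/eqP z0]; first by rewrite subrr normr0.
  have [c c0 ->] : exists2 c : R, `|c| < d & (f z - f 0) / z = df c.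
    have [zp|zn] := ltP 0 z.
      have [|c] := @MVT _ f df 0 z zp _ (continuous_subspaceT cf).
        by move=> x; rewrite in_itv/= => /andP[x0 _]; apply: fd; rewrite gt_eqF.
      rewrite in_itv/= => /andP[c0 cz] E; exists c; last by rewrite E subr0 mulfK.
      by rewrite gtr0_norm// (lt_trans cz)// (le_lt_trans (ler_norm _) zd).
    have {}zn : z < 0 by rewrite lt_neqAle z0.
    have [|c] := @MVT _ f df z 0 zn _ (continuous_subspaceT cf).
      by move=> x; rewrite in_itv/= => /andP[_ x0]; apply: fd; rewrite lt_eqF.
    rewrite in_itv/= => /andP[cz c0] E; exists c.
      rewrite ltr0_norm// (lt_trans _ zd)// ltr0_norm// ltrN2//.
    by rewrite -opprB E sub0r mulrN opprK mulfK.
  by apply: hd; rewrite /ball/= sub0r normrN.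
- by rewrite eqxx.
Qed.

Lemma halfline_junction f (a b : R -> R) : {within `[0, +oo[, continuous a} ->
  {for 0, continuous b} -> (forall s, 0 < s -> f s = a s) ->
  (forall s, s <= 0 -> f s = b s) -> a 0 = b 0 -> {for 0, continuous f}.
Proof.
move=> /subspace_continuousP ca cb fa fb ab; apply/cvgrPdist_lt => e e0.
have ain : [set` `[0, +oo[] (0 : R) by rewrite /= in_itv/= lexx.
have /cvgrPdist_lt/(_ _ e0) := ca 0 ain.
move=> /nbhs_ballP[d1/= d10 h1].
have /cvgrPdist_lt/(_ _ e0)/nbhs_ballP[d2/= d20 h2] := cb.
apply/nbhs_ballP; exists (Num.min d1 d2) => /=; first by rewrite lt_min d10.
move=> s; rewrite /ball/= lt_min => /andP[s1 s2]; rewrite (fb 0 (lexx _)).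
have [sp|sn] := ltP 0 s; last by rewrite fb//; exact: h2.
rewrite fa// -ab; apply: h1 => //=.
by rewrite in_itv/= ltW.
Qed.

(* [gamma] is only controlled on the half-line, and [v] may a priori vanish;
   the quadratic Taylor extension makes the chain rule available there. *)
Lemma halfline_extension (gamma : R -> R) : Ck_halfline 3 gamma ->
  exists g g1 g2 : R -> R, [/\ forall s : R, 0 <= s -> g s = gamma s,
    forall s : R, 0 < s -> g1 s = derive1 gamma s,
    forall s : R, is_derive s 1 g (g1 s) & forall s : R, is_derive s 1 g1 (g2 s)].
Proof.
move=> [cg dg ext].
have [k1 ck1 k1E] := ext 1 isT; have [k2 ck2 k2E] := ext 2 isT.
have d0 (s : R) : 0 < s -> is_derive s 1 gamma (derive1 gamma s).
  by move=> s0; rewrite derive1E; apply/derivableP; exact: (dg 0 s isT s0).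
have d1 (s : R) : 0 < s -> is_derive s 1 (derive1 gamma) (derive1n 2 gamma s).
  by move=> s0; rewrite derive1nS derive1E; apply/derivableP; exact: (dg 1 s isT s0).
pose g (s : R) := if 0 < s then gamma s else gamma 0 + k1 0 * s + k2 0 * (s * s / 2).
pose g1 (s : R) := if 0 < s then derive1 gamma s else k1 0 + k2 0 * s.
pose g2 (s : R) := if 0 < s then derive1n 2 gamma s else k2 0.
have q0 (s : R) : is_derive s 1 (fun s => gamma 0 + k1 0 * s + k2 0 * (s * s / 2)) (k1 0 + k2 0 * s).
  have dI := @is_derive_id R R s 1.
  have := is_deriveD (is_deriveD (@is_derive_cst R R R (gamma 0) s 1) (is_deriveZ (k1 0) dI))
    (is_deriveZ (k2 0 / 2) (is_deriveM dI dI)).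
  have -> : (cst (gamma 0) + (k1 0 \*: @idfun R) + (k2 0 / 2 \*: (@idfun R * @idfun R)) : R -> R) =
     (fun s => gamma 0 + k1 0 * s + k2 0 * (s * s / 2)).
    apply/funext => z; rewrite !fctE -[LHS]/(gamma 0 + k1 0 * z + k2 0 / 2 * (z * z)).
    by field.
  move=> h; apply: (is_derive_eq h).
  rewrite -[LHS]/(0 + k1 0 * 1 + k2 0 / 2 * (s * 1 + s * 1)).
  by field.
have q1 (s : R) : is_derive s 1 (fun s => k1 0 + k2 0 * s) (k2 0).
  have dI := @is_derive_id R R s 1.
  have := is_deriveD (@is_derive_cst R R R (k1 0) s 1) (is_deriveZ (k2 0) dI).
  by move=> h; apply: (is_derive_eq h); rewrite -[LHS]/(0 + k2 0 * 1) add0r mulr1.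
have qc0 : {for 0, continuous (fun s : R => gamma 0 + k1 0 * s + k2 0 * (s * s / 2))}.
  exact: is_derive_for_cont (q0 0).
have qc1 : {for 0, continuous (fun s : R => k1 0 + k2 0 * s)}.
  exact: is_derive_for_cont (q1 0).
have gpos (s : R) : 0 < s -> is_derive s 1 g (g1 s).
  move=> s0; rewrite /g1 s0; apply: (@near_eq_is_derive _ _ _ gamma) (d0 s s0).
  by near=> t; rewrite /g ifT//; near: t; exact: lt_nbhsr.
have g1pos (s : R) : 0 < s -> is_derive s 1 g1 (g2 s).
  move=> s0; rewrite /g2 s0; apply: (@near_eq_is_derive _ _ _ (derive1 gamma)) (d1 s s0).
  by near=> t; rewrite /g1 ifT//; near: t; exact: lt_nbhsr.
have gneg (s : R) : s < 0 -> is_derive s 1 g (g1 s).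
  move=> s0; rewrite /g1 ltNge (ltW s0)/=; apply: (@near_eq_is_derive _ _ _ _ _ _ _ _ _ (q0 s)).
  near=> t; rewrite /g ltNge ifF//; apply/negbF; apply: ltW; near: t; exact: lt_nbhsl.
have g1neg (s : R) : s < 0 -> is_derive s 1 g1 (g2 s).
  move=> s0; rewrite /g2 ltNge (ltW s0)/=; apply: (@near_eq_is_derive _ _ _ _ _ _ _ _ _ (q1 s)).
  near=> t; rewrite /g1 ltNge ifF//; apply/negbF; apply: ltW; near: t; exact: lt_nbhsl.
have cg0 : {for 0, continuous g}.
  apply: (halfline_junction cg qc0).
  - by move=> s s0; rewrite /g s0.
  - by move=> s s0; rewrite /g ltNge s0.
  - by rewrite !mulr0 mul0r mulr0 !addr0.
have cg1 : {for 0, continuous g1}.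
  apply: (halfline_junction ck1 qc1).
  - by move=> s s0; rewrite /g1 s0 -k1E.
  - by move=> s s0; rewrite /g1 ltNge s0.
  - by rewrite mulr0 addr0.
have cg2 : {for 0, continuous g2}.
  apply: (halfline_junction (b := fun=> k2 0) ck2); first exact: cst_continuous.
  - by move=> s s0; rewrite /g2 s0 -k2E.
  - by move=> s s0; rewrite /g2 ltNge s0.
  - by [].
have cgA : continuous g.
  move=> s; have [s0|s0|->] := ltgtP s 0; last exact: cg0.
    exact: is_derive_for_cont (gneg s s0).
  exact: is_derive_for_cont (gpos s s0).
have cg1A : continuous g1.
  move=> s; have [s0|s0|->] := ltgtP s 0; last exact: cg1.
    exact: is_derive_for_cont (g1neg s s0).
  exact: is_derive_for_cont (g1pos s s0).
exists g, g1, g2; split.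
- move=> s; rewrite le_eqVlt => /predU1P[<-|s0]; last by rewrite /g s0.
  by rewrite /g ltxx !mulr0 mul0r mulr0 !addr0.
- by move=> s s0; rewrite /g1 s0.
- move=> s; have [s0|s0|->] := ltgtP s 0; [exact: gneg|exact: gpos|].
  apply: is_derive_junction => // z z0.
  by have [?|?|zz] := ltgtP z 0; [exact: gneg|exact: gpos|rewrite zz eqxx in z0].
- move=> s; have [s0|s0|->] := ltgtP s 0; [exact: g1neg|exact: g1pos|].
  apply: is_derive_junction => // z z0.
  by have [?|?|zz] := ltgtP z 0; [exact: g1neg|exact: g1pos|rewrite zz eqxx in z0].
Unshelve. all: by end_near.
Qed.

(** The mean value theorem is applied to the extension of [gamma], continuous on the whole line,
    which also covers intervals starting at 0. *)
Lemma halfline_nonincreasing (gamma : R -> R) : Ck_halfline 3 gamma ->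
  (forall s : R, 0 < s -> derive1 gamma s <= 0) ->
  forall a b : R, 0 <= a -> a <= b -> gamma b <= gamma a.
Proof.
move=> Cg g'; have [g [g1 [g2 [gE g1E dg _]]]] := halfline_extension Cg.
move=> a b a0; rewrite le_eqVlt => /predU1P[->//|ab].
rewrite -!gE// ?(le_trans a0 (ltW ab))//.
have cg : continuous g by move=> s; exact: is_derive_for_cont (dg s).
have [c] := MVT ab (fun x _ => dg x) (continuous_subspaceT cg).
rewrite in_itv/= => /andP[ac cb] E; rewrite -subr_le0 E.
rewrite mulr_le0_ge0 ?subr_ge0 ?(ltW ab)// g1E ?g'// (le_lt_trans a0)//.
Qed.

End halfline.

(** * Stability of Neumann regularity under algebraic operations *)

Section regularity_algebra.
Context {R : realType} {n : nat}.
Local Notation V := 'rV[R]_n.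
Implicit Types (x y nu : V) (f g h w a b : V -> R).

Variable Omega : set V.
Hypothesis sO : smooth_bounded_domain Omega.

Lemma within_bounded_domain f : {within closure Omega, continuous f} ->
  exists2 M : R, 0 <= M & forall x, Omega x -> `|f x| <= M.
Proof. by move=> cf; apply: (ext_bounded sO); exists f. Qed.

Lemma within_for_cont f x : {within closure Omega, continuous f} -> Omega x ->
  {for x, continuous f}.
Proof. by move=> cf; apply: (ext_for_cont sO); exists f. Qed.

Lemma neumann_comb f g h a b (M : R) : neumann Omega f -> neumann Omega g ->
  (forall x, Omega x -> `|a x| <= M) -> (forall x, Omega x -> `|b x| <= M) ->
  (forall i x, Omega x -> pderiv i h x = a x * pderiv i f x + b x * pderiv i g x) ->
  neumann Omega h.
Proof.
move=> nf ng aM bM hE x nu bx xnu; apply/cvgr0Pnorm_lt => e e0.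
pose M' := `|M| + 1; have M'0 : 0 < M' by rewrite ltr_wpDl.
have e20 : 0 < e / 2 / M' by rewrite !divr_gt0.
have [r1 r10 h1] := within_cvg_ball (nf x nu bx xnu) e20.
have [r2 r20 h2] := within_cvg_ball (ng x nu bx xnu) e20.
apply/nbhs_ballP; exists (Num.min r1 r2) => /=; first by rewrite lt_min r10.
move=> y; rewrite mx_norm_ball /ball_/= lt_min => /andP[y1 y2] Oy.
have -> : \sum_i pderiv i h y * nu ord0 i = a y * (\sum_i pderiv i f y * nu ord0 i) +
    b y * (\sum_i pderiv i g y * nu ord0 i).
  rewrite !mulr_sumr -big_split/=; apply: eq_bigr => i _; rewrite hE//.
  by rewrite mulrDl !mulrA.
have MM : M < M' by rewrite (le_lt_trans (ler_norm _))// ltrDl.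
have bnd (c s : R) : `|c| <= M -> `|s| < e / 2 / M' -> `|c * s| < e / 2.
  move=> cM; rewrite ltr_pdivlMr// => sM; rewrite normrM.
  apply: le_lt_trans sM; rewrite mulrC ler_wpM2l// (le_trans cM)// ltW//.
have := bnd _ _ (aM y Oy) (h1 y Oy y1); have := bnd _ _ (bM y Oy) (h2 y Oy y2).
move: (a y * _) (b y * _) => p q hq hp.
by rewrite (le_lt_trans (ler_normD _ _))// [e]splitr ltrD.
Qed.

(** Linear combinations, products and compositions all have a gradient of the form
    [a grad f + b grad g] with bounded differentiable coefficients; the three lemmas for them are
    instances of this one. *)
Lemma neumann_regular_comb f g h a b (M : R) :
  neumann_regular Omega f -> neumann_regular Omega g ->
  {within closure Omega, continuous h} ->
  (forall x, Omega x -> {for x, continuous a} /\ {for x, continuous b}) ->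
  (forall i x, Omega x -> pderivable i a x /\ pderivable i b x) ->
  (forall x, Omega x -> `|a x| <= M /\ `|b x| <= M) ->
  (forall i x, Omega x ->
     is_derive x (delta_mx ord0 i) h (a x * pderiv i f x + b x * pderiv i g x)) ->
  neumann_regular Omega h.
Proof.
move=> [cf df cdf d2f nf] [cg dg cdg d2g ng] ch cab dab abM dh.
have hE i x : Omega x -> pderiv i h x = a x * pderiv i f x + b x * pderiv i g x.
  by move=> Ox; apply: pderivE; exact: dh.
have nE i x : Omega x ->
    \forall y \near x, a y * pderiv i f y + b y * pderiv i g y = pderiv i h y.
  by move=> Ox; apply: (near_in sO) => // y Oy; rewrite hE.
split; first exact: ch.
- by move=> i x Ox; have [] := dh i x Ox.
- move=> i x Ox; apply: (near_eq_for_cont (nE i x Ox)); have [ca cb] := cab x Ox.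
  by apply: for_contD; apply: for_contM; [exact: ca|exact: cdf|exact: cb|exact: cdg].
- move=> i x Ox; have [da db] := dab i x Ox.
  have := @near_eq_is_derive _ _ _ _ _ x (delta_mx ord0 i) _ (nE i x Ox)
    (is_deriveD (is_derive_mul (pderivableP da) (pderivableP (d2f i x Ox)))
                (is_derive_mul (pderivableP db) (pderivableP (d2g i x Ox)))).
  by case.
- by apply: (neumann_comb nf ng (M := M) _ _ hE) => x Ox; have [] := abM x Ox.
Qed.

Let cst_side (c d : R) :
  [/\ forall x, Omega x -> {for x, continuous (fun=> c : R)} /\
      {for x, continuous (fun=> d : R)},
    forall i x, Omega x -> pderivable i (fun=> c : R) x /\ pderivable i (fun=> d : R) x &
    forall x, Omega x -> `|c| <= `|c| + `|d| /\ `|d| <= `|c| + `|d|].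
Proof.
split=> [x _|i x _|x _].
- by split; exact: cst_continuous.
- by split; have [] := @is_derive_cst R V R c x (delta_mx ord0 i);
    have [] := @is_derive_cst R V R d x (delta_mx ord0 i).
- by rewrite lerDl lerDr.
Qed.

Lemma neumann_regularL (c d : R) f g : neumann_regular Omega f -> neumann_regular Omega g ->
  neumann_regular Omega (fun x => c * f x + d * g x).
Proof.
move=> Rf Rg; have [cf df _ _ _] := Rf; have [cg dg _ _ _] := Rg.
have [h1 h2 h3] := cst_side c d.
apply: (neumann_regular_comb Rf Rg _ h1 h2 h3).
  have cc (k : R) : {within closure Omega, continuous (fun=> k : R)}.
    by apply: continuous_subspaceT; exact: cst_continuous.
  by apply: within_contD; apply: within_contM.
move=> i x Ox.
exact: is_deriveD (is_deriveZ _ (pderivableP (df i x Ox))) (is_deriveZ _ (pderivableP (dg i x Ox))).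
Qed.

Lemma neumann_regularM f g : neumann_regular Omega f -> neumann_regular Omega g ->
  neumann_regular Omega (fun x => f x * g x).
Proof.
move=> Rf Rg; have [cf df _ _ _] := Rf; have [cg dg _ _ _] := Rg.
have [M1 M10 H1] := within_bounded_domain cf; have [M2 M20 H2] := within_bounded_domain cg.
apply: (@neumann_regular_comb f g _ g f (M1 + M2) Rf Rg).
- exact: within_contM.
- by move=> x Ox; split; exact: within_for_cont.
- by move=> i x Ox; split; [exact: dg|exact: df].
- by move=> x Ox; split; [rewrite (le_trans (H2 x Ox))// lerDr|rewrite (le_trans (H1 x Ox))// lerDl].
- move=> i x Ox; rewrite [g x * _]mulrC.
  by apply: is_derive_mul; apply: pderivableP; [exact: df|exact: dg].
Qed.

Lemma neumann_regular_comp (k k1 k2 : R -> R) f :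
  (forall s : R, is_derive s 1 k (k1 s)) -> (forall s : R, is_derive s 1 k1 (k2 s)) ->
  neumann_regular Omega f -> neumann_regular Omega (fun x => k (f x)).
Proof.
move=> dk dk1 Rf; have [cf df _ _ _] := Rf.
have ck : continuous k by move=> s; exact: is_derive_for_cont (dk s).
have ck1 : continuous k1 by move=> s; exact: is_derive_for_cont (dk1 s).
have ck1f := within_cont_comp ck1 cf.
have [M M0 HM] := within_bounded_domain ck1f.
apply: (@neumann_regular_comb f f _ (fun x => k1 (f x)) (fun=> 0) M Rf Rf).
- exact: within_cont_comp.
- by move=> x Ox; split; [exact: within_for_cont|exact: cst_continuous].
- move=> i x Ox; split.
    by have [] := is_derive_chain (dk1 (f x)) (pderivableP (df i x Ox)).
  by have [] := @is_derive_cst R V R 0 x (delta_mx ord0 i).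
- by move=> x Ox; rewrite normr0; split => //; exact: HM.
- move=> i x Ox; rewrite mul0r addr0.
  exact: is_derive_chain (dk (f x)) (pderivableP (df i x Ox)).
Qed.

Lemma C2_closure_neumann_regular w : C2_closure Omega w -> neumann Omega w ->
  neumann_regular Omega w.
Proof.
move=> [cw dw edw d2w _] nw; split; [exact: cw|exact: dw| |by move=> i x; exact: d2w|exact: nw].
  by move=> i x; exact: (ext_for_cont sO (edw i)).
Qed.

Lemma laplacianL (c d : R) f g x : neumann_regular Omega f -> neumann_regular Omega g ->
  Omega x -> laplacian (fun y => c * f y + d * g y) x = c * laplacian f x + d * laplacian g x.
Proof.
move=> [_ df _ d2f _] [_ dg _ d2g _] Ox.
rewrite /laplacian !mulr_sumr -big_split/=; apply: eq_bigr => i _; apply: pderivE.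
have nf : \forall y \near x, pderivable i f y by apply: (near_in sO) => // y; exact: df.
have ng : \forall y \near x, pderivable i g y by apply: (near_in sO) => // y; exact: dg.
have zf := is_derive2Z c nf (d2f i x Ox); have zg := is_derive2Z d ng (d2g i x Ox).
have pZ (k : R) (F : V -> R) : (\forall y \near x, pderivable i F y) ->
    \forall y \near x, pderivable i (fun z => k * F z) y.
  by apply: filterS => y Fy; have [] := is_deriveZ k (pderivableP Fy).
have := is_derive2D (pZ c f nf) (pZ d g ng) (ex_derive (is_derive := zf)) (ex_derive (is_derive := zg)).
by rewrite (pderivE zf) (pderivE zg).
Qed.

Lemma laplacian_eq f g x : (forall y, Omega y -> f y = g y) -> Omega x ->
  laplacian f x = laplacian g x.
Proof.
move=> fg Ox; have E i y : Omega y -> pderiv i f y = pderiv i g y.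
  by move=> Oy; apply: near_eq_derive; apply: (near_in sO) => // z; exact: fg.
by apply: eq_bigr => i _; apply: near_eq_derive; apply: (near_in sO) => // z Oz; exact: E.
Qed.

End regularity_algebra.

(** * Uniform estimates in time on space-time cylinders *)

Section cylinder.
Context {R : realType} {n : nat}.
Local Notation V := 'rV[R]_n.
Implicit Types (x y : V) (t s h : R) (w : V -> R -> R) (I : set R).

Lemma time_oo_room (T : \bar R) t : time_oo T t ->
  exists2 d : R, 0 < d & forall s, `|s - t| < d -> time_oo T s.
Proof.
move=> [t0 tT].
have [b tb bT] : exists2 b : R, t < b & (b%:E <= T)%E.
  case: T tT => [r| |] tT.
  - by exists r; rewrite ?lexx// -lte_fin.
  - by exists (t + 1); rewrite ?leey// ltrDl.
  - by rewrite ltNge leNye in tT.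
exists (Num.min t (b - t)); first by rewrite lt_min t0 subr_gt0.
move=> s; rewrite lt_min !ltr_norml => /andP[/andP[s1 _] /andP[_ s2]]; split; first by lra.
by apply: lt_le_trans bT; rewrite lte_fin; lra.
Qed.

Variable Omega : set V.
Hypothesis sO : smooth_bounded_domain Omega.

Let bO : bounded_set Omega. Proof. by have [] := sO. Qed.
Let Oinc x : Omega x -> closure Omega x. Proof. exact: subset_closure. Qed.

(** Compactness of the closure, in near-covering form along the filter [within I (nbhs t)]. Staying
    within [I] allows the endpoint [t = 0] of [time_co]. *)
Lemma cylinder_uniform (k : V * R -> R) I t (e : R) :
  {within closure Omega `*` I, continuous k} -> I t -> 0 < e ->
  exists2 d : R, 0 < d & forall s, I s -> `|s - t| < d ->
    forall x, closure Omega x -> `|k (x, s) - k (x, t)| < e.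
Proof.
move=> /subspace_continuousP ck It e0.
have /compact_near_coveringP cov := closure_bounded_compact bO.
have := cov R (within I (nbhs t)) (fun s x => closure Omega x -> `|k (x, s) - k (x, t)| < e) _.
case.
  move=> x cx; have e20 : 0 < e / 2 by rewrite divr_gt0.
  have /cvgrPdist_lt/(_ _ e20) := ck (x, t) (conj cx It).
  move=> [[A B]/= [nA nB] AB].
  exists (A, B `&` I) => /=; first by split => //; apply: filterS nB => s Bs Is; split.
  move=> [y s]/= [Ay [Bs Is]] cy.
  have h1 := AB (y, s) (conj Ay Bs) (conj cy Is).
  have h2 := AB (y, t) (conj Ay (nbhs_singleton nB)) (conj cy It).
  rewrite /= in h1 h2.
  have -> : k (y, s) - k (y, t) = (k (x, t) - k (y, t)) - (k (x, t) - k (y, s)) by ring.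
  by rewrite (le_lt_trans (ler_normB _ _))// [e]splitr ltrD.
move=> d/= d0 hd; exists d => // s Is st x cx.
by apply: (hd s) => //=; rewrite distrC.
Qed.

Lemma cylinder_slice (k : V * R -> R) I t : {within closure Omega `*` I, continuous k} -> I t ->
  {within closure Omega, continuous (fun x => k (x, t))}.
Proof.
move=> ck It; apply: (within_comp (B := closure Omega `*` I) (g := fun x => (x, t))) => //.
move=> x P [[A B]/= [nA nB] AB].
suff : nbhs x [set y | P (y, t)] by [].
by apply: filterS nA => y Ay; apply: AB; split => //=; exact: nbhs_singleton.
Qed.

Lemma C21_slice I w t : C21 Omega I w -> I t -> C2_closure Omega (w^~ t).
Proof.
move=> [cw _ dw d2w] It; split.
- exact: (@cylinder_slice (fun p => w p.1 p.2) I).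
- by move=> i x Ox; exact: (dw i).1.
- move=> i; have [_ [k ck kE]] := dw i.
  exists (fun x => k (x, t)); first exact: (@cylinder_slice k I).
  by move=> x Ox; rewrite -kE.
- by move=> i j x Ox; exact: (d2w i j).1.
- move=> i j; have [_ [k ck kE]] := d2w i j.
  exists (fun x => k (x, t)); first exact: (@cylinder_slice k I).
  by move=> x Ox; rewrite -kE.
Qed.

Lemma C21_is_derive I w x t : C21 Omega I w -> Omega x -> I t ->
  is_derive t 1 (w x) (derive1 (w x) t).
Proof. by move=> [_ [dw _] _ _] Ox It; rewrite derive1E; apply/derivableP; exact: dw. Qed.

Lemma C21_time_cont I w x t : C21 Omega I w -> Omega x -> I t -> {for t, continuous (w x)}.
Proof. by move=> Cw Ox It; exact: is_derive_for_cont (C21_is_derive Cw Ox It). Qed.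

(** The quotient is the time derivative at an intermediate time, and the continuous extension of
    this derivative to the closure is uniformly close to its value at [t]. *)
Lemma difference_quotient_uniform (T : \bar R) w t (e : R) : C21 Omega (time_oo T) w ->
  time_oo T t -> 0 < e ->
  exists2 d : R, 0 < d & forall h, 0 < h < d -> time_oo T (t + h) /\
    forall x, Omega x -> `|(w x (t + h) - w x t) / h - derive1 (w x) t| < e.
Proof.
move=> Cw Tt e0; have [_ [_ [k ck kE]] _ _] := Cw.
have [d1 d10 H1] := cylinder_uniform ck Tt e0.
have [d2 d20 H2] := time_oo_room Tt.
exists (Num.min d1 d2); first by rewrite lt_min d10.
move=> h /andP[h0]; rewrite lt_min => /andP[hd1 hd2].
have T' s : t <= s <= t + h -> time_oo T s.
  by move=> /andP[s1 s2]; apply: H2; rewrite ltr_norml; apply/andP; split; lra.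
have tth : t < t + h by rewrite ltrDl.
split; first by apply: T'; rewrite lexx ltW.
move=> x Ox.
have [|s|c] := @MVT _ (w x) (derive1 (w x)) t (t + h) tth.
- move=> s; rewrite in_itv/= => /andP[s1 s2].
  by apply: (C21_is_derive Cw Ox); apply: T'; rewrite !ltW.
- apply: continuous_in_subspaceT => z; rewrite inE/= in_itv/= => zI.
  by apply: (C21_time_cont Cw Ox); exact: T'.
rewrite in_itv/= => /andP[c1 c2] ->; rewrite [t + h]addrC addrK mulfK ?gt_eqF//.
have Tc : time_oo T c by apply: T'; rewrite !ltW.
have := H1 c Tc _ x (Oinc Ox); rewrite -(kE (x, c))//= -(kE (x, t))//=.
by apply; rewrite ltr_norml; apply/andP; split; lra.
Qed.

End cylinder.

(** * Sign, growth and initial value of the solution *)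

Section evolution.
Context {R : realType} {n : nat}.
Local Notation V := 'rV[R]_n.
Implicit Types (x y : V) (t s h : R).

Variable Omega : set V.
Hypothesis sO : smooth_bounded_domain Omega.
Variables (gamma g g1 g2 : R -> R).
Hypothesis gE : forall s : R, 0 <= s -> g s = gamma s.
Hypothesis dg : forall s : R, is_derive s 1 g (g1 s).
Hypothesis dg1 : forall s : R, is_derive s 1 g1 (g2 s).
Variables (mu : R) (u0 : V -> R) (T : \bar R) (u v : V -> R -> R).
Hypothesis sol : classical_solution Omega gamma mu u0 T u v.

Let Oinc x : Omega x -> closure Omega x. Proof. exact: subset_closure. Qed.

Lemma time_oo_co t : time_oo T t -> time_co T t.
Proof. by move=> [t0 tT]; split => //; exact: ltW. Qed.

Lemma solution_regular t : time_oo T t ->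
  neumann_regular Omega (u^~ t) /\ neumann_regular Omega (v^~ t).
Proof.
move=> Tt; have [[_ _ Cu Cv] _ _ neu _] := sol; have [nu nv] := neu t Tt.
by split; apply: (C2_closure_neumann_regular sO) => //; apply: C21_slice Tt.
Qed.

Lemma flux_regular t : time_oo T t -> neumann_regular Omega (fun y => g (v y t) * u y t).
Proof.
move=> Tt; have [Ru Rv] := solution_regular Tt.
exact: (neumann_regularM sO (neumann_regular_comp sO dg dg1 Rv) Ru).
Qed.

Lemma solution_eqns x t : Omega x -> time_oo T t ->
  laplacian (fun y => g (v y t) * u y t) x = derive1 (u x) t - mu * u x t * (1 - u x t) /\
  laplacian (v^~ t) x = v x t - u x t.
Proof.
move=> Ox Tt; have [_ vpos eqs _ _] := sol; have [eu ev] := eqs x t Ox Tt.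
split; last by rewrite -ev opprD opprK addrCA subrr addr0.
rewrite eu addrK; apply: (laplacian_eq sO) => // y Oy.
by rewrite gE//; apply: vpos; [exact: Oinc|exact: time_oo_co].
Qed.

(* The finite difference [(v(t+h) - v(t))/h + g(v)u + lam v] is an exact
   solution of the resolvent equation whose right-hand side no longer contains
   [Delta (g(v)u)], so the elliptic comparison principle applies to it. *)
Lemma evolution_bound (sg lam B : R) t : `|sg| <= 1 -> time_oo T t ->
  (forall x, Omega x ->
     sg * (g (v x t) * u x t + mu * u x t * (1 - u x t) + lam * u x t) <= B) ->
  forall x, Omega x -> sg * (derive1 (v x) t + g (v x t) * u x t + lam * v x t) <= B.
Proof.
move=> sg1 Tt HB x Ox; apply/ler_addgt0Pr => e e0.
have [[_ _ Cu Cv] _ _ _ _] := sol.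
have e20 : 0 < e / 2 by rewrite divr_gt0.
have [d1 d10 H1] := difference_quotient_uniform sO Cu Tt e20.
have [d2 d20 H2] := difference_quotient_uniform sO Cv Tt e20.
pose h := Num.min d1 d2 / 2.
have m0 : 0 < Num.min d1 d2 by rewrite lt_min d10.
have h0 : 0 < h by rewrite divr_gt0.
have hm : h < Num.min d1 d2 by rewrite /h; lra.
have [Tth Hu] : time_oo T (t + h) /\
    forall x, Omega x -> `|(u x (t + h) - u x t) / h - derive1 (u x) t| < e / 2.
  by apply: H1; rewrite h0 (lt_le_trans hm)// ge_min lexx.
have [_ Hv] : time_oo T (t + h) /\
    forall x, Omega x -> `|(v x (t + h) - v x t) / h - derive1 (v x) t| < e / 2.
  by apply: H2; rewrite h0 (lt_le_trans hm)// ge_min lexx orbT.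
have sgb a : `|a| < e / 2 -> sg * a <= e / 2.
  move=> ae; rewrite (le_trans (ler_norm _))// normrM (le_trans _ (ltW ae))//.
  by rewrite ler_piMl.
have [_ Rv] := solution_regular Tt; have [_ Rvh] := solution_regular Tth.
have Rg := flux_regular Tt.
have R1 := neumann_regularL sO h^-1 (- h^-1) Rvh Rv.
have R2 := neumann_regularL sO 1 lam Rg Rv.
have RW := neumann_regularL sO sg sg R1 R2.
have := elliptic_max_principle sO (K := B + e / 2) RW _ (Oinc Ox).
move=> W.
have {W} : sg * (h^-1 * v x (t + h) + - h^-1 * v x t) +
     sg * (1 * (g (v x t) * u x t) + lam * v x t) <= B + e / 2.
  (* After substituting both equations the quotients of [v] cancel, and what is left is the
     expression bounded by [B] plus [sg] times the difference quotient of [u] minus [u_t], at most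
     [e / 2]. *)
  apply: W => y Oy; rewrite (laplacianL sO _ _ R1 R2 Oy).
  rewrite (laplacianL sO _ _ Rvh Rv Oy) (laplacianL sO _ _ Rg Rv Oy).
  have [-> ->] := solution_eqns Oy Tt; have [_ ->] := solution_eqns Oy Tth.
  have := lerD (HB y Oy) (sgb _ (Hu y Oy)); congr (_ <= _).
  by ring.
move=> W.
have := Hv x Ox; rewrite -normrN => /sgb b.
have -> : B + e = B + e / 2 + e / 2 by field.
by have := lerD W b; congr (_ <= _); ring.
Qed.

Hypothesis gamma_gt0 : forall s : R, 0 <= s -> 0 < gamma s.
Hypothesis gamma_le : forall a b : R, 0 <= a -> a <= b -> gamma b <= gamma a.
Hypothesis mu0 : 0 < mu.
Hypothesis u00 : forall x, Omega x -> 0 <= u0 x.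

Let v_ge0 x t : closure Omega x -> time_co T t -> 0 <= v x t.
Proof. by have [_ vpos _ _ _] := sol; exact: vpos. Qed.

Let bO : bounded_set Omega. Proof. by have [] := sO. Qed.

Lemma cylinder_bounded (k : V * R -> R) t : time_co T t ->
  {within closure Omega `*` time_co T, continuous k} ->
  exists2 M : R, 0 <= M & forall x s, closure Omega x -> 0 <= s <= t -> `|k (x, s)| <= M.
Proof.
move=> [_ tT] ck.
have cK : compact (closure Omega `*` `[0, t]%classic).
  by apply: compact_setX; [exact: closure_bounded_compact|exact: segment_compact].
have sub : closure Omega `*` `[0, t]%classic `<=` closure Omega `*` time_co T.
  move=> [x s]/= [cx]; rewrite in_itv/= => /andP[s0 st]; split => //; split => //.
  by apply: le_lt_trans tT; rewrite lee_fin.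
have [M M0 HM] := compact_bounded_above cK (continuous_subspaceW sub ck).
by exists M => // x s cx s0t; apply: HM; split => //=; rewrite in_itv.
Qed.

Lemma closure_ge0 (f : V -> R) : {within closure Omega, continuous f} ->
  (forall x, Omega x -> 0 <= f x) -> forall x, closure Omega x -> 0 <= f x.
Proof.
move=> /subspace_continuousP cf f0 x cx; rewrite leNgt; apply/negP => fx.
have fn : f @ within (closure Omega) (nbhs x) --> f x := cf x cx.
have nx : nbhs x [set y | closure Omega y -> f y < 0].
  by have : \forall y \near within (closure Omega) (nbhs x), f y < 0 by exact: (cvgr_lt _ fn).
have [y [Oy fy]] := cx _ nx.
by have := f0 y Oy; rewrite leNgt fy//; exact: Oinc.
Qed.

(** With [w = - g(v) u] one has [w_t = g(v) Delta w + c w] for [c = g1(v) v_t / g(v) + mu (1 - u)],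
    and [w <= 0] initially. The parabolic principle needs [c] bounded above down to time 0, hence a
    bound on [v_t], which [evolution_bound] supplies. *)
Lemma solution_ge0 x t : closure Omega x -> time_co T t -> 0 <= u x t.
Proof.
move=> cx Tt; have [[cu cv Cu Cv] _ _ _ ui] := sol.
have cg : continuous g by move=> s; exact: is_derive_for_cont (dg s).
have cg1 : continuous g1 by move=> s; exact: is_derive_for_cont (dg1 s).
have Tt' : time_co T 0 by split => //; case: Tt => t0 tT; apply: le_lt_trans tT; rewrite lee_fin.
have Ts s : 0 <= s <= t -> time_co T s.
  by move=> /andP[s0 st]; split => //; case: Tt => t0 tT; apply: le_lt_trans tT; rewrite lee_fin.
have Tso s : 0 < s <= t -> time_oo T s.
  by move=> /andP[s0 st]; split => //; have [] := Ts s; rewrite ?st ?ltW.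
have gv y s : closure Omega y -> 0 <= s <= t -> 0 < g (v y s) <= gamma 0.
  by move=> cy st; have vy := v_ge0 cy (Ts s st); rewrite gE// gamma_gt0//= gamma_le.
have [U U0 HU] := cylinder_bounded Tt cu.
have [Vm Vm0 HV] := cylinder_bounded Tt cv.
have [G1 G10 HG1] := cylinder_bounded Tt (within_cont_comp cg1 cv).
rewrite /= in HU HV HG1.
have gmin y s : closure Omega y -> 0 <= s <= t -> gamma Vm <= g (v y s).
  move=> cy st; have vy := v_ge0 cy (Ts s st); rewrite gE// gamma_le//.
  by rewrite (le_trans (ler_norm _))// HV.
have gV0 : 0 < gamma Vm by exact: gamma_gt0.
have A0 : 0 < gamma 0 by exact: gamma_gt0.
pose B := gamma 0 * U + mu * U * (1 + U).
have gu y s : closure Omega y -> 0 <= s <= t -> `|g (v y s) * u y s| <= gamma 0 * U.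
  move=> cy st; have /andP[g0 gA] := gv y s cy st.
  by rewrite normrM ler_pM// ?HU// gtr0_norm.
have HB y s : closure Omega y -> 0 <= s <= t ->
    `|g (v y s) * u y s + mu * u y s * (1 - u y s)| <= B.
  move=> cy st; rewrite (le_trans (ler_normD _ _))// lerD ?gu//.
  rewrite !normrM (gtr0_norm mu0) ler_pM// ?mulr_ge0// ?(ltW mu0)//.
    by rewrite ler_pM2l// HU.
  by rewrite (le_trans (ler_normB _ _))// normr1 lerD2l HU.
have vt y s : Omega y -> 0 < s <= t -> `|derive1 (v y) s| <= B + gamma 0 * U.
  move=> Oy st; have st' : 0 <= s <= t by case/andP: st => s0 ->; rewrite ltW.
  (* Used with both signs of [sg], this bounds [v_t + g(v) u] in absolute value at every time in
     [(0, t]]. *)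
  have bnd (sg : R) : `|sg| = 1 -> sg * (derive1 (v y) s + g (v y s) * u y s + 0 * v y s) <= B.
    move=> sg1; apply: (@evolution_bound sg 0 B s) => //; first by rewrite sg1.
      exact: Tso.
    move=> z Oz; rewrite mul0r addr0 (le_trans (ler_norm _))// normrM sg1 mul1r HB//.
    exact: Oinc.
  have h1 := bnd 1 (normr1 _); have h2 := bnd (-1) (etrans (normrN _) (normr1 _)).
  rewrite mul0r addr0 in h1 h2.
  have := gu y s (Oinc Oy) st'; rewrite !ler_norml => /andP[p q].
  by apply/andP; split; lra.
have tt : 0 <= t <= t by rewrite lexx andbT; case: Tt.
pose w y s := - (g (v y s) * u y s).
(* The factors bound [g1(v)], [v_t] and [1 / g(v)], the last because [g(v) >= gamma Vm] by
   monotonicity; the remaining term bounds [mu (1 - u)] through [|u| <= U]. *)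
pose k := G1 * (B + gamma 0 * U) / gamma Vm + mu * (1 + U).
suff : w x t <= 0 by rewrite oppr_le0 pmulr_rge0//; have /andP[] := gv x t cx tt.
apply: (@parabolic_max_principle _ _ Omega sO w t (gamma 0) k (ltW A0) _ _ _ _ x t cx tt).
- have cW : {within closure Omega `*` time_co T, continuous (fun p : V * R => - (g (v p.1 p.2) * u p.1 p.2))}.
    apply: within_cont_comp; first exact: opp_continuous.
    by apply: within_contM cu; exact: (within_cont_comp cg cv).
  apply: continuous_subspaceW cW => -[y s]/= [cy]; rewrite in_itv/= => sI.
  by split => //; exact: Ts.
- move=> s sI; have Rf := flux_regular (Tso s sI).
  have -> : w^~ s = fun y => (-1) * (g (v y s) * u y s) + 0 * (g (v y s) * u y s).
    by apply/funext => y; rewrite mulN1r mul0r addr0.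
  exact: (neumann_regularL sO (-1) 0 Rf Rf).
- move=> y s Oy sI; have To := Tso s sI; have cy := Oinc Oy.
  have sI' : 0 <= s <= t by case/andP: sI => s0 ->; rewrite ltW.
  have /andP[g0 gA] := gv y s cy sI'.
  exists (g (v y s)), (g1 (v y s) * derive1 (v y) s / g (v y s) + mu * (1 - u y s)).
  split; first by rewrite (ltW g0).
    apply: lerD.
      rewrite (le_trans (ler_norm _))// !normrM ler_pM// ?mulr_ge0//.
        by rewrite ler_pM// ?HG1// vt.
      by rewrite normfV gtr0_norm// lef_pV2 ?posrE// gmin.
    rewrite ler_pM2l// lerD2l; have := HU y s cy sI'; rewrite ler_norml => /andP[+ _].
    lra.
  have Rf := flux_regular To.
  have -> : laplacian (w^~ s) y = - laplacian (fun z => g (v z s) * u z s) y.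
    have -> : w^~ s = fun y => (-1) * (g (v y s) * u y s) + 0 * (g (v y s) * u y s).
      by apply/funext => z; rewrite mulN1r mul0r addr0.
    by rewrite (laplacianL sO _ _ Rf Rf Oy) mulN1r mul0r addr0.
  have [-> _] := solution_eqns Oy To.
  have dv := C21_is_derive Cv Oy To; have du := C21_is_derive Cu Oy To.
  have dgv := @is_derive1_comp _ g (v y) s _ _ (dg (v y s)) dv.
  have := is_deriveN (is_deriveM dgv du).
  move=> h; apply: (is_derive_eq h).
  rewrite /w -[LHS]/(- (g (v y s) * derive1 (u y) s + u y s * (g1 (v y s) * derive1 (v y) s))).
  by field; rewrite gt_eqF.
- move=> y cy; rewrite oppr_le0 mulr_ge0//.
    have t0 : 0 <= (0 : R) <= t by rewrite lexx; case: Tt.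
    by have /andP[/ltW] := gv y 0 cy t0.
  apply: (closure_ge0 (f := u^~ 0) _ _ cy); first exact: (cylinder_slice cu Tt').
  by move=> z Oz; rewrite ui// u00.
Qed.

(** Gronwall's lemma in the form of the mean value theorem for [exp(lam s) (v - K)], which is
    continuous up to time 0 but known to be differentiable only afterwards. *)
Lemma solution_growth x t : Omega x -> time_co T t ->
  v x t <= v x 0 + (1 + gamma 0 / mu).
Proof.
move=> Ox Tt; have [[cu cv Cu Cv] _ _ _ _] := sol; have cx := Oinc Ox.
have A0 : 0 < gamma 0 by exact: gamma_gt0.
pose K := 1 + gamma 0 / mu; pose lam := gamma 0 + mu.
have K0 : 0 <= K by rewrite addr_ge0// divr_ge0 ?ltW.
have lam0 : 0 < lam by rewrite addr_gt0.
have Ts s : 0 <= s <= t -> time_co T s.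
  by move=> /andP[s0 st]; split => //; case: Tt => t0 tT; apply: le_lt_trans tT; rewrite lee_fin.
have T0 : time_co T 0 by apply: Ts; rewrite lexx; case: Tt.
have v00 := v_ge0 cx T0.
have t0 : 0 <= t by case: Tt.
move: t0; rewrite le_eqVlt => /predU1P[<-|t0]; first by rewrite lerDl.
have gv y s : Omega y -> time_co T s -> 0 <= g (v y s) <= gamma 0.
  move=> Oy Tso; have vy := v_ge0 (Oinc Oy) Tso.
  by rewrite gE// ltW ?gamma_gt0//= gamma_le.
have vts s : 0 < s < t -> derive1 (v x) s + lam * (v x s - K) <= 0.
  move=> /andP[s0 st]; have To : time_oo T s.
    by have [] := Ts s; rewrite ?ltW.
  have h := @evolution_bound 1 lam (lam * K) s _ To _ x Ox.
  have : 1 * (derive1 (v x) s + g (v x s) * u x s + lam * v x s) <= lam * K.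
    apply: h => [|y Oy]; first by rewrite normr1.
    have /andP[g0 gA] := gv y s Oy (time_oo_co To).
    have uy : 0 <= u y s by apply: solution_ge0; [exact: Oinc|exact: time_oo_co].
    have gu : g (v y s) * u y s <= gamma 0 * u y s by rewrite ler_wpM2r.
    (* Completing the square, with [lam * K = lam^2 / mu]. *)
    have E : lam * K = 2 * lam * u y s - mu * u y s ^+ 2 + (lam - mu * u y s) ^+ 2 / mu.
      by rewrite /K /lam; field; rewrite gt_eqF.
    have q : 0 <= (lam - mu * u y s) ^+ 2 / mu by rewrite divr_ge0 ?sqr_ge0 ?ltW.
    rewrite E mul1r; apply: (@le_trans _ _ (2 * lam * u y s - mu * u y s ^+ 2)); last by rewrite lerDl.
    have -> : 2 * lam * u y s - mu * u y s ^+ 2 =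
      gamma 0 * u y s + mu * u y s * (1 - u y s) + lam * u y s by rewrite /lam; ring.
    by rewrite !lerD2r.
  have /andP[g0 _] := gv x s Ox (time_oo_co To).
  have : 0 <= g (v x s) * u x s.
    by rewrite mulr_ge0// solution_ge0//; exact: time_oo_co.
  by rewrite mul1r mulrBr; move: (g _ * _) (lam * v x s) (lam * K) (derive1 _ _) => *; lra.
pose f s := expR (lam * s) * (v x s - K).
pose df s := expR (lam * s) * (derive1 (v x) s + lam * (v x s - K)).
have dlin (s : R) : is_derive s 1 (fun r => lam * r) lam.
  have h := is_deriveZ lam (@is_derive_id R R s 1).
  by apply: (is_derive_eq h); exact: mulr1.
have dexp (s : R) : is_derive s 1 (fun r => expR (lam * r)) (expR (lam * s) * lam).
  exact: (@is_derive1_comp _ expR (fun r => lam * r) s _ _ (is_derive_expR _) (dlin s)).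
have cexp : continuous (fun r : R => expR (lam * r)).
  by move=> s; exact: is_derive_for_cont (dexp s).
have [||c] := @MVT _ f df 0 t t0.
- move=> s; rewrite in_itv/= => /andP[s0 st].
  have To : time_oo T s by have [] := Ts s; rewrite ?ltW.
  have h := is_deriveM (dexp s) (is_deriveB (C21_is_derive Cv Ox To) (@is_derive_cst _ _ _ K s 1)).
  apply: (is_derive_eq h).
  rewrite -[LHS]/(expR (lam * s) * (derive1 (v x) s - 0) + (v x s - K) * (expR (lam * s) * lam)) /df.
  by ring.
- apply: within_contM; first exact: continuous_subspaceT.
  apply: within_contD; last by apply: continuous_subspaceT; exact: cst_continuous.
  apply: (within_comp (B := closure Omega `*` time_co T) (g := fun s => (x, s)) (f := fun p : V * R => v p.1 p.2)) => //.
    move=> s P [[A B]/= [nA nB] AB].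
    suff : nbhs s [set r | P (x, r)] by [].
    by apply: filterS nB => r Br; apply: AB; split => //=; exact: nbhs_singleton.
  by move=> s; rewrite /= in_itv/= => sI; split => //; exact: Ts.
rewrite in_itv/= => cI E.
have : f t <= f 0.
  rewrite -subr_le0 E subr0 mulr_le0_ge0 ?(ltW t0)// /df.
  by rewrite mulr_ge0_le0 ?expR_ge0// vts.
rewrite /f mulr0 expR0 mul1r => h.
have E1 : 1 <= expR (lam * t) by rewrite -expR0 ler_expR mulr_ge0// ltW.
have [vK|vK] := leP (v x t - K) 0; first by rewrite -/K; move: vK v00; lra.
have : v x t - K <= expR (lam * t) * (v x t - K) by rewrite ler_peMl// ltW.
by rewrite -/K; move: (expR _ * _) h => *; lra.
Qed.

Hypothesis T0 : (0 < T)%E.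
Hypothesis cu0 : {within closure Omega, continuous u0}.

(** For small [t > 0] the slice [v(t)] is C2 and solves the resolvent equation with datum [u(t)],
    and both slices converge uniformly to those at time 0. So [resolvent_distance] provides the
    approximants that [eq_of_L2_approx] asks for. *)
Lemma solution_initial (v0 : V -> R) : {within closure Omega, continuous v0} ->
  neumann_resolvent Omega u0 v0 -> forall x, Omega x -> v x 0 = v0 x.
Proof.
move=> cv0 res; have [[cu cv Cu Cv] _ _ neu ui] := sol.
have T00 : time_co T 0 by split => //; rewrite lexx.
have [M _ HM] := within_bounded_domain sO cu0.
apply: (eq_of_L2_approx sO (z := v^~ 0)).
- move=> x; exact: (within_for_cont sO (cylinder_slice cv T00)).
- by move=> x; exact: (within_for_cont sO).
move=> e e0; set L := fine (lebesgue_rv n Omega).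
have L0 : 0 <= L by exact: fine_ge0.
have L10 : 0 < L + 1 by rewrite ltr_wpDl.
(* Chosen so that [d^2 L <= d (L + 1) <= e]; the added 1 keeps the denominator positive. *)
pose d := Num.min 1 (e / (L + 1)).
have d0 : 0 < d by rewrite lt_min ltr01 divr_gt0.
have dL : d ^+ 2 * L <= e.
  apply: (@le_trans _ _ (d * (L + 1))).
    rewrite expr2 -mulrA ler_wpM2l ?(ltW d0)//.
    rewrite (@le_trans _ _ L)// ?lerDl// ler_piMl//.
    by rewrite /d ge_min lexx.
  by rewrite -ler_pdivlMr// /d ge_min lexx orbT.
have [r1 r10 H1] := cylinder_uniform sO cu T00 d0.
have [r2 r20 H2] := cylinder_uniform sO cv T00 e0.
have [t [t0 tT tr]] : exists t : R, [/\ 0 < t, (t%:E < T)%E & t < Num.min r1 r2].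
  have m0 : 0 < Num.min r1 r2 by rewrite lt_min r10.
  pose m := Num.min r1 r2.
  (* A positive real bound below [T], which may be infinite. *)
  have [b b0 bT] : exists2 b : R, 0 < b & (b%:E <= T)%E.
    move: T0; case: T => [r| |] // r0; first by exists r.
    by exists 1; rewrite ?leey.
  exists (Num.min m b / 2); have mb : 0 < Num.min m b by rewrite lt_min m0.
  have h : Num.min m b / 2 < Num.min m b by lra.
  split; first by rewrite divr_gt0.
    by apply: lt_le_trans bT; rewrite lte_fin (lt_le_trans h)// ge_min lexx orbT.
  by rewrite (lt_le_trans h)// ge_min lexx.
have Tt : time_oo T t by [].
move: tr; rewrite lt_min => /andP[tr1 tr2].
have nt : `|t - 0| = t by rewrite subr0 gtr0_norm.
have Hu x : Omega x -> `|u x t - u0 x| <= d.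
  move=> Ox; have := H1 t (time_oo_co Tt) _ x (Oinc Ox); rewrite nt => /(_ tr1).
  by rewrite /= ui// => /ltW.
have [Ru _] := solution_regular Tt; have [cut _ _ _ _] := Ru.
have [||||||||] := resolvent_distance sO (w := v^~ t) (u := u^~ t) (u0 := u0) (v0 := v0) (ltW d0).
- exact: (C21_slice Cv Tt).
- exact: (neu t Tt).2.
- by move=> x Ox; have [_ ->] := solution_eqns Ox Tt; rewrite opprB addrCA subrr addr0.
- by move=> x; exact: (within_for_cont sO cut).
- by move=> x; exact: (within_for_cont sO cu0).
- by exists M.
- exact: res.
- exact: Hu.
move=> rw Iw; exists (v^~ t); split; [|exact: rw|exact: le_trans Iw dL].
move=> x Ox; have := H2 t (time_oo_co Tt) _ x (Oinc Ox); rewrite nt => /(_ tr2).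
by rewrite /= => /ltW.
Qed.

End evolution.

Unset Implicit Arguments.
Set Strict Implicit.
Set Printing Implicit Defensive.

Theorem lemma3p6 (R : realType) (n : nat) (Omega : set 'rV[R]_n)
    (gamma : R -> R) :
  (1 <= n <= 3)%N ->
  smooth_bounded_domain Omega ->
  Ck_halfline 3 gamma ->
  (forall s : R, 0 < s -> 0 < gamma s) ->
  (forall s : R, 0 < s -> derive1 gamma s <= 0) ->
  forall m : R, exists2 C : R, 0 < C &
    forall (u0 : 'rV[R]_n -> R) (mu : R) (T : \bar R)
           (u v : 'rV[R]_n -> R -> R) (v0 : 'rV[R]_n -> R),
      {within closure Omega, continuous u0} ->
      (forall x, closure Omega x -> 0 <= u0 x) ->
      (exists2 x, closure Omega x & u0 x != 0) ->
      L1norm Omega u0 = m ->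
      0 < mu ->
      maximal_classical_solution Omega gamma mu u0 T u v ->
      {within closure Omega, continuous v0} ->
      neumann_resolvent Omega u0 v0 ->
      forall (x : 'rV[R]_n) (t : R), Omega x -> time_co T t ->
        v x t <= v0 x + 1 + C / mu.
Proof.
move=> _ sO Cg gpos g' m.
have gle := halfline_nonincreasing Cg g'.
(* Positivity is assumed on the open half-line only; at 0 it follows from monotonicity, by
   comparison with [gamma (s + 1)]. *)
have g0 (s : R) : 0 <= s -> 0 < gamma s.
  move=> s0; apply: (lt_le_trans (gpos (s + 1) _)); first by rewrite ltr_wpDl.
  by apply: gle => //; rewrite lerDl.
exists (gamma 0); first exact: g0.
move=> u0 mu T u v v0 cu0 u00 _ _ mu0 [T0 sol _] cv0 res x t Ox Tt.
have [g [g1 [g2 [gE _ dg dg1]]]] := halfline_extension Cg.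
have u0O y : Omega y -> 0 <= u0 y by move=> Oy; apply: u00; exact: subset_closure.
rewrite -(solution_initial sO gE sol T0 cu0 cv0 res Ox) -addrA.
exact: (solution_growth sO gE dg dg1 sol g0 gle mu0 u0O Ox Tt).
Qed.
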